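(* For any $\lambda\in\mathbb{C}$ with $|\lambda|<1$ there exists an analytic expanding circle map $\tau$ such that, for the associated transfer operator $\mathcal{L}$ acting on $H^\infty(A)$ (where $A$ is an annulus admissible for $\tau$), the non-zero eigenvalues of $\mathcal{L}$ are precisely the non-zero numbers among all nonnegative powers of $\lambda$ and $\overline{\lambda}$; that is, the spectrum of $\mathcal{L}:H^\infty(A)\to H^\infty(A)$ is \[ \sigma(\mathcal{L})=\{\lambda^n : n\in\mathbb{N}_0\}\cup\{\overline{\lambda}^n : n\in\mathbb{N}\}\cup\{0\}. \] Moreover, the algebraic multiplicity of the leading eigenvalue ($=1$) is one, while the algebraic multiplicity of the remaining (non-zero) eigenvalues is two if $\lambda$ is real and one if $\lambda$ has nonvanishing imaginary part.
   Context: $\mathbb{N}=\{1,2,\dots\}$, $\mathbb{N}_0=\mathbb{N}\cup\{0\}$, $\mathbb{T}=\{z\in\mathbb{C}:|z|=1\}$. A map $\tau:\mathbb{T}\to\mathbb{T}$ is an analytic expanding circle map if $\tau$ is analytic on $\mathbb{T}$ (i.e. extends holomorphically to a neighbourhood of $\mathbb{T}$) and $\inf_{z\in\mathbb{T}}|\tau'(z)|>1$. Such a $\tau$ is a $K$-fold covering of $\mathbb{T}$ for some integer $K>1$; the analytic extensions of $\tau$ are also denoted $\tau$. For $0<r<1<R$ let $A_{r,R}=\{z\in\mathbb{C}: r<|z|<R\}$, and let $\mathcal{A}$ be the set of all $A_{r,R}$ on which $\tau$ is analytic. An annulus $A\in\mathcal{A}$ is called admissible for $\tau$ if there is $A_0\in\mathcal{A}$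 such that $\tau$ and $1/\tau$ are analytic on the closure $\mathrm{cl}(A_0)$, $\tau(\partial A_0)\cap \mathrm{cl}(A_0)=\emptyset$, $\mathrm{cl}(A_0)\subset A$, and $\tau(\partial A_0)\cap \mathrm{cl}(A)=\emptyset$. $H^\infty(A)$ is the Banach space of bounded holomorphic functions on $A$ with the supremum norm. The transfer operator associated with $\tau$ is \[(\mathcal{L}f)(z)=\sum_{k=1}^K \phi_k'(z)\,f(\phi_k(z))\quad (z\in\mathbb{T}),\] where $\phi_1,\dots,\phi_K$ are the local inverse branches of $\tau$. For $f\in H^\infty(A)$ with $A$ admissible, $\mathcal{L}(f|_{\mathbb{T}})$ extends uniquely to an element of $H^\infty(A)$, again denoted $\mathcal{L}f$; this gives a compact operator $\mathcal{L}:H^\infty(A)\to H^\infty(A)$.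
   Formalization: When λ has nonvanishing imaginary part, the formal statement gives algebraic multiplicity one only to non-real eigenvalues; a real non-zero eigenvalue other than 1 (where λ^n equals its conjugate) gets multiplicity two, since ''one'' fails there, e.g. for λ=4i/5. *)

(* Defs.v *)
From HB Require Import structures.
From mathcomp Require Import all_boot all_order all_algebra.
From mathcomp Require Import complex.
From mathcomp Require Import all_classical all_reals all_analysis.

Set Implicit Arguments.
Unset Strict Implicit.
Unset Printing Implicit Defensive.

Import Order.TTheory GRing.Theory Num.Theory.
Import numFieldNormedType.Exports.

Local Open Scope classical_set_scope.
Local Open Scope ring_scope.

(* The topology of R[i] is the one of its complex-valued norm, so that
   derivable f z 1 is complex differentiability of f at z. *)
HB.instance Definition _ (R : realType) := NormedModule.copy R[i] R[i]^o.

Definition cabs (R : realType) (z : R[i]) : R := ComplexField.Normc.normc z.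

Lemma cabsE (R : realType) (z : R[i]) : (cabs z)%:C%C = `|z|.
Proof. by []. Qed.

Definition unit_circle (R : realType) : set R[i] := [set z | cabs z = 1].

Definition annulus (R : realType) (r1 r2 : R) : set R[i] :=
  [set z | r1 < cabs z < r2].

Definition frontier (T : topologicalType) (A : set T) : set T :=
  closure A `\` A°.

Definition holomorphic_on (R : realType) (U : set R[i]) (f : R[i] -> R[i]) :=
  forall z, U z -> derivable f z 1.

Definition analytic_on (R : realType) (B : set R[i]) (f : R[i] -> R[i]) :=
  exists U : set R[i], [/\ open U, B `<=` U & holomorphic_on U f].

(* A circle map is a function on R[i] of which only the values on the unit
   circle matter; its analytic extensions are kept as separate functions. *)
Definition extends_circle_map (R : realType) (tau F : R[i] -> R[i]) :=
  forall z, unit_circle z -> F z = tau z.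

Definition analytic_expanding_circle_map (R : realType) (tau : R[i] -> R[i]) :=
  (forall z, unit_circle z -> unit_circle (tau z)) /\
  exists F : R[i] -> R[i],
    [/\ extends_circle_map tau F, analytic_on (@unit_circle R) F
      & 1 < inf [set cabs (derive1 F z) | z in @unit_circle R]].

Definition admissible (R : realType) (tau : R[i] -> R[i]) (r1 r2 : R) :=
  [/\ 0 < r1 < 1, 1 < r2 &
    exists F : R[i] -> R[i],
      [/\ extends_circle_map tau F, holomorphic_on (annulus r1 r2) F &
        exists s1 s2 : R,
          let A0 := annulus s1 s2 in
          [/\ 0 < s1 < 1 /\ 1 < s2,
              analytic_on (closure A0) F /\
              analytic_on (closure A0) (fun z => (F z)^-1),
              F @` frontier A0 `&` closure A0 = set0,
              closure A0 `<=` annulus r1 r2 &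
              F @` frontier A0 `&` closure (annulus r1 r2) = set0]]].

Section bounded_holomorphic.
Variables (R : realType) (A : set R[i]).

(* Functions on A are represented by their extension by zero to R[i], so that
   equality of representatives is equality on A. *)
Definition bounded_holomorphic : {pred R[i] -> R[i]} := fun f =>
  `[< [/\ holomorphic_on A f, has_ubound [set cabs (f z) | z in A]
        & forall z, ~ A z -> f z = 0] >].

Record Hinf : predArgType := MkHinf {
  Hinf_fun :> R[i] -> R[i];
  _ : Hinf_fun \in bounded_holomorphic }.

HB.instance Definition _ := [isSub for Hinf_fun].
HB.instance Definition _ := [Choice of Hinf by <:].

Lemma cabs_ge0 (z : R[i]) : 0 <= cabs z.
Proof. by rewrite -lecR cabsE normr_ge0. Qed.

Lemma cabs_normD (z w : R[i]) : cabs (z + w) <= cabs z + cabs w.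
Proof. by rewrite -lecR rmorphD /= !cabsE ler_normD. Qed.

Lemma cabsM (z w : R[i]) : cabs (z * w) = cabs z * cabs w.
Proof. exact: ComplexField.Normc.normcM. Qed.

Lemma cabs0 : cabs (0 : R[i]) = 0.
Proof. exact: ComplexField.Normc.normc0. Qed.

Lemma bounded_holomorphic_submod : submod_closed bounded_holomorphic.
Proof.
split=> [|a f g /asboolP[hf [M Mf] f0] /asboolP[hg [N Ng] g0]]; apply/asboolP.
  split=> //.
  by exists 0; move=> _ [z _ <-]; rewrite cabs0.
split.
- by move=> z Az; apply: derivableD; [apply: derivableZ; exact: hf|exact: hg].
- exists (cabs a * M + N); move=> _ [z Az <-].
  rewrite (le_trans (cabs_normD _ _))// lerD//; last by apply: Ng; exists z.
  rewrite [X in cabs X](_ : _ = a * f z)// cabsM ler_wpM2l ?cabs_ge0//.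
  by apply: Mf; exists z.
- move=> z nAz; rewrite [LHS](_ : _ = a * f z + g z)//.
  by rewrite f0// g0// mulr0 addr0.
Qed.

HB.instance Definition _ :=
  GRing.isSubmodClosed.Build _ _ bounded_holomorphic bounded_holomorphic_submod.
HB.instance Definition _ := [SubChoice_isSubLmodule of Hinf by <:].

Lemma HinfD (f g : Hinf) z : (f + g) z = f z + g z. Proof. by []. Qed.
Lemma HinfZ a (f : Hinf) z : (a *: f) z = a * f z. Proof. by []. Qed.

Definition Hinf_supnorm (f : Hinf) : R := sup [set cabs (f z) | z in A].

Lemma Hinf_ub (f : Hinf) : has_ubound [set cabs (f z) | z in A].
Proof. by case: f => f /= /asboolP[]. Qed.

Lemma Hinf_out (f : Hinf) z : ~ A z -> f z = 0.
Proof. by case: f => f /= /asboolP[_ _]; apply. Qed.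

Lemma Hinf_sup0 : A = set0 -> forall f, Hinf_supnorm f = 0.
Proof. by move=> A0 f; rewrite /Hinf_supnorm A0 image_set0 sup0. Qed.

Lemma Hinf_le (f : Hinf) z : A z -> cabs (f z) <= Hinf_supnorm f.
Proof. by move=> Az; apply: ub_le_sup; [exact: Hinf_ub|exists z]. Qed.

Lemma Hinf_ge (f : Hinf) M : A !=set0 ->
  (forall z, A z -> cabs (f z) <= M) -> Hinf_supnorm f <= M.
Proof.
move=> [z Az] fM; apply: ge_sup; first by exists (cabs (f z)), z.
by move=> _ [w Aw <-]; exact: fM.
Qed.

Definition Hinf_norm (f : Hinf) : R[i] := (Hinf_supnorm f)%:C%C.

Lemma Hinf_normD f g : Hinf_norm (f + g) <= Hinf_norm f + Hinf_norm g.
Proof.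
rewrite /Hinf_norm -rmorphD lecR.
have [/Hinf_sup0 s0|/set0P A0] := eqVneq A set0; first by rewrite !s0 addr0.
apply: Hinf_ge => // z Az.
by rewrite HinfD (le_trans (cabs_normD _ _))// lerD// Hinf_le.
Qed.

Lemma Hinf_supnorm_ge0 f : 0 <= Hinf_supnorm f.
Proof.
have [/Hinf_sup0 ->//|/set0P [z Az]] := eqVneq A set0.
exact: le_trans (cabs_ge0 _) (Hinf_le f Az).
Qed.

Lemma Hinf_normZ (l : R[i]) f : Hinf_norm (l *: f) = `|l| * Hinf_norm f.
Proof.
rewrite /Hinf_norm -cabsE -rmorphM; congr (_%:C)%C.
have [/Hinf_sup0 s0|/set0P A0] := eqVneq A set0; first by rewrite !s0 mulr0.
apply/eqP; rewrite eq_le; apply/andP; split.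
  apply: Hinf_ge => // z Az.
  by rewrite HinfZ cabsM ler_wpM2l ?cabs_ge0// Hinf_le.
have [->|l0] := eqVneq l 0; first by rewrite cabs0 mul0r Hinf_supnorm_ge0.
have cl0 : 0 < cabs l.
  rewrite lt_def cabs_ge0 andbT; apply: contra l0 => /eqP.
  by move/ComplexField.Normc.eq0_normc ->.
rewrite mulrC -ler_pdivlMr//; apply: Hinf_ge => // z Az.
by rewrite ler_pdivlMr// mulrC -cabsM -HinfZ Hinf_le.
Qed.

Lemma Hinf_norm_eq0 f : Hinf_norm f = 0 -> f = 0.
Proof.
move=> [f0]; apply/val_inj/funext => z /=.
have [Az|nAz] := pselect (A z); last exact: Hinf_out.
apply: ComplexField.Normc.eq0_normc; apply/eqP.
by rewrite eq_le cabs_ge0 andbT -f0 Hinf_le.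
Qed.

HB.instance Definition _ := Lmodule_isNormed.Build R[i] Hinf
  Hinf_normD Hinf_normZ Hinf_norm_eq0.

End bounded_holomorphic.

(* The conditions on phi only involve tau on the circle; they determine the
   holomorphic germs phi k at z0. *)
Definition local_inverse_branches (R : realType) (tau : R[i] -> R[i])
    (z0 : R[i]) (K : nat) (phi : 'I_K -> R[i] -> R[i]) :=
  exists U : set R[i],
    [/\ open U, U z0,
        forall k, holomorphic_on U (phi k),
        forall k z, U z -> unit_circle z ->
          unit_circle (phi k z) /\ tau (phi k z) = z &
        forall z, U z -> unit_circle z ->
          injective (fun k => phi k z) /\
          forall w, unit_circle w -> tau w = z -> exists k, w = phi k z].

Definition is_transfer_operator (R : realType) (tau : R[i] -> R[i])
    (A : set R[i]) (L : Hinf A -> Hinf A) :=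
  exists2 K : nat, (1 < K)%N &
    forall z, unit_circle z -> exists phi : 'I_K -> R[i] -> R[i],
      local_inverse_branches tau z phi /\
      forall f : Hinf A, L f z = \sum_(k < K) derive1 (phi k) z * f (phi k z).

Section spectral_theory.
Variables (K : numFieldType) (V : normedModType K).
Implicit Types (L : V -> V) (mu : K) (m : nat).

Definition resolvent_set L : set K :=
  [set mu | exists S : {linear V -> V}, [/\ continuous S,
     cancel (fun f => mu *: f - L f) S & cancel S (fun f => mu *: f - L f)]].

Definition spectrum L : set K := ~` resolvent_set L.

Definition eigenvalues L : set K :=
  [set mu | exists2 f, f != 0 & L f = mu *: f].

Definition generalized_eigenspace L mu : set V :=
  [set f | exists n, iter n (fun g => L g - mu *: g) f = 0].

Definition has_dimension (W : set V) m :=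
  exists b : 'I_m -> V,
    let comb := fun c : {ffun 'I_m -> K} => \sum_i c i *: b i in
    injective comb /\ range comb = W.

Definition algebraic_multiplicity L mu m :=
  has_dimension (generalized_eigenspace L mu) m.

End spectral_theory.

(* Main.v *)
(* The map is the Blaschke product tau z = z (z + lambda) / (1 + lambda^* z), whose
   fixed points 0 and infinity have multipliers lambda and lambda^*.  On an admissible
   annulus there are circles |w| = s2 and |w| = s1 with |tau w| > r2 and |tau w| < r1,
   and Cauchy's formula turns the transfer operator into the difference of the means of
   f w * w / (tau w - z) over these two circles.  Expanding the two kernels into geometric
   series in z and 1/z shows that L f = \sum_i c_i(f) e_i, where the e_i are the Laurent
   monomials and the norms of c_i and e_i have geometrically decaying product; moreover
   c_i(e_j) = 0 for i > j in a suitable enumeration, and the diagonal entries c_i(e_i) are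
   1, lambda^*, lambda, lambda^*^2, lambda^2, etc.

   For such a triangular sum of rank one operators P_i = c_i(.) e_i and for N large,
   1 - L/mu = (1 - T/mu) (1 - P_(N-1)/mu) ... (1 - P_0/mu) with T = \sum_(i >= N) P_i of
   norm less than |mu|, so that mu is in the resolvent set as soon as mu <> 0 is not a
   diagonal entry.  Generalized eigenvectors lie in the span of e_0, ..., e_(N-1), where
   multiplicities are read off the diagonal.

   Cauchy's formula on annuli is derived from Goursat's bisection argument in the
   logarithmic coordinate, with integrals replaced by limits of dyadic averages. *)

Require Import Defs.
From HB Require Import structures.
From mathcomp Require Import all_boot all_order all_algebra.
From mathcomp Require Import complex.
From mathcomp Require Import all_classical all_reals all_analysis.
From mathcomp Require Import ring lra.

Set Implicit Arguments.
Unset Strict Implicit.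
Unset Printing Implicit Defensive.

Import Order.TTheory GRing.Theory Num.Theory.
Import numFieldNormedType.Exports.

Local Open Scope classical_set_scope.
Local Open Scope ring_scope.

(** * Complex modulus and differentiability *)

Section ComplexModulus.
Variable R : realType.
Implicit Types (z w : R[i]) (x y : R).

Lemma cabs1 : cabs (1 : R[i]) = 1.
Proof. exact: ComplexField.Normc.normc1. Qed.

Lemma cabsN z : cabs (- z) = cabs z.
Proof. exact: normcN. Qed.

Lemma cabsV z : cabs z^-1 = (cabs z)^-1.
Proof. exact: ComplexField.Normc.normcV. Qed.

Lemma cabs_div z w : cabs (z / w) = cabs z / cabs w.
Proof. by rewrite cabsM cabsV. Qed.

Lemma cabsX z n : cabs (z ^+ n) = cabs z ^+ n.
Proof. by elim: n => [|n IH]; rewrite ?expr0 ?cabs1// !exprS cabsM IH. Qed.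

Lemma cabs_eq0 z : (cabs z == 0) = (z == 0).
Proof.
apply/eqP/eqP => [|->]; last exact: cabs0.
exact: ComplexField.Normc.eq0_normc.
Qed.

Lemma cabs_gt0 z : (0 < cabs z) = (z != 0).
Proof. by rewrite lt_def cabs_ge0 andbT cabs_eq0. Qed.

Lemma cabs_distC z w : cabs (z - w) = cabs (w - z).
Proof. by rewrite -cabsN opprB. Qed.

Lemma cabsB z w : cabs (z - w) <= cabs z + cabs w.
Proof. by rewrite (le_trans (cabs_normD _ _))// cabsN. Qed.

Lemma cabs_lerB z w : cabs z - cabs w <= cabs (z - w).
Proof. by rewrite lerBlDr -{1}(subrK w z) cabs_normD. Qed.

Lemma cabs_lerB' z w : cabs w - cabs z <= cabs (z - w).
Proof. by rewrite cabs_distC cabs_lerB. Qed.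

Lemma cabs_real x : cabs (x%:C)%C = `|x|.
Proof. by rewrite /cabs /= expr0n /= addr0 sqrtr_sqr. Qed.

Lemma cabs_nat n : cabs (n%:R : R[i]) = n%:R.
Proof.
have -> : (n%:R : R[i]) = ((n%:R : R)%:C)%C by rewrite rmorph_nat.
by rewrite cabs_real normr_nat.
Qed.

Lemma cabs_sum (I : Type) (s : seq I) (F : I -> R[i]) :
  cabs (\sum_(i <- s) F i) <= \sum_(i <- s) cabs (F i).
Proof.
elim/big_rec2: _ => [|i y x _ IH]; first by rewrite cabs0.
by rewrite (le_trans (cabs_normD _ _))// lerD2l.
Qed.

Lemma cabs_Re z : `|complex.Re z| <= cabs z.
Proof.
case: z => a b; rewrite /cabs /= -sqrtr_sqr ler_wsqrtr//.
by rewrite lerDl sqr_ge0.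
Qed.

Lemma cabs_Im z : `|complex.Im z| <= cabs z.
Proof.
case: z => a b; rewrite /cabs /= -sqrtr_sqr ler_wsqrtr//.
by rewrite lerDr sqr_ge0.
Qed.

Lemma cabs_le_ReIm z : cabs z <= `|complex.Re z| + `|complex.Im z|.
Proof.
rewrite {1}[z]complexE (le_trans (cabs_normD _ _))// cabsM !cabs_real.
suff -> : cabs ('i%C : R[i]) = 1 by rewrite mul1r.
by rewrite /cabs /= expr0n /= add0r expr1n sqrtr1.
Qed.

Lemma cabs_conj z : cabs (z^*)%C = cabs z.
Proof. by case: z => a b; rewrite /cabs /= sqrrN. Qed.

Lemma cabs_sqr z : cabs z ^+ 2 = complex.Re z ^+ 2 + complex.Im z ^+ 2.
Proof. by case: z => a b; rewrite /cabs /= sqr_sqrtr// addr_ge0// sqr_ge0. Qed.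

Lemma mulcJ z : z * (z^*)%C = (cabs z ^+ 2)%:C%C.
Proof.
rewrite cabs_sqr; case: z => a b; simpc => /=.
by congr (_ +i* _)%C; ring.
Qed.

Lemma cabs_small_eq0 z : (forall e : R, 0 < e -> cabs z <= e) -> z = 0.
Proof.
move=> h; apply/eqP; rewrite -cabs_eq0 eq_le cabs_ge0 andbT.
by apply/ler_addgt0Pr => e e0; rewrite add0r h.
Qed.

Lemma cabs_close_eq z w : (forall e : R, 0 < e -> cabs (z - w) <= e) -> z = w.
Proof. by move=> h; apply/eqP; rewrite -subr_eq0; apply/eqP/cabs_small_eq0. Qed.

Lemma ReB z w : complex.Re (z - w) = complex.Re z - complex.Re w.
Proof. by case: z; case: w. Qed.

Lemma ImB z w : complex.Im (z - w) = complex.Im z - complex.Im w.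
Proof. by case: z; case: w. Qed.

Lemma ccomplete (u : nat -> R[i]) :
  (forall e : R, 0 < e -> exists N, forall n, (N <= n)%N -> cabs (u n - u N) <= e) ->
  exists l, forall e : R, 0 < e -> exists N, forall n, (N <= n)%N -> cabs (u n - l) <= e.
Proof.
move=> hu.
have cv (p : R[i] -> R) : (forall z w, `|p z - p w| <= cabs (z - w)) ->
    exists l, forall e : R, 0 < e -> exists N, forall n, (N <= n)%N -> `|p (u n) - l| <= e.
  move=> hp.
  have /cvg_ex[l /cvgrPdist_le hl] : cvgn (p \o u).
    apply/cauchy_cvgP/cauchy_exP => e e0.
    have [N hN] := hu _ (divr_gt0 e0 (ltr0n R 2)).
    exists (p (u N)); exists N => // n /= Nn.
    rewrite /ball /= distrC (le_lt_trans (hp _ _))// (le_lt_trans (hN _ Nn))//.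
    by lra.
  by exists l => e /hl[N _ hN]; exists N => n /hN; rewrite distrC.
have [|a ha] := cv (@complex.Re R); first by move=> z w; rewrite -ReB cabs_Re.
have [|b hb] := cv (@complex.Im R); first by move=> z w; rewrite -ImB cabs_Im.
exists (a +i* b)%C => e e0.
have [N1 h1] := ha _ (divr_gt0 e0 (ltr0n R 2)).
have [N2 h2] := hb _ (divr_gt0 e0 (ltr0n R 2)).
exists (maxn N1 N2) => n; rewrite geq_max => /andP[/h1 {}h1 /h2 {}h2].
apply: le_trans (cabs_le_ReIm _) _.
rewrite ReB ImB /=; by move: h1 h2; lra.
Qed.

End ComplexModulus.

Section ComplexDifferentiability.
Variable R : realType.
Implicit Types (f g : R[i] -> R[i]) (z w d : R[i]).

Definition ccont f z := forall e : R, 0 < e ->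
  exists2 r : R, 0 < r & forall w, cabs (w - z) < r -> cabs (f w - f z) < e.

(* Caratheodory's form of complex differentiability. *)
Definition cdiff f z d := exists q,
  [/\ ccont q z, q z = d & forall w, f w - f z = q w * (w - z)].

Lemma ccont_cst d z : ccont (fun=> d) z.
Proof. by move=> e e0; exists 1 => // w _; rewrite subrr cabs0. Qed.

Lemma ccont_id z : ccont id z.
Proof. by move=> e e0; exists e. Qed.

Lemma ccontD f g z : ccont f z -> ccont g z -> ccont (fun w => f w + g w) z.
Proof.
move=> hf hg e e0; have e2 : 0 < e / 2 by lra.
have [r1 r10 h1] := hf _ e2; have [r2 r20 h2] := hg _ e2.
exists (Num.min r1 r2); first by rewrite lt_min r10.
move=> w; rewrite lt_min => /andP[/h1 {}h1 /h2 {}h2].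
by rewrite opprD addrACA (le_lt_trans (cabs_normD _ _))//; lra.
Qed.

Lemma ccontN f z : ccont f z -> ccont (fun w => - f w) z.
Proof.
move=> hf e /hf[r r0 h]; exists r => // w /h.
by rewrite -opprD cabsN.
Qed.

Lemma ccontB f g z : ccont f z -> ccont g z -> ccont (fun w => f w - g w) z.
Proof. by move=> hf hg; apply: ccontD => //; exact: ccontN. Qed.

Lemma ccontM f g z : ccont f z -> ccont g z -> ccont (fun w => f w * g w) z.
Proof.
move=> hf hg e e0.
pose A := cabs (f z) + 1; pose B := cabs (g z) + 1.
have A0 : 0 < A by rewrite ltr_wpDl ?cabs_ge0.
have B0 : 0 < B by rewrite ltr_wpDl ?cabs_ge0.
have [r1 r10 h1] := hf _ (divr_gt0 e0 (mulr_gt0 (ltr0n R 2) B0)).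
have [r2 r20 h2] := hg _ (divr_gt0 e0 (mulr_gt0 (ltr0n R 2) A0)).
have [r3 r30 h3] := hg _ ltr01.
exists (Num.min r1 (Num.min r2 r3)); first by rewrite !lt_min r10 r20.
move=> w; rewrite !lt_min => /and3P[/h1 {}h1 /h2 {}h2 /h3 {}h3].
have -> : f w * g w - f z * g z = (f w - f z) * g w + f z * (g w - g z) by ring.
rewrite (le_lt_trans (cabs_normD _ _))// !cabsM.
have gB : cabs (g w) <= B.
  by rewrite -[g w](subrK (g z)) (le_trans (cabs_normD _ _))// addrC lerD2l ltW.
have hA : cabs (f z) <= A by rewrite lerDl.
have -> : e = e / (2 * B) * B + A * (e / (2 * A)) by field; rewrite !gt_eqF.
apply: ltr_leD; last by rewrite ler_pM ?cabs_ge0// ltW.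
by rewrite (@le_lt_trans _ _ (cabs (f w - f z) * B)) ?ltr_pM2r// ler_wpM2l ?cabs_ge0.
Qed.

Lemma ccontV f z : ccont f z -> f z != 0 -> ccont (fun w => (f w)^-1) z.
Proof.
move=> hf f0 e e0.
pose m := cabs (f z); have m0 : 0 < m by rewrite cabs_gt0.
have m2 : 0 < m / 2 by lra.
have [r1 r10 h1] := hf _ m2.
have [r2 r20 h2] := hf _ (mulr_gt0 e0 (mulr_gt0 m2 m0)).
exists (Num.min r1 r2); first by rewrite lt_min r10.
move=> w; rewrite lt_min => /andP[/h1 {}h1 /h2 {}h2].
have fw : m / 2 < cabs (f w).
  have := cabs_lerB' (f w) (f z); rewrite -/m; move: h1; lra.
have fw0 : f w != 0 by rewrite -cabs_gt0; lra.
have -> : (f w)^-1 - (f z)^-1 = (f z - f w) / (f w * f z).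
  by field; rewrite f0 fw0.
rewrite cabs_div cabs_distC cabsM ltr_pdivrMr; last by rewrite mulr_gt0// cabs_gt0.
by rewrite (lt_trans h2)// ltr_pM2l// ltr_pM2r.
Qed.

Lemma ccont_comp f g z : ccont f z -> ccont g (f z) -> ccont (fun w => g (f w)) z.
Proof.
move=> hf hg e /hg[r r0 h]; have [s s0 hs] := hf _ r0.
by exists s => // w /hs/h.
Qed.

Lemma ccontX f z n : ccont f z -> ccont (fun w => f w ^+ n) z.
Proof.
move=> hf; elim: n => [|n IH].
  by under eq_fun do rewrite expr0; exact: ccont_cst.
by under eq_fun do rewrite exprS; exact: ccontM.
Qed.

Lemma ccont_near f g z (r : R) : 0 < r -> (forall w, cabs (w - z) < r -> f w = g w) ->
  ccont f z -> ccont g z.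
Proof.
move=> r0 fg hf e /hf[s s0 h]; exists (Num.min r s); first by rewrite lt_min r0.
move=> w; rewrite lt_min => /andP[wr ws].
by rewrite -!fg ?subrr ?cabs0//; exact: h.
Qed.

Lemma cdiff_cont f z d : cdiff f z d -> ccont f z.
Proof.
move=> [q [hq _ hf]].
have -> : f = (fun w => f z + q w * (w - z)) by apply/funext => w; rewrite -hf addrC subrK.
apply: ccontD; first exact: ccont_cst.
apply: ccontM => //; apply: ccontB; [exact: ccont_id|exact: ccont_cst].
Qed.

Lemma cdiff_cst d z : cdiff (fun=> d) z 0.
Proof.
by exists (fun=> 0); split=> //; [exact: ccont_cst|move=> w; rewrite subrr mul0r].
Qed.

Lemma cdiff_id z : cdiff id z 1.
Proof.
by exists (fun=> 1); split=> //; [exact: ccont_cst|move=> w; rewrite mul1r].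
Qed.

Lemma cdiffD f g z d d' : cdiff f z d -> cdiff g z d' ->
  cdiff (fun w => f w + g w) z (d + d').
Proof.
move=> [p [hp <- fp]] [q [hq <- gq]]; exists (fun w => p w + q w).
split=> //; first exact: ccontD.
by move=> w; rewrite mulrDl -fp -gq; ring.
Qed.

Lemma cdiffN f z d : cdiff f z d -> cdiff (fun w => - f w) z (- d).
Proof.
move=> [p [hp <- fp]]; exists (fun w => - p w).
by split=> //; [exact: ccontN|move=> w; rewrite mulNr -fp opprD].
Qed.

Lemma cdiffB f g z d d' : cdiff f z d -> cdiff g z d' ->
  cdiff (fun w => f w - g w) z (d - d').
Proof. by move=> hf hg; apply: cdiffD => //; exact: cdiffN. Qed.

Lemma cdiffM f g z d d' : cdiff f z d -> cdiff g z d' ->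
  cdiff (fun w => f w * g w) z (d * g z + f z * d').
Proof.
move=> hf hg; have cg := cdiff_cont hg; move: hf hg.
move=> [p [hp <- fp]] [q [hq <- gq]]; exists (fun w => p w * g w + f z * q w).
split=> //.
- by apply: ccontD; apply: ccontM => //; exact: ccont_cst.
- move=> w; have -> : f w * g w - f z * g z = (f w - f z) * g w + f z * (g w - g z) by ring.
  by rewrite fp gq; ring.
Qed.

Lemma cdiffV f z d : cdiff f z d -> f z != 0 ->
  cdiff (fun w => (f w)^-1) z (- d / f z ^+ 2).
Proof.
move=> hf f0; have cf := cdiff_cont hf; move: hf => [p [hp <- fp]].
pose k w := if f w == 0 then ((f w)^-1 - (f z)^-1) / (w - z) else - p w / (f w * f z).
have m0 : 0 < cabs (f z) by rewrite cabs_gt0.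
have [r r0 hr] := cf _ m0.
have nz w : cabs (w - z) < r -> f w != 0.
  move=> /hr h; apply: contraTneq h => ->.
  by rewrite sub0r cabsN ltxx.
exists k; split.
- apply: (@ccont_near (fun w => - p w / (f w * f z)) _ _ r) => //.
    by move=> w /nz/negPf; rewrite /k => ->.
  apply: ccontM; first exact: ccontN.
  apply: ccontV; last by rewrite mulf_neq0.
  by apply: ccontM => //; exact: ccont_cst.
- by rewrite /k (negPf f0) expr2.
- move=> w; rewrite /k; case: ifPn => [|fw].
    have [->|wz] := eqVneq w z; first by rewrite (negPf f0).
    by move=> _; rewrite divfK// subr_eq0.
  have -> : - p w / (f w * f z) * (w - z) = - (p w * (w - z)) / (f w * f z) by ring.
  by rewrite -fp; field; rewrite fw f0.
Qed.

Lemma cdiff_comp f g z d d' : cdiff f z d -> cdiff g (f z) d' ->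
  cdiff (fun w => g (f w)) z (d' * d).
Proof.
move=> hf hg; have cf := cdiff_cont hf; move: hf hg.
move=> [p [hp <- fp]] [q [hq <- gq]]; exists (fun w => q (f w) * p w); split=> //.
- by apply: ccontM => //; exact: ccont_comp.
- by move=> w; rewrite gq fp mulrA.
Qed.

Lemma cdiffX f z d n : cdiff f z d -> exists d', cdiff (fun w => f w ^+ n) z d'.
Proof.
move=> hf; elim: n => [|n [d' IH]].
  by exists 0; under eq_fun do rewrite expr0; exact: cdiff_cst.
by eexists; under eq_fun do rewrite exprS; apply: cdiffM; eassumption.
Qed.

Lemma cdiff_near f g z d (r : R) : 0 < r ->
  (forall w, cabs (w - z) < r -> f w = g w) -> cdiff f z d -> cdiff g z d.
Proof.
move=> r0 fg [p [hp pd fp]].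
have fgz : f z = g z by apply: fg; rewrite subrr cabs0.
exists (fun w => if cabs (w - z) < r then p w else (g w - g z) / (w - z)); split.
- by apply: ccont_near r0 _ hp => w ->.
- by rewrite subrr cabs0 r0.
- move=> w; case: ifPn => [wr|]; first by rewrite -fg// -fgz fp.
  have [->|wz] := eqVneq w z; first by rewrite subrr cabs0 r0.
  by rewrite divfK// subr_eq0.
Qed.

Lemma cdiffP f z d : cdiff f z d <-> forall e : R, 0 < e -> exists2 r : R, 0 < r &
  forall w, cabs (w - z) < r -> cabs (f w - f z - d * (w - z)) <= e * cabs (w - z).
Proof.
split=> [[p [hp <- fp]] e /hp[r r0 h]|h].
  exists r => // w /h /ltW wr; rewrite fp -mulrBl cabsM ler_wpM2r//.
  exact: cabs_ge0.
exists (fun w => if w == z then d else (f w - f z) / (w - z)); split.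
- move=> e e0; have e2 : 0 < e / 2 by lra.
  have [r r0 hr] := h _ e2; exists r => // w wr; rewrite eqxx.
  have [_|wz] := eqVneq w z; first by rewrite subrr cabs0.
  rewrite (@le_lt_trans _ _ (e / 2))//; last by lra.
  have wz0 : 0 < cabs (w - z) by rewrite cabs_gt0 subr_eq0.
  rewrite -(ler_pM2r wz0) -cabsM mulrBl divfK ?subr_eq0//.
  exact: hr.
- by rewrite eqxx.
- move=> w; have [->|wz] := eqVneq w z; first by rewrite !subrr mulr0.
  by rewrite divfK// subr_eq0.
Qed.

End ComplexDifferentiability.

Section ComplexTopology.
Variable R : realType.
Implicit Types (f g : R[i] -> R[i]) (z w d : R[i]).

Lemma pos_complex (e : R[i]) : 0 < e -> exists2 r : R, 0 < r & e = (r%:C)%C.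
Proof.
case: e => a b; rewrite ltcE /= => /andP[/eqP b0 a0].
by exists a => //; rewrite b0.
Qed.

Lemma nbhs_cabs z (A : set R[i]) : nbhs z A <->
  exists2 r : R, 0 < r & forall w, cabs (w - z) < r -> A w.
Proof.
split=> [/nbhs_ballP[e /= /pos_complex[r r0 ->] h]|[r r0 h]].
  exists r => // w wr; apply: h; rewrite /ball /=.
  by rewrite -cabsE ltcR cabs_distC.
apply/nbhs_ballP; exists (r%:C)%C; first by rewrite /= ltcR.
move=> w; rewrite /ball /= -cabsE ltcR => wr.
by apply: h; rewrite cabs_distC.
Qed.

Lemma cabs_open (U : set R[i]) : (forall z, U z ->
  exists2 r : R, 0 < r & forall w, cabs (w - z) < r -> U w) -> open U.
Proof. by move=> h; rewrite openE => z /h /nbhs_cabs. Qed.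

Lemma closure_cabs (A : set R[i]) z : closure A z <->
  forall r : R, 0 < r -> exists2 w, A w & cabs (w - z) < r.
Proof.
split=> [h r r0|h B /nbhs_cabs[r /h[w Aw wr] hB]].
  have /h[w [Aw wr]] : nbhs z [set w | cabs (w - z) < r] by apply/nbhs_cabs; exists r.
  by exists w.
by exists w; split=> //; exact: hB.
Qed.

Lemma cdiff_derivable f z d : cdiff f z d ->
  (fun h : R[i] => h^-1 *: (f (h *: 1 + z) - f z)) @ 0^' --> d.
Proof.
move=> /cdiffP h; apply/cvgrPdist_lt => e /pos_complex[r r0 ->].
have r2 : 0 < r / 2 by lra.
have [s s0 hs] := h _ r2.
apply/nbhs_cabs; exists s => // k; rewrite subr0 => ks k0.
have -> : k *: 1 = k by rewrite /GRing.scale /= mulr1.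
have := hs (k + z); rewrite addrK => /(_ ks) hk.
rewrite -cabsE ltcR cabs_distC.
have -> : k^-1 *: (f (k + z) - f z) - d = k^-1 * (f (k + z) - f z - d * k).
  by rewrite /GRing.scale /= [in RHS]mulrBr mulrCA mulVf// mulr1.
have ck : 0 < cabs k by rewrite cabs_gt0.
rewrite cabsM cabsV mulrC ltr_pdivrMr// (le_lt_trans hk)// ltr_pM2r//.
by lra.
Qed.

Definition cdiffs f z := exists d, cdiff f z d.

Lemma derivable_cdiffs f z : derivable f z 1 <-> cdiffs f z.
Proof.
split=> [/cvg_ex[d /cvgrPdist_lt hd]|[d /cdiff_derivable hd]]; last by apply/cvg_ex; exists d.
exists d; apply/cdiffP => e e0.
have /nbhs_cabs[r r0 hr] := hd (e%:C)%C (eq_ind_r is_true e0 (ltcR 0 e)).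
exists r => // w wr.
have [->|wz] := eqVneq w z; first by rewrite !subrr mulr0 subr0 cabs0 mulr0.
have wz0 : w - z != 0 by rewrite subr_eq0.
have := hr (w - z); rewrite subr0 => /(_ wr wz0).
have -> : (w - z) *: 1 = w - z by rewrite /GRing.scale /= mulr1.
rewrite /= subrK -cabsE ltcR (cabs_distC d).
rewrite [X in cabs X](_ : _ = (w - z)^-1 * (f w - f z - d * (w - z))); last first.
  by rewrite /GRing.scale /= [in RHS]mulrBr mulrCA mulVf// mulr1.
rewrite cabsM cabsV mulrC ltr_pdivrMr ?cabs_gt0//.
exact: ltW.
Qed.

Lemma cdiff_derive1 f z d : cdiff f z d -> derive1 f z = d.
Proof.
move=> /cdiff_derivable hd; rewrite derive1E /derive.
by apply: cvg_lim hd; exact: norm_hausdorff.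
Qed.

Lemma cdiffs_cont f z : cdiffs f z -> ccont f z.
Proof. by case=> d; exact: cdiff_cont. Qed.

Lemma cdiffs_cst d z : cdiffs (fun=> d) z.
Proof. by exists 0; exact: cdiff_cst. Qed.

Lemma cdiffs_id z : cdiffs id z.
Proof. by exists 1; exact: cdiff_id. Qed.

Lemma cdiffsD f g z : cdiffs f z -> cdiffs g z -> cdiffs (fun w => f w + g w) z.
Proof. by move=> [a ha] [b hb]; eexists; apply: cdiffD ha hb. Qed.

Lemma cdiffsB f g z : cdiffs f z -> cdiffs g z -> cdiffs (fun w => f w - g w) z.
Proof. by move=> [a ha] [b hb]; eexists; apply: cdiffB ha hb. Qed.

Lemma cdiffsM f g z : cdiffs f z -> cdiffs g z -> cdiffs (fun w => f w * g w) z.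
Proof. by move=> [a ha] [b hb]; eexists; apply: cdiffM ha hb. Qed.

Lemma cdiffsV f z : cdiffs f z -> f z != 0 -> cdiffs (fun w => (f w)^-1) z.
Proof. by move=> [a ha] f0; eexists; apply: cdiffV ha f0. Qed.

Lemma cdiffsX f z n : cdiffs f z -> cdiffs (fun w => f w ^+ n) z.
Proof. by move=> [a ha]; have [d hd] := cdiffX n ha; exists d. Qed.

Lemma cdiffs_comp f g z : cdiffs f z -> cdiffs g (f z) -> cdiffs (fun w => g (f w)) z.
Proof. by move=> [a ha] [b hb]; eexists; apply: cdiff_comp ha hb. Qed.

Lemma cdiffs_near f g z (r : R) : 0 < r ->
  (forall w, cabs (w - z) < r -> f w = g w) -> cdiffs f z -> cdiffs g z.
Proof. by move=> r0 fg [d hd]; exists d; exact: cdiff_near r0 fg hd. Qed.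

End ComplexTopology.

Section ComplexExponential.
Variable R : realType.
Implicit Types (z w : R[i]) (x y t : R).

Definition expi t : R[i] := (cos t +i* sin t)%C.

Definition cexp z : R[i] := (expR (complex.Re z))%:C%C * expi (complex.Im z).

Lemma cabs_expi t : cabs (expi t) = 1.
Proof. by rewrite /cabs /= cos2Dsin2 sqrtr1. Qed.

Lemma expiD s t : expi (s + t) = expi s * expi t.
Proof.
rewrite /expi cosD sinD; simpc.
by congr (_ +i* _)%C; ring.
Qed.

Lemma expi0 : expi 0 = 1. Proof. by rewrite /expi cos0 sin0. Qed.

Lemma expi2pi : expi (pi *+ 2) = 1.
Proof. by rewrite /expi cos2pi sin2pi. Qed.

Lemma cexpD z w : cexp (z + w) = cexp z * cexp w.
Proof.
have -> : z + w = ((complex.Re z + complex.Re w) +i* (complex.Im z + complex.Im w))%C.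
  by case: z; case: w.
by rewrite /cexp /= expRD expiD rmorphM /=; ring.
Qed.

Lemma cabs_cexp z : cabs (cexp z) = expR (complex.Re z).
Proof. by rewrite /cexp cabsM cabs_expi mulr1 cabs_real ger0_norm// expR_ge0. Qed.

Lemma is_derive0_small (f : R -> R) (l : R) : is_derive (0 : R) (1 : R) f l ->
  forall e, 0 < e -> exists2 r : R, 0 < r &
  forall x, `|x| < r -> `|f x - f 0 - l * x| <= e * `|x|.
Proof.
move=> [df dl] e e0.
have : (fun h : R => h^-1 *: (f (h *: 1 + 0) - f 0)) @ 0^' --> l.
  by rewrite -dl; exact: df.
move=> /cvgrPdist_le/(_ _ e0)/nbhs_ballP[r /= r0 hr].
exists r => // x xr.
have [->|x0] := eqVneq x 0; first by rewrite subrr mulr0 subr0 normr0 mulr0.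
have := hr x; rewrite /ball /= sub0r normrN => /(_ xr x0).
rewrite addr0 distrC.
have -> : x *: 1 = x by rewrite /GRing.scale /= mulr1.
have -> : x^-1 *: (f x - f 0) - l = x^-1 * (f x - f 0 - l * x).
  by rewrite /GRing.scale /= [in RHS]mulrBr mulrCA mulVf// mulr1.
by rewrite normrM normfV mulrC ler_pdivrMr// normr_gt0.
Qed.

Lemma cdiff_cexp0 : cdiff cexp 0 1.
Proof.
apply/cdiffP => e e0.
have [e' [e'0 e'e e'1]] : exists e', [/\ 0 < e', e' <= e / 12 & e' <= 1 / 2].
  exists (Num.min (e / 12) (1 / 2)); rewrite lt_min !ge_min !lexx orbT.
  by split=> //; apply/andP; split; lra.
have [r1 r10 h1] := is_derive0_small (is_derive_expR 0) e'0.
have [r2 r20 h2] := is_derive0_small (is_derive_cos 0) e'0.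
have [r3 r30 h3] := is_derive0_small (is_derive_sin 0) e'0.
pose r := Num.min (Num.min r1 r2) (Num.min r3 e').
have r0 : 0 < r by rewrite !lt_min r10 r20 r30 e'0.
exists r => // -[x y]; rewrite subr0 !lt_min => /andP[/andP[c1 c2] /andP[c3 c4]].
have hx := cabs_Re (x +i* y)%C; have hy := cabs_Im (x +i* y)%C.
set m := cabs _ in c1 c2 c3 c4 hx hy *; rewrite /= in hx hy.
have := h1 x (le_lt_trans hx c1); rewrite expR0 mul1r => {}h1.
have := h2 y (le_lt_trans hy c2); rewrite sin0 oppr0 mul0r cos0 subr0 => {}h2.
have := h3 y (le_lt_trans hy c3); rewrite sin0 cos0 mul1r subr0 => {}h3.
have -> : cexp 0 = 1 by rewrite /cexp /= expR0 expi0 mul1r.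
rewrite mul1r; apply: le_trans (cabs_le_ReIm _) _.
have m0 : 0 <= m := cabs_ge0 _.
have -> : complex.Re (cexp (x +i* y)%C - 1 - (x +i* y)%C) =
    (expR x - 1 - x) + expR x * (cos y - 1).
  rewrite !ReB /cexp /expi; simpc => /=; ring.
have -> : complex.Im (cexp (x +i* y)%C - 1 - (x +i* y)%C) =
    (expR x - 1) * y + expR x * (sin y - y).
  rewrite !ImB /cexp /expi; simpc => /=; ring.
have b1 : `|expR x - 1 - x| <= e' * m by rewrite (le_trans h1)// ler_wpM2l// ltW.
have b2 : `|cos y - 1| <= e' * m by rewrite (le_trans h2)// ler_wpM2l// ltW.
have b3 : `|sin y - y| <= e' * m by rewrite (le_trans h3)// ler_wpM2l// ltW.
have e'm : e' * m <= 1 / 4.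
  by rewrite (_ : 1 / 4 = (1 / 2) * (1 / 2)) ?ler_pM ?(ltW e'0)//; lra.
have e'm2 : e' * m <= 1 / 2 * m by rewrite ler_wpM2r.
have b4 : `|expR x - 1| <= 2 * e'.
  have := ler_normD (expR x - 1 - x) x; rewrite subrK; move: b1 hx c4 e'm2 e'0; lra.
have b5 : `|expR x| <= 2.
  have := ler_normD (expR x - 1) 1; rewrite subrK normr1; move: b4 e'1; lra.
have b6 : `|expR x * (cos y - 1)| <= 2 * (e' * m) by rewrite normrM ler_pM.
have b7 : `|expR x * (sin y - y)| <= 2 * (e' * m) by rewrite normrM ler_pM.
have b8 : `|(expR x - 1) * y| <= 2 * e' * m by rewrite normrM ler_pM.
have := ler_normD (expR x - 1 - x) (expR x * (cos y - 1)).
have := ler_normD ((expR x - 1) * y) (expR x * (sin y - y)).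
have : e' * m <= e / 12 * m by rewrite ler_wpM2r.
have : 0 <= e * m by rewrite mulr_ge0// ltW.
move: b1 b6 b7 b8; rewrite -!mulrA; lra.
Qed.

Lemma cdiff_cexp z : cdiff cexp z (cexp z).
Proof.
have -> : cexp = (fun w => cexp z * cexp (w - z)).
  by apply/funext => w; rewrite -cexpD addrC subrK.
have h : cdiff (fun w => cexp (w - z)) z (1 * (1 - 0)).
  apply: (@cdiff_comp _ (fun w => w - z) cexp z).
    by apply: cdiffB; [exact: cdiff_id|exact: cdiff_cst].
  by rewrite subrr; exact: cdiff_cexp0.
have := cdiffM (cdiff_cst (cexp z) z) h.
by rewrite mul0r add0r subrr subr0 -cexpD addr0 mul1r mulr1.
Qed.

End ComplexExponential.

(** * Goursat's theorem and circle means *)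

Section Goursat.
Variables (R : realType) (G : R[i] -> R[i]).
Implicit Types (z w p d A B a b : R[i]).

Definition segment_avg (F : R[i] -> R[i]) k z A : R[i] :=
  (2 ^+ k)^-1 * \sum_(0 <= j < 2 ^ k) F (z + j%:R / 2 ^+ k * A).

(* The left-endpoint Riemann sum, with 2^k points on each side, of the contour integral
   of F along the boundary of the parallelogram spanned by A and B at z. *)
Definition cell_sum (F : R[i] -> R[i]) k z A B : R[i] :=
  A * (segment_avg F k z A - segment_avg F k (z + B) A) +
  B * (segment_avg F k (z + A) B - segment_avg F k z B).

Lemma two_neq0 : (2 : R[i]) != 0.
Proof. by rewrite pnatr_eq0. Qed.

Lemma exp2_neq0 k : (2 ^+ k : R[i]) != 0.
Proof. by rewrite expf_neq0// two_neq0. Qed.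

Lemma segment_avgS F k z A : segment_avg F k.+1 z A =
  (segment_avg F k z (A / 2) + segment_avg F k (z + A / 2) (A / 2)) / 2.
Proof.
rewrite /segment_avg expnS mul2n -addnn (@big_cat_nat _ _ _ (2 ^ k))//=; last exact: leq_addr.
rewrite -{2}[(2 ^ k)%N]add0n big_addn addnK.
rewrite (eq_bigr (fun j => F (z + j%:R / 2 ^+ k * (A / 2)))); last first.
  by move=> j _; congr F; rewrite exprS; field; rewrite exp2_neq0.
rewrite [X in _ + X](eq_bigr (fun j => F (z + A / 2 + j%:R / 2 ^+ k * (A / 2)))); last first.
  by move=> j _; congr F; rewrite natrD natrX exprS; field; rewrite exp2_neq0.
by rewrite exprS invfM; ring.
Qed.

Lemma cell_sumS F k z A B (a := A / 2) (b := B / 2) : cell_sum F k.+1 z A B =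
  cell_sum F k z a b + cell_sum F k (z + a) a b +
  (cell_sum F k (z + b) a b + cell_sum F k (z + a + b) a b).
Proof.
have aA : A = a + a by rewrite /a; field.
have bB : B = b + b by rewrite /b; field.
rewrite /cell_sum !segment_avgS -/a -/b; clearbody a b; subst A B; rewrite !addrA.
have -> : z + a + b + b = z + b + b + a by ring.
have -> : z + b + a = z + a + b by ring.
have -> : z + a + b + a = z + a + a + b by ring.
by field.
Qed.

Lemma segment_avgD F H k z A :
  segment_avg (fun w => F w + H w) k z A = segment_avg F k z A + segment_avg H k z A.
Proof. by rewrite /segment_avg big_split mulrDr. Qed.

Lemma segment_avg_affine (c d : R[i]) k z z' A :
  segment_avg (fun w => c + d * w) k z A - segment_avg (fun w => c + d * w) k z' A =
  d * (z - z').
Proof.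
rewrite /segment_avg -mulrBr -sumrB (eq_bigr (fun=> d * (z - z'))); last by move=> j _; ring.
rewrite sumr_const_nat subn0 -[_ *+ (2 ^ k)]mulr_natl natrX.
by rewrite mulKf// exp2_neq0.
Qed.

Lemma cell_sum_affine (c d : R[i]) k z A B :
  cell_sum (fun w => c + d * w) k z A B = 0.
Proof. by rewrite /cell_sum !segment_avg_affine; ring. Qed.

Lemma cell_sumD F H k z A B :
  cell_sum (fun w => F w + H w) k z A B = cell_sum F k z A B + cell_sum H k z A B.
Proof. by rewrite /cell_sum !segment_avgD; ring. Qed.

Lemma dyadic01 k j : (j < 2 ^ k)%N -> 0 <= (j%:R / 2 ^+ k : R) <= 1.
Proof.
move=> jk; rewrite divr_ge0 ?exprn_ge0 ?ler0n//= ler_pdivrMr ?exprn_gt0// mul1r.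
by rewrite -natrX ler_nat ltnW.
Qed.

Lemma dyadicC k j : (j%:R / 2 ^+ k : R[i]) = ((j%:R / 2 ^+ k : R)%:C)%C.
Proof. by rewrite fmorph_div/= rmorphXn/= !rmorph_nat. Qed.

Lemma segment_avg_le F k z A (M : R) :
  (forall t : R, 0 <= t <= 1 -> cabs (F (z + t%:C%C * A)) <= M) ->
  cabs (segment_avg F k z A) <= M.
Proof.
move=> hM; rewrite /segment_avg cabsM cabsV cabsX cabs_nat mulrC ler_pdivrMr ?exprn_gt0//.
apply: le_trans (cabs_sum _ _) _.
apply: (@le_trans _ _ (\sum_(0 <= j < 2 ^ k) M)).
  rewrite big_nat_cond [leRHS]big_nat_cond; apply: ler_sum => j; rewrite andbT => /andP[_ jk].
  by rewrite dyadicC; apply: hM; exact: dyadic01.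
by rewrite sumr_const_nat subn0 -natrX mulr_natr.
Qed.

Lemma cell_sum_le F k z A B (M : R) :
  (forall s t : R, 0 <= s <= 1 -> 0 <= t <= 1 ->
    cabs (F (z + s%:C%C * A + t%:C%C * B)) <= M) ->
  cabs (cell_sum F k z A B) <= 2 * (cabs A + cabs B) * M.
Proof.
move=> hM.
have b0 : (0 : R) <= (0 : R) <= (1 : R) by rewrite lexx ler01.
have b1 : (0 : R) <= (1 : R) <= (1 : R) by rewrite lexx ler01.
have h1 : cabs (segment_avg F k z A) <= M.
  by apply: segment_avg_le => t t01; have := hM t 0 t01 b0; rewrite mul0r addr0.
have h2 : cabs (segment_avg F k (z + B) A) <= M.
  by apply: segment_avg_le => t t01; have := hM t 1 t01 b1; rewrite mul1r addrAC.
have h3 : cabs (segment_avg F k (z + A) B) <= M.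
  by apply: segment_avg_le => t t01; have := hM 1 t b1 t01; rewrite mul1r.
have h4 : cabs (segment_avg F k z B) <= M.
  by apply: segment_avg_le => t t01; have := hM 0 t b0 t01; rewrite mul0r addr0.
apply: le_trans (cabs_normD _ _) _; rewrite !cabsM.
rewrite (_ : _ * _ * M = cabs A * (M + M) + cabs B * (M + M)); last by ring.
by apply: lerD; rewrite ler_wpM2l ?cabs_ge0// (le_trans (cabsB _ _))// lerD.
Qed.

(* The sums vanish exactly on affine functions, so only the remainder term counts. *)
Lemma cdiff_cell_sum p d : cdiff G p d -> forall e : R, 0 < e ->
  exists2 r : R, 0 < r & forall k z a b (s t : R), 0 <= s <= 1 -> 0 <= t <= 1 ->
  p = z + s%:C%C * a + t%:C%C * b -> cabs a + cabs b < r ->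
  cabs (cell_sum G k z a b) <= e * (cabs a + cabs b) ^+ 2.
Proof.
move=> /cdiffP hG e e0; have e2 : 0 < e / 2 by lra.
have [r r0 hr] := hG _ e2; exists r => // k z a b s t /andP[s0 s1] /andP[t0 t1] pE ab.
pose H w := G w - (G p - d * p + d * w).
have -> : G = (fun w => (G p - d * p + d * w) + H w).
  by apply/funext => w; rewrite /H addrC subrK.
rewrite cell_sumD cell_sum_affine add0r.
rewrite (_ : e * _ = 2 * (cabs a + cabs b) * (e / 2 * (cabs a + cabs b))); last by field.
apply: cell_sum_le => s' t' /andP[s'0 s'1] /andP[t'0 t'1].
set w := z + _ + _.
have wp : cabs (w - p) <= cabs a + cabs b.
  have -> : w - p = (s' - s)%:C%C * a + (t' - t)%:C%C * b.
    by rewrite pE /w !rmorphB /=; ring.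
  apply: le_trans (cabs_normD _ _) _; rewrite !cabsM !cabs_real.
  by apply: lerD; rewrite ler_piMl ?cabs_ge0// ler_norml; apply/andP; split; lra.
have -> : H w = G w - G p - d * (w - p) by rewrite /H; ring.
by rewrite (le_trans (hr _ (le_lt_trans wp ab)))// ler_wpM2l// ltW.
Qed.

Lemma dyadic_limit (i : nat -> nat) : i 0 = 0%N ->
  (forall n, exists b : bool, i n.+1 = (i n).*2 + b)%N ->
  exists t : R, forall n, (i n)%:R / 2 ^+ n <= t <= (i n).+1%:R / 2 ^+ n.
Proof.
move=> i0 iS.
pose x n : R := (i n)%:R / 2 ^+ n; pose y n : R := (i n).+1%:R / 2 ^+ n.
have pw n : 0 < 2 ^+ n :> R by rewrite exprn_gt0.
have xy n : x n <= y n by rewrite ler_pM2r ?invr_gt0// ler_nat.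
have xS n : x n <= x n.+1.
  rewrite /x exprS invfM mulrA ler_pM2r ?invr_gt0// ler_pdivlMr// -natrM ler_nat.
  by have [b ->] := iS n; rewrite muln2 leq_addr.
have yS n : y n.+1 <= y n.
  rewrite /y exprS invfM mulrA ler_pM2r ?invr_gt0// ler_pdivrMr// -natrM ler_nat.
  by have [b ->] := iS n; rewrite muln2 doubleS ltnS -addn1 leq_add2l leq_b1.
have xm m n : (m <= n)%N -> x m <= x n.
  move=> /subnK <-; elim: (n - m)%N => //= k IH; rewrite addSn.
  exact: le_trans IH (xS _).
have ym m n : (m <= n)%N -> y n <= y m.
  move=> /subnK <-; elim: (n - m)%N => //= k IH; rewrite addSn.
  exact: le_trans (yS _) IH.
have bd m n : x m <= y n.
  have [mn|/ltnW nm] := leqP m n; first exact: le_trans (xm _ _ mn) (xy _).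
  exact: le_trans (xy _) (ym _ _ nm).
exists (sup (range x)) => n; apply/andP; split.
  by apply: ub_le_sup; [exists (y 0%N) => _ [m _ <-]; exact: bd|exists n].
by apply: ge_sup; [exists (x 0%N), 0%N|move=> _ [m _ <-]; exact: bd].
Qed.

Lemma goursat z A B :
  (forall s t : R, 0 <= s <= 1 -> 0 <= t <= 1 -> cdiffs G (z + s%:C%C * A + t%:C%C * B)) ->
  forall e : R, 0 < e -> exists K, forall k, (K <= k)%N -> cabs (cell_sum G k z A B) <= e.
Proof.
move=> dG e e0.
pose cz n (i j : nat) : R[i] := z + i%:R / 2 ^+ n * A + j%:R / 2 ^+ n * B.
pose good n i j := exists K, forall k, (K <= k)%N ->
  cabs (cell_sum G k (cz n i j) (A / 2 ^+ n) (B / 2 ^+ n)) <= e / 4 ^+ n.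
suff [K hK] : good 0%N 0%N 0%N.
  exists K => k /hK; rewrite /cz !mul0r !addr0 !expr0 !divr1.
  by [].
apply: contrapT => bad.
have step n i j : exists b : bool * bool,
    ~ good n i j -> ~ good n.+1 (i.*2 + b.1)%N (j.*2 + b.2)%N.
  apply: contrapT => /forallNP allb.
  have child (b1 b2 : bool) : good n.+1 (i.*2 + b1)%N (j.*2 + b2)%N.
    by apply: contrapT => nb; apply: (allb (b1, b2)) => _.
  have : good n i j; last by move=> gd; apply: (allb (true, true)) => /(_ gd).
  have [K1 h1] := child false false; have [K2 h2] := child true false.
  have [K3 h3] := child false true; have [K4 h4] := child true true.
  exists (maxn (maxn K1 K2) (maxn K3 K4)).+1 => -[//|k]; rewrite ltnS !geq_max.
  move=> /andP[/andP[/h1 {}h1 /h2 {}h2] /andP[/h3 {}h3 /h4 {}h4]].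
  rewrite cell_sumS.
  have hA : A / 2 ^+ n / 2 = A / 2 ^+ n.+1 by rewrite exprSr invfM mulrA.
  have hB : B / 2 ^+ n / 2 = B / 2 ^+ n.+1 by rewrite exprSr invfM mulrA.
  rewrite hA hB.
  have -> : cz n i j + A / 2 ^+ n.+1 + B / 2 ^+ n.+1 = cz n.+1 (i.*2 + true)%N (j.*2 + true)%N.
    by rewrite /cz /nat_of_bool !natrD -!muln2 !natrM exprS; field; rewrite exp2_neq0.
  have -> : cz n i j + A / 2 ^+ n.+1 = cz n.+1 (i.*2 + true)%N (j.*2 + false)%N.
    by rewrite /cz /nat_of_bool !natrD -!muln2 !natrM exprS; field; rewrite exp2_neq0.
  have -> : cz n i j + B / 2 ^+ n.+1 = cz n.+1 (i.*2 + false)%N (j.*2 + true)%N.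
    by rewrite /cz /nat_of_bool !natrD -!muln2 !natrM exprS; field; rewrite exp2_neq0.
  have -> : cz n i j = cz n.+1 (i.*2 + false)%N (j.*2 + false)%N.
    by rewrite /cz /nat_of_bool !natrD -!muln2 !natrM exprS; field; rewrite exp2_neq0.
  rewrite (_ : e / 4 ^+ n = e / 4 ^+ n.+1 + e / 4 ^+ n.+1 + (e / 4 ^+ n.+1 + e / 4 ^+ n.+1)); last first.
    by rewrite exprS; field; rewrite expf_neq0// pnatr_eq0.
  apply: le_trans (cabs_normD _ _) _; apply: lerD.
    by apply: le_trans (cabs_normD _ _) _; apply: lerD.
  by apply: le_trans (cabs_normD _ _) _; apply: lerD.
have [b hb] : exists b : nat * nat * nat -> bool * bool, forall x, ~ good x.1.1 x.1.2 x.2 ->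
    ~ good x.1.1.+1 (x.1.2.*2 + (b x).1)%N (x.2.*2 + (b x).2)%N.
  have [b hb] := choice (fun x : nat * nat * nat => step x.1.1 x.1.2 x.2).
  by exists b.
pose fix ij (n : nat) : nat * nat := if n is m.+1 then
  let x := (m, (ij m).1, (ij m).2) in
  ((ij m).1.*2 + (b x).1, (ij m).2.*2 + (b x).2)%N else (0, 0)%N.
have allbad n : ~ good n (ij n).1 (ij n).2.
  by elim: n => [//|n IH]; exact: (hb (n, (ij n).1, (ij n).2)).
have [s hs] := @dyadic_limit (fun n => (ij n).1) erefl (fun n => ex_intro _ _ erefl).
have [t ht] := @dyadic_limit (fun n => (ij n).2) erefl (fun n => ex_intro _ _ erefl).
have s01 : 0 <= s <= 1 by have := hs 0%N; rewrite /= mul0r divr1.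
have t01 : 0 <= t <= 1 by have := ht 0%N; rewrite /= mul0r divr1.
have [d hd] := dG _ _ s01 t01.
pose M := cabs A + cabs B.
have M0 : 0 <= M by rewrite addr_ge0// cabs_ge0.
have e' : 0 < e / (M ^+ 2 + 1) by rewrite divr_gt0// ltr_wpDl// exprn_ge0.
have [r r0 hr] := cdiff_cell_sum hd e'.
have [n hn] : exists n, M / 2 ^+ n < r.
  exists (Num.bound (M / r)).
  rewrite ltr_pdivrMr ?exprn_gt0// mulrC -ltr_pdivrMr//.
  have h := archi_boundP (divr_ge0 M0 (ltW r0)).
  by rewrite (lt_trans h)// -natrX ltr_nat ltn_expl.
apply: (allbad n); exists 0%N => k _.
have two n' : 0 < 2 ^+ n' :> R by rewrite exprn_gt0.
pose s' := s * 2 ^+ n - (ij n).1%:R; pose t' := t * 2 ^+ n - (ij n).2%:R.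
have unit01 (u : R) (l : nat) : l%:R / 2 ^+ n <= u <= l.+1%:R / 2 ^+ n ->
    0 <= u * 2 ^+ n - l%:R <= 1.
  by rewrite ler_pdivrMr// ler_pdivlMr// -addn1 natrD; lra.
have cA : cabs (A / 2 ^+ n) + cabs (B / 2 ^+ n) = M / 2 ^+ n.
  by rewrite !cabs_div !cabsX !cabs_nat -mulrDl.
have pE : z + s%:C%C * A + t%:C%C * B = cz n (ij n).1 (ij n).2 +
    s'%:C%C * (A / 2 ^+ n) + t'%:C%C * (B / 2 ^+ n).
  rewrite /cz !rmorphB !rmorphM !rmorphXn /= !rmorph_nat.
  by field; exact: exp2_neq0.
have := hr k _ _ _ _ _ (unit01 _ _ (hs n)) (unit01 _ _ (ht n)) pE.
rewrite cA => /(_ hn) h; apply: le_trans h _.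
rewrite exprMn exprVn -exprM mulnC exprM (_ : 2 ^+ 2 = 4 :> R); last by ring.
rewrite mulrA ler_pM2r ?invr_gt0 ?exprn_gt0//.
rewrite mulrAC ler_pdivrMr ?ltr_wpDl ?exprn_ge0//.
by rewrite ler_pM2l// lerDl.
Qed.

End Goursat.

Section RealCompactness.
Variable R : realType.

Lemma geometric_small (q : R) : 0 <= q < 1 -> forall e, 0 < e ->
  exists N, forall n, (N <= n)%N -> q ^+ n <= e.
Proof.
move=> /andP[q0 q1] e e0.
have : q ^+ n @[n --> \oo] --> (0 : R) by apply: cvg_expr; rewrite ger0_norm.
move=> /cvgrPdist_le/(_ _ e0)[N _ hN]; exists N => n /hN.
by rewrite sub0r normrN ger0_norm// exprn_ge0.
Qed.

Lemma dyadic_small (e : R) : 0 < e -> exists N, forall n, (N <= n)%N -> 2 ^- n <= e.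
Proof.
move=> e0; have h : 0 <= (2^-1 : R) < 1 by apply/andP; split; lra.
by have [N hN] := geometric_small h e0; exists N => n /hN; rewrite exprVn.
Qed.

Lemma unit_interval_cover (P : nat -> R -> Prop) :
  (forall x, 0 <= x <= 1 -> exists N (d : R), 0 < d /\
     forall n t, (N <= n)%N -> `|t - x| < d -> P n t) ->
  exists N, forall t, 0 <= t <= 1 -> P N t.
Proof.
move=> h.
have /compact_near_coveringP cov := @segment_compact R 0 1.
have [|N _ hN] := cov nat \oo P _; last first.
  by exists N => t t01; apply: (hN N) => //=; rewrite in_itv.
move=> x; rewrite /= in_itv /= => /h[N [d [d0 hd]]].
exists (ball x d, [set n | (N <= n)%N]).
  by split; [exact: nbhsx_ballx|exists N].
move=> [t n] [/= bt Nn]; apply: hd => //.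
by rewrite distrC.
Qed.

End RealCompactness.

Section CircleMean.
Variable R : realType.
Implicit Types (f g : R[i] -> R[i]) (z w l : R[i]) (r s t : R).

Definition twopii : R[i] := (0 +i* (pi *+ 2))%C.

Definition circ r t : R[i] := r%:C%C * expi (t * (pi *+ 2)).

Lemma cabs_circ r t : 0 <= r -> cabs (circ r t) = r.
Proof. by move=> r0; rewrite /circ cabsM cabs_expi cabs_real mulr1 ger0_norm. Qed.

Lemma cexp_circ t : cexp (t%:C%C * twopii) = expi (t * (pi *+ 2)).
Proof.
have -> : t%:C%C * twopii = (0 +i* (t * (pi *+ 2)))%C.
  by rewrite /twopii /GRing.mul /= mulr0 !mul0r subrr addr0.
by rewrite /cexp /= expR0 mul1r.
Qed.

Definition circle_sum f k r := segment_avg (fun z => f (r%:C%C * cexp z)) k 0 twopii.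

Lemma circle_sum_le f k r M : (forall t, 0 <= t <= 1 -> cabs (f (circ r t)) <= M) ->
  cabs (circle_sum f k r) <= M.
Proof.
by move=> h; apply: segment_avg_le => t t01; rewrite add0r cexp_circ; exact: h.
Qed.

Lemma circle_sumD f g k r :
  circle_sum (fun w => f w + g w) k r = circle_sum f k r + circle_sum g k r.
Proof. by rewrite /circle_sum segment_avgD. Qed.

Lemma circle_sumZ a f k r : circle_sum (fun w => a * f w) k r = a * circle_sum f k r.
Proof. by rewrite /circle_sum /segment_avg mulrCA -mulr_sumr. Qed.

Lemma circle_sum_cst a k r : circle_sum (fun=> a) k r = a.
Proof.
rewrite /circle_sum /segment_avg sumr_const_nat subn0 -[_ *+ (2 ^ k)]mulr_natl natrX.
by rewrite mulKf// exp2_neq0.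
Qed.

Definition is_mean f r l := forall e : R, 0 < e ->
  exists N, forall n, (N <= n)%N -> cabs (circle_sum f n r - l) <= e.

Lemma is_mean_unique f r l l' : is_mean f r l -> is_mean f r l' -> l = l'.
Proof.
move=> h h'; apply: cabs_close_eq => e e0.
have e2 : 0 < e / 2 by lra.
have [N hN] := h _ e2; have [N' hN'] := h' _ e2.
have := hN (maxn N N') (leq_maxl _ _); have := hN' (maxn N N') (leq_maxr _ _).
set S := circle_sum _ _ _ => h1 h2.
have -> : l - l' = (S - l') - (S - l) by ring.
by rewrite (le_trans (cabsB _ _))//; lra.
Qed.

Lemma is_meanD f g r l l' : is_mean f r l -> is_mean g r l' ->
  is_mean (fun w => f w + g w) r (l + l').
Proof.
move=> h h' e e0; have e2 : 0 < e / 2 by lra.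
have [N hN] := h _ e2; have [N' hN'] := h' _ e2.
exists (maxn N N') => n; rewrite geq_max => /andP[/hN {}hN /hN' {}hN'].
by rewrite circle_sumD opprD addrACA (le_trans (cabs_normD _ _))//; lra.
Qed.

Lemma is_meanZ a f r l : is_mean f r l -> is_mean (fun w => a * f w) r (a * l).
Proof.
move=> h e e0.
have a1 : 0 < cabs a + 1 by rewrite ltr_wpDl// cabs_ge0.
have [N hN] := h _ (divr_gt0 e0 a1).
exists N => n /hN {}hN; rewrite circle_sumZ -mulrBr cabsM.
apply: (@le_trans _ _ ((cabs a + 1) * (e / (cabs a + 1)))).
  by rewrite ler_pM ?cabs_ge0// lerDl.
by rewrite mulrC divfK// gt_eqF.
Qed.

Lemma is_mean_le f r l M : (forall t, 0 <= t <= 1 -> cabs (f (circ r t)) <= M) ->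
  is_mean f r l -> cabs l <= M.
Proof.
move=> hM h; apply/ler_addgt0Pr => e /h[N /(_ _ (leqnn _)) hN].
rewrite -(subrK (circle_sum f N r) l) (le_trans (cabs_normD _ _))// addrC lerD//.
  exact: circle_sum_le.
by rewrite cabs_distC.
Qed.

(* Equal to 0 when the dyadic averages do not converge. *)
Definition circle_mean f r : R[i] := xget 0 [set l | is_mean f r l].

Lemma is_mean_eq f r l : is_mean f r l -> circle_mean f r = l.
Proof.
move=> h; rewrite /circle_mean; case: xgetP => [l' _ h'|/(_ l)//].
exact: is_mean_unique h' h.
Qed.

Definition ccont_circle f r := forall w, cabs w = r -> ccont f w.

Lemma segment_avg_cauchy (F : R[i] -> R[i]) (e : R) N z A :
  (forall s t, 0 <= s <= 1 -> 0 <= t <= 1 -> `|s - t| <= 2 ^- N ->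
    cabs (F (z + s%:C%C * A) - F (z + t%:C%C * A)) <= e) ->
  forall n, (N <= n)%N -> cabs (segment_avg F n z A - segment_avg F N z A) <= e.
Proof.
elim: N z A => [|N IH] z A osc n.
  move=> _; have -> : segment_avg F 0 z A = F z.
    by rewrite /segment_avg expn0 big_nat1 mul0r mul0r addr0 expr0 invr1 mul1r.
  have -> : segment_avg F n z A - F z = segment_avg (fun w => F w + (- F z)) n z A.
    rewrite segment_avgD; congr (_ + _).
    rewrite /segment_avg sumr_const_nat subn0 -[_ *+ (2 ^ n)]mulr_natl natrX.
    by rewrite mulKf// exp2_neq0.
  apply: segment_avg_le => t t01.
  have := osc t 0 t01; rewrite mul0r addr0 subr0; apply; first by rewrite lexx ler01.
  by move: t01 => /andP[t0 t1]; rewrite expr0 invr1 ger0_norm.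
case: n => // n Nn; rewrite !segment_avgS -mulrBl opprD addrACA cabs_div cabs_nat.
have h1 : cabs (segment_avg F n z (A / 2) - segment_avg F N z (A / 2)) <= e.
  apply: IH => // s t /andP[s0 s1] /andP[t0 t1] st.
  have := osc (s / 2) (t / 2).
  rewrite !fmorph_div /= !rmorph_nat !(mulrAC _ 2^-1) -!mulrA; apply.
  - by apply/andP; split; lra.
  - by apply/andP; split; lra.
  - rewrite -mulrBl normrM exprS invfM mulrC ger0_norm ?ler_pM2l; lra.
have h2 : cabs (segment_avg F n (z + A / 2) (A / 2) - segment_avg F N (z + A / 2) (A / 2)) <= e.
  apply: IH => // s t /andP[s0 s1] /andP[t0 t1] st.
  have := osc (1 / 2 + s / 2) (1 / 2 + t / 2).
  rewrite !rmorphD !fmorph_div /= !rmorph_nat.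
  rewrite (_ : z + (1 / 2 + s%:C%C / 2) * A = z + A / 2 + s%:C%C * (A / 2)); last by field.
  rewrite (_ : z + (1 / 2 + t%:C%C / 2) * A = z + A / 2 + t%:C%C * (A / 2)); last by field.
  apply.
  - by apply/andP; split; lra.
  - by apply/andP; split; lra.
  - rewrite (_ : _ - _ = (s - t) / 2); last by field.
    rewrite normrM exprS invfM mulrC ger0_norm ?ler_pM2l; lra.
rewrite ler_pdivrMr//; apply: le_trans (cabs_normD _ _) _; lra.
Qed.

Lemma ccont_expi x : forall e : R, 0 < e -> exists2 d : R, 0 < d &
  forall y, `|y - x| < d -> cabs (expi y - expi x) < e.
Proof.
move=> e e0; have E y : expi y = cexp (0 +i* y)%C :> R[i] by rewrite /cexp /= expR0 mul1r.
have [d d0 hd] := cdiff_cont (cdiff_cexp (0 +i* x)%C) e0.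
exists d => // y yx; rewrite !E; apply: hd.
apply: le_lt_trans (cabs_le_ReIm _) _.
by rewrite ReB ImB /= subrr normr0 add0r.
Qed.

Lemma ccont_circ r x : forall e : R, 0 < e -> exists2 d : R, 0 < d &
  forall s t, `|s - r| < d -> `|t - x| < d -> cabs (circ s t - circ r x) < e.
Proof.
move=> e e0.
have r1 : 0 < `|r| + 1 by rewrite ltr_wpDl.
have e2 : 0 < e / 2 / (`|r| + 1) by rewrite !divr_gt0.
have [d d0 hd] := ccont_expi (x * (pi *+ 2)) e2.
have p0 : (0 : R) < pi *+ 2 by rewrite mulrn_wgt0// pi_gt0.
exists (Num.min (e / 2) (d / (pi *+ 2))); first by rewrite lt_min !divr_gt0.
move=> s t; rewrite !lt_min => /andP[sr _] /andP[_ tx].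
have -> : circ s t - circ r x = (s - r)%:C%C * expi (t * (pi *+ 2)) +
    r%:C%C * (expi (t * (pi *+ 2)) - expi (x * (pi *+ 2))).
  by rewrite /circ rmorphB /=; ring.
apply: le_lt_trans (cabs_normD _ _) _; rewrite !cabsM cabs_expi mulr1 !cabs_real.
have := hd (t * (pi *+ 2)); rewrite -mulrBl normrM (gtr0_norm p0) -ltr_pdivlMr// => /(_ tx) h.
have : `|r| * cabs (expi (t * (pi *+ 2)) - expi (x * (pi *+ 2))) <= e / 2.
  rewrite (@le_trans _ _ ((`|r| + 1) * (e / 2 / (`|r| + 1))))//.
    by rewrite ler_pM ?cabs_ge0// ?lerDl// ltW.
  by rewrite mulrC divfK// gt_eqF.
by move: sr; lra.
Qed.

Lemma mean_exists f r : 0 <= r -> ccont_circle f r -> is_mean f r (circle_mean f r).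
Proof.
move=> r0 hf.
suff [l hl] : exists l, is_mean f r l by rewrite (is_mean_eq hl).
apply: ccomplete => e e0.
have [N hN] : exists N, forall t, 0 <= t <= 1 ->
    forall s, `|s - t| <= 2 ^- N -> cabs (f (circ r s) - f (circ r t)) <= e.
  apply: (@unit_interval_cover R (fun N t => forall s, `|s - t| <= 2 ^- N ->
    cabs (f (circ r s) - f (circ r t)) <= e)) => x _.
  have e2 : 0 < e / 2 by lra.
  have [d d0 hd] := hf (circ r x) (cabs_circ _ r0) _ e2.
  have [d' d'0 hd'] := ccont_circ r x d0.
  have d'2 : 0 < d' / 2 / 2 by lra.
  have [N hN] := dyadic_small d'2.
  exists N, (d' / 2); split; first by lra.
  move=> n t /hN nN tx s st.
  have -> : f (circ r s) - f (circ r t) =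
     (f (circ r s) - f (circ r x)) - (f (circ r t) - f (circ r x)) by ring.
  apply: le_trans (cabsB _ _) _.
  have h1 : cabs (f (circ r s) - f (circ r x)) < e / 2.
    apply/hd/hd'; first by rewrite subrr normr0.
    by rewrite -(subrK t s) -addrA (le_lt_trans (ler_normD _ _))//; lra.
  have h2 : cabs (f (circ r t) - f (circ r x)) < e / 2.
    by apply/hd/hd'; [rewrite subrr normr0|lra].
  by lra.
exists N => n Nn; apply: segment_avg_cauchy => // s t s01 t01 st.
by rewrite !add0r !cexp_circ; exact: hN.
Qed.

Lemma circle_meanD f g r : 0 <= r -> ccont_circle f r -> ccont_circle g r ->
  circle_mean (fun w => f w + g w) r = circle_mean f r + circle_mean g r.
Proof. by move=> r0 hf hg; apply/is_mean_eq/is_meanD; exact: mean_exists. Qed.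

Lemma circle_meanZ a f r : 0 <= r -> ccont_circle f r ->
  circle_mean (fun w => a * f w) r = a * circle_mean f r.
Proof. by move=> r0 hf; apply/is_mean_eq/is_meanZ; exact: mean_exists. Qed.

Lemma circle_meanB f g r : 0 <= r -> ccont_circle f r -> ccont_circle g r ->
  circle_mean (fun w => f w - g w) r = circle_mean f r - circle_mean g r.
Proof.
move=> r0 hf hg; rewrite -[- circle_mean g r]mulN1r -circle_meanZ// -circle_meanD//.
  by under [in RHS]eq_fun do rewrite mulN1r.
by move=> w wr; apply: ccontM; [exact: ccont_cst|exact: hg].
Qed.

Lemma circle_mean_cst a r : circle_mean (fun=> a) r = a.
Proof.
apply: is_mean_eq => e e0; exists 0%N => n _.
by rewrite circle_sum_cst subrr cabs0 ltW.
Qed.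

Lemma eq_circle_mean f g r : 0 <= r -> (forall w, cabs w = r -> f w = g w) ->
  circle_mean f r = circle_mean g r.
Proof.
move=> r0 fg; rewrite /circle_mean; congr (xget 0 _); apply/seteqP.
have E n : circle_sum f n r = circle_sum g n r.
  rewrite /circle_sum /segment_avg; congr (_ * _); apply: eq_bigr => j _.
  by rewrite add0r dyadicC cexp_circ; apply/fg/cabs_circ.
by split=> l /= h e /h[N hN]; exists N => n /hN; rewrite E.
Qed.

Lemma circle_mean_le f r M : 0 <= r -> ccont_circle f r ->
  (forall w, cabs w = r -> cabs (f w) <= M) -> cabs (circle_mean f r) <= M.
Proof.
move=> r0 hf hM; apply: is_mean_le (mean_exists r0 hf) => t _.
by apply/hM/cabs_circ.
Qed.

Lemma circle_mean_sum (I : Type) (s : seq I) (F : I -> R[i] -> R[i]) r : 0 <= r ->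
  (forall i, ccont_circle (F i) r) ->
  circle_mean (fun w => \sum_(i <- s) F i w) r = \sum_(i <- s) circle_mean (F i) r.
Proof.
move=> r0 hF; elim: s => [|i s IH].
  by rewrite big_nil; under eq_fun do rewrite big_nil; rewrite circle_mean_cst.
rewrite big_cons -IH -circle_meanD//; first by under eq_fun do rewrite big_cons.
move=> w wr; elim: s {IH} => [|j s IH].
  by under eq_fun do rewrite big_nil; exact: ccont_cst.
by under eq_fun do rewrite big_cons; apply: ccontD => //; exact: hF.
Qed.

End CircleMean.

(* The patterns with a partially applied operation catch the bodies that second-order
   matching leaves eta-reduced. *)
Ltac ccont_auto := repeat (first [assumption | lazymatch goal with
  | |- ccont (fun _ => ?c) _ => exact: ccont_cst
  | |- ccont (fun w => w) _ => exact: ccont_id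
  | |- ccont (@GRing.inv _) _ => apply: (ccontV (ccont_id _))
  | |- ccont (@GRing.mul _ ?a) _ => apply: (ccontM (ccont_cst a _) (ccont_id _))
  | |- ccont (@Algebra.add _ ?a) _ => apply: (ccontD (ccont_cst a _) (ccont_id _))
  | |- ccont (fun w => @GRing.inv _ (@?f w)) _ => apply: ccontV
  | |- ccont (fun w => @GRing.mul _ (@?f w) (@?g w)) _ => apply: ccontM
  | |- ccont (fun w => @GRing.exp _ (@?f w) ?n) _ => apply: ccontX
  | |- ccont (fun w => @Algebra.add _ (@?f w) (@Algebra.opp _ (@?g w))) _ => apply: ccontB
  | |- ccont (fun w => @Algebra.add _ (@?f w) (@?g w)) _ => apply: ccontD
  end]).

Ltac cdiffs_auto := repeat (first [assumption | lazymatch goal with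
  | |- cdiffs (fun _ => ?c) _ => exact: cdiffs_cst
  | |- cdiffs (fun w => w) _ => exact: cdiffs_id
  | |- cdiffs (@GRing.inv _) _ => apply: (cdiffsV (cdiffs_id _))
  | |- cdiffs (@GRing.mul _ ?a) _ => apply: (cdiffsM (cdiffs_cst a _) (cdiffs_id _))
  | |- cdiffs (@Algebra.add _ ?a) _ => apply: (cdiffsD (cdiffs_cst a _) (cdiffs_id _))
  | |- cdiffs (fun w => @GRing.inv _ (@?f w)) _ => apply: cdiffsV
  | |- cdiffs (fun w => @GRing.mul _ (@?f w) (@?g w)) _ => apply: cdiffsM
  | |- cdiffs (fun w => @GRing.exp _ (@?f w) ?n) _ => apply: cdiffsX
  | |- cdiffs (fun w => @Algebra.add _ (@?f w) (@Algebra.opp _ (@?g w))) _ => apply: cdiffsB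
  | |- cdiffs (fun w => @Algebra.add _ (@?f w) (@?g w)) _ => apply: cdiffsD
  end]).

Section CauchyFormula.
Variable R : realType.
Implicit Types (f g p u : R[i] -> R[i]) (z w l : R[i]) (x r s t rho : R).

Lemma ReD z w : complex.Re (z + w) = complex.Re z + complex.Re w.
Proof. by case: z; case: w. Qed.

Lemma Re_realM x z : complex.Re (x%:C%C * z) = x * complex.Re z.
Proof. by case: z => a b; rewrite /= mul0r subr0. Qed.

Lemma cexp_ln r : 0 < r -> cexp (ln r)%:C%C = r%:C%C :> R[i].
Proof. by move=> r0; rewrite /cexp /= lnK ?posrE// expi0 mulr1. Qed.

Lemma cexp_twopii : cexp (twopii R) = 1.
Proof. by rewrite -[twopii R]mul1r (cexp_circ 1) mul1r expi2pi. Qed.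

Lemma twopii_neq0 : twopii R != 0.
Proof. by rewrite eq_complex /= negb_and mulrn_eq0 (gt_eqF (pi_gt0 R)) orbT. Qed.

Lemma circle_mean_regular f r1 r2 : 0 < r1 -> r1 <= r2 ->
  (forall w, r1 <= cabs w <= r2 -> cdiffs f w) -> circle_mean f r1 = circle_mean f r2.
Proof.
move=> r10 r12 df; have r20 := lt_le_trans r10 r12.
have cf r : r1 <= r <= r2 -> ccont_circle f r by move=> hr w wr; apply/cdiffs_cont/df; rewrite wr.
have m1 := mean_exists (ltW r10) (cf r1 (introT andP (conj (lexx _) r12))).
have m2 := mean_exists (ltW r20) (cf r2 (introT andP (conj r12 (lexx _)))).
have l12 : 0 <= ln r2 - ln r1 by rewrite subr_ge0 ler_ln// posrE.
have close (e : R) : 0 < e -> exists K, forall k, (K <= k)%N ->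
    cabs (circle_sum f k r2 - circle_sum f k r1) <= e.
  move=> e0; have cp : 0 < cabs (twopii R) by rewrite cabs_gt0 twopii_neq0.
  have dG s t : 0 <= s <= 1 -> 0 <= t <= 1 -> cdiffs (fun z => f (cexp z))
      ((ln r1)%:C%C + s%:C%C * (ln r2 - ln r1)%:C%C + t%:C%C * twopii R).
    move=> /andP[s0 s1] _.
    apply: (@cdiffs_comp _ (@cexp R) f); first by eexists; exact: cdiff_cexp.
    apply: df; rewrite cabs_cexp.
    set v := complex.Re _; have -> : v = ln r1 + s * (ln r2 - ln r1).
      by rewrite /v !ReD !Re_realM /= mulr0 addr0.
    have E1 : expR (ln r1) = r1 by rewrite lnK.
    have E2 : expR (ln r2) = r2 by rewrite lnK.
    move: l12 E1 E2; set L1 := ln r1; set L2 := ln r2 => l12 <- <-.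
    by rewrite !ler_expR; apply/andP; split; nra.
  have [K hK] := goursat dG (mulr_gt0 cp e0).
  exists K => k /hK; rewrite /cell_sum.
  have per z A : segment_avg (fun z => f (cexp z)) k (z + twopii R) A =
      segment_avg (fun z => f (cexp z)) k z A.
    by rewrite /segment_avg; congr (_ * _); apply: eq_bigr => j _;
      rewrite addrAC [in LHS]cexpD cexp_twopii mulr1.
  rewrite per subrr mulr0 add0r cabsM ler_pM2l//.
  have E r : 0 < r -> segment_avg (fun z => f (cexp z)) k (ln r)%:C%C (twopii R) =
      circle_sum f k r.
    move=> r0; rewrite /circle_sum /segment_avg; congr (_ * _); apply: eq_bigr => j _.
    by rewrite add0r cexpD cexp_ln.
  have -> : (ln r1)%:C%C + (ln r2 - ln r1)%:C%C = (ln r2)%:C%C :> R[i].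
    by rewrite rmorphB /= addrC subrK.
  by rewrite !E.
apply: cabs_close_eq => e e0.
have e3 : 0 < e / 3 by lra.
have [N1 h1] := m1 _ e3; have [N2 h2] := m2 _ e3; have [N3 h3] := close _ e3.
pose n := maxn N1 (maxn N2 N3).
have {}h1 := h1 n (leq_maxl _ _).
have {}h2 := h2 n (leq_trans (leq_maxl _ _) (leq_maxr _ _)).
have {}h3 := h3 n (leq_trans (leq_maxr _ _) (leq_maxr _ _)).
have -> : circle_mean f r1 - circle_mean f r2 = (circle_sum f n r2 - circle_mean f r2)
  - (circle_sum f n r1 - circle_mean f r1) - (circle_sum f n r2 - circle_sum f n r1) by ring.
apply: le_trans (cabsB _ _) _; have := cabsB (circle_sum f n r2 - circle_mean f r2)
  (circle_sum f n r1 - circle_mean f r1).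
by move: h1 h2 h3; lra.
Qed.

Lemma circle_mean_continuous f rho : 0 < rho -> ccont_circle f rho ->
  forall e : R, 0 < e -> exists2 d : R, 0 < d & forall r, 0 < r -> `|r - rho| < d ->
  ccont_circle f r -> cabs (circle_mean f r - circle_mean f rho) <= e.
Proof.
move=> rho0 hf e e0; have e3 : 0 < e / 3 by lra.
have [N hN] : exists N, forall t, 0 <= t <= 1 -> forall r, `|r - rho| < 2 ^- N ->
    cabs (f (circ r t) - f (circ rho t)) <= e / 3.
  apply: (@unit_interval_cover R (fun N t => forall r, `|r - rho| < 2 ^- N ->
    cabs (f (circ r t) - f (circ rho t)) <= e / 3)) => x _.
  have e6 : 0 < e / 6 by lra.
  have [d d0 hd] := hf (circ rho x) (cabs_circ _ (ltW rho0)) _ e6.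
  have [d' d'0 hd'] := ccont_circ rho x d0.
  have [N hN] := dyadic_small d'0.
  exists N, d'; split => // n t /hN nN tx r rr.
  have -> : f (circ r t) - f (circ rho t) =
     (f (circ r t) - f (circ rho x)) - (f (circ rho t) - f (circ rho x)) by ring.
  apply: le_trans (cabsB _ _) _.
  have h1 : cabs (f (circ r t) - f (circ rho x)) < e / 6.
    by apply/hd/hd'; [lra|].
  have h2 : cabs (f (circ rho t) - f (circ rho x)) < e / 6.
    by apply/hd/hd'; rewrite // subrr normr0.
  by lra.
exists (2 ^- N) => [|r r0 rr cf]; first by rewrite invr_gt0 exprn_gt0.
have [N1 h1] := mean_exists (ltW r0) cf e3.
have [N2 h2] := mean_exists (ltW rho0) hf e3.
have {}h1 := h1 _ (leq_maxl N1 N2); have {}h2 := h2 _ (leq_maxr N1 N2).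
set n := maxn N1 N2 in h1 h2.
have h3 : cabs (circle_sum f n r - circle_sum f n rho) <= e / 3.
  rewrite /circle_sum /segment_avg -mulrBr -sumrB.
  apply: (@segment_avg_le _ (fun z => f (r%:C%C * cexp z) - f (rho%:C%C * cexp z))) => t t01.
  by rewrite add0r !cexp_circ; exact: hN.
have -> : circle_mean f r - circle_mean f rho = (circle_sum f n rho - circle_mean f rho)
  - (circle_sum f n r - circle_mean f r) + (circle_sum f n r - circle_sum f n rho) by ring.
apply: le_trans (cabs_normD _ _) _; have := cabsB (circle_sum f n rho - circle_mean f rho)
  (circle_sum f n r - circle_mean f r).
by move: h1 h2 h3; lra.
Qed.

(* The exceptional circle |w| = rho is the one through the pole in Cauchy's formula. *)
Lemma circle_mean_const f r1 r2 rho : 0 < r1 -> r1 <= r2 ->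
  (forall w, r1 <= cabs w <= r2 -> ccont f w) ->
  (forall w, r1 <= cabs w <= r2 -> cabs w != rho -> cdiffs f w) ->
  circle_mean f r1 = circle_mean f r2.
Proof.
move=> r10 r12 cf df.
have cc r : r1 <= r -> r <= r2 -> ccont_circle f r.
  by move=> h1 h2 w wr; apply: cf; rewrite wr h1.
have reg a b : r1 <= a -> a <= b -> b <= r2 -> rho < a \/ b < rho ->
    circle_mean f a = circle_mean f b.
  move=> ra ab br hrho; apply: circle_mean_regular => //; first exact: lt_le_trans ra.
  move=> w /andP[aw wb]; apply: df; first by apply/andP; split; lra.
  by apply/eqP => wrho; case: hrho; lra.
have [rho1|rho1] := ltP rho r1; first by apply: reg; [| | |left].
have [rho2|rho2] := ltP r2 rho; first by apply: reg; [| | |right].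
have rho0 : 0 < rho by exact: lt_le_trans rho1.
have crho := cc _ rho1 rho2.
transitivity (circle_mean f rho).
  have [->//|] := eqVneq r1 rho; rewrite neq_lt => /orP[lt1|]; last by rewrite ltNge rho1.
  apply: cabs_close_eq => e /(circle_mean_continuous rho0 crho)[d d0 hd].
  pose r := Num.max r1 (rho - d / 2).
  have [rr1 rr2 rr3] : [/\ r1 <= r, r < rho & rho - d / 2 <= r].
    by rewrite /r le_max lexx le_max lexx orbT gt_max lt1; split=> //=; lra.
  rewrite (reg r1 r) //; [|lra|by right].
  apply: hd; [lra|by rewrite ltr_norml; apply/andP; split; lra|apply: cc; lra].
have [->//|] := eqVneq r2 rho; rewrite neq_lt => /orP[|lt1]; first by rewrite ltNge rho2.
apply: cabs_close_eq => e /(circle_mean_continuous rho0 crho)[d d0 hd].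
pose r := Num.min r2 (rho + d / 2).
have [rr1 rr2 rr3] : [/\ r <= r2, rho < r & r <= rho + d / 2].
  by rewrite /r ge_min lexx ge_min lexx orbT lt_min lt1; split=> //=; lra.
rewrite -(reg r r2) //; [|lra|by left].
rewrite cabs_distC; apply: hd; [lra|by rewrite ltr_norml; apply/andP; split; lra|apply: cc; lra].
Qed.

Lemma circle_mean_at0 f r : 0 < r -> (forall w, 0 < cabs w <= r -> cdiffs f w) ->
  ccont f 0 -> circle_mean f r = f 0.
Proof.
move=> r0 df f0; apply: cabs_close_eq => e /f0[d d0 hd].
pose r' := Num.min r (d / 2).
have [rr1 rr2 rr3] : [/\ 0 < r', r' <= r & r' <= d / 2].
  by rewrite /r' lt_min !ge_min !lexx orbT r0 divr_gt0.
rewrite -(@circle_mean_regular f r' r)//; last first.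
  by move=> w /andP[w1 w2]; apply: df; rewrite w2 andbT; exact: lt_le_trans w1.
have cf : ccont_circle f r' by move=> w wr; apply/cdiffs_cont/df; rewrite wr rr1.
rewrite -(circle_mean_cst (f 0) r') -circle_meanB//; [|exact: ltW|by move=> w _; exact: ccont_cst].
apply: circle_mean_le; first exact: ltW.
  by move=> w wr; apply: ccontB; [exact: cf|exact: ccont_cst].
by move=> w wr; apply/ltW/hd; rewrite subr0 wr; lra.
Qed.

Lemma circle_mean_at_infinity f g r : 0 < r -> (forall w, r <= cabs w -> cdiffs f w) ->
  (forall w, r <= cabs w -> f w = g w^-1) -> ccont g 0 -> circle_mean f r = g 0.
Proof.
move=> r0 df fg g0; apply: cabs_close_eq => e /g0[d d0 hd].
pose r' := Num.max r (2 / d).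
have [rr1 rr2] : r <= r' /\ 2 / d <= r' by rewrite !le_max !lexx orbT.
have r'0 : 0 < r' by exact: lt_le_trans rr1.
rewrite (@circle_mean_regular f r r')//; last by move=> w /andP[w1 w2]; exact: df.
have cf : ccont_circle f r' by move=> w wr; apply/cdiffs_cont/df; rewrite wr.
rewrite -(circle_mean_cst (g 0) r') -circle_meanB//; [|exact: ltW|by move=> w _; exact: ccont_cst].
apply: circle_mean_le; first exact: ltW.
  by move=> w wr; apply: ccontB; [exact: cf|exact: ccont_cst].
move=> w wr; rewrite fg ?wr//; apply/ltW/hd; rewrite subr0 cabsV wr.
have : 2 <= r' * d by rewrite -ler_pdivrMr.
by rewrite invf_plt ?posrE//; rewrite -[X in X < _]mul1r ltr_pdivrMr//; lra.
Qed.

Lemma circle_mean_kernel_out z r : cabs z < r ->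
  circle_mean (fun w => w / (w - z)) r = 1.
Proof.
move=> zr; have r0 : 0 < r by rewrite (le_lt_trans _ zr)// cabs_ge0.
have n0 w : r <= cabs w -> w - z != 0.
  by move=> rw; rewrite subr_eq0; apply: contraTneq rw => ->; rewrite -ltNge.
rewrite (@circle_mean_at_infinity _ (fun v => (1 - z * v)^-1))//.
- by rewrite mulr0 subr0 invr1.
- by move=> w /n0 w0; cdiffs_auto.
- move=> w rw; have w0 : w != 0 by rewrite -cabs_gt0 (lt_le_trans r0).
  by have -> : 1 - z * w^-1 = (w - z) / w by [field]; rewrite invf_div.
- by ccont_auto; rewrite mulr0 subr0 oner_neq0.
Qed.

Lemma circle_mean_kernel_in z r : 0 < r < cabs z ->
  circle_mean (fun w => w / (w - z)) r = 0.
Proof.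
move=> /andP[r0 rz].
have n0 w : cabs w <= r -> w - z != 0.
  by move=> rw; rewrite subr_eq0; apply: contraTneq rw => ->; rewrite -ltNge.
rewrite circle_mean_at0 ?mul0r//.
- by move=> w /andP[_ /n0 w0]; cdiffs_auto.
- by ccont_auto; apply: n0; rewrite cabs0 ltW.
Qed.

Lemma cauchy_formula f z r1 r2 : 0 < r1 -> r1 < cabs z < r2 ->
  (forall w, r1 <= cabs w <= r2 -> cdiffs f w) ->
  circle_mean (fun w => f w * (w / (w - z))) r2 -
  circle_mean (fun w => f w * (w / (w - z))) r1 = f z.
Proof.
move=> r10 /andP[r1z zr2] df.
have [|d [q [qz _ fq]]] := df z; first by rewrite !ltW.
have r20 : 0 < r2 by lra.
have dq w : r1 <= cabs w <= r2 -> cdiffs q w \/ w = z.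
  move=> /df dfw; have [->|wz] := eqVneq w z; [by right|left].
  have wz0 : w - z != 0 by rewrite subr_eq0.
  apply: (@cdiffs_near _ (fun w => (f w - f z) / (w - z)) _ _ (cabs (w - z))).
  - by rewrite cabs_gt0.
  - move=> v vw; rewrite fq mulfK// subr_eq0; apply: contraTneq vw => ->.
    by rewrite cabs_distC ltxx.
  - by cdiffs_auto.
have E r : r1 <= r <= r2 -> r != cabs z -> circle_mean (fun w => q w * w) r =
    circle_mean (fun w => f w * (w / (w - z))) r - f z * circle_mean (fun w => w / (w - z)) r.
  move=> hr rz.
  have r0 : 0 <= r by lra.
  have n0 w : cabs w = r -> w - z != 0.
    by move=> wr; rewrite subr_eq0; apply: contra rz => /eqP <-; rewrite wr.
  have ck : ccont_circle (fun w => w / (w - z)) r.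
    by move=> w /n0 wz; ccont_auto.
  rewrite -circle_meanZ// -circle_meanB//.
  - by apply: eq_circle_mean => // w /n0 wz; rewrite -mulrBl fq; field.
  - move=> w wr; apply: ccontM; last exact: ck.
    by apply/cdiffs_cont/df; rewrite wr.
  - by move=> w wr; apply: ccontM; [exact: ccont_cst|exact: ck].
have : circle_mean (fun w => q w * w) r1 = circle_mean (fun w => q w * w) r2.
  apply: (@circle_mean_const _ _ _ (cabs z)) => //; first by lra.
  - move=> w /dq[/cdiffs_cont qw|->]; ccont_auto.
  - by move=> w /dq[qw _|->]; [cdiffs_auto|rewrite eqxx].
rewrite !E ?lexx ?ltW ?(lt_trans r1z)// ?(gt_eqF zr2) ?(lt_eqF r1z)//.
rewrite circle_mean_kernel_in ?r10// circle_mean_kernel_out// mulr0 subr0 mulr1 => ->.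
by ring.
Qed.

End CauchyFormula.

Section CauchyConsequences.
Variable R : realType.
Implicit Types (f g p u : R[i] -> R[i]) (z w l : R[i]) (x r s t rho : R).

Lemma ccont_circle_bounded f r : 0 <= r -> ccont_circle f r ->
  exists2 M : R, 0 < M & forall t, 0 <= t <= 1 -> cabs (f (circ r t)) <= M.
Proof.
move=> r0 cf.
have [N hN] : exists N, forall t, 0 <= t <= 1 -> cabs (f (circ r t)) <= N%:R.
  apply: (@unit_interval_cover R (fun N t => cabs (f (circ r t)) <= N%:R)) => x _.
  have [d d0 hd] := cf (circ r x) (cabs_circ _ r0) _ ltr01.
  have [d' d'0 hd'] := ccont_circ r x d0.
  exists (Num.bound (cabs (f (circ r x)) + 1)), d'; split=> // n t Nn tx.
  have h1 : cabs (f (circ r t) - f (circ r x)) < 1.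
    by apply/hd/hd'; rewrite // subrr normr0.
  have h2 := cabs_lerB (f (circ r t)) (f (circ r x)).
  have h3 := archi_boundP (addr_ge0 (cabs_ge0 (f (circ r x))) ler01).
  have h4 : (Num.bound (cabs (f (circ r x)) + 1))%:R <= n%:R :> R by rewrite ler_nat.
  by lra.
exists (N%:R + 1) => [|t /hN]; first by rewrite ltr_wpDl.
by lra.
Qed.

Lemma circle_mean_circ_le f r M : 0 <= r -> ccont_circle f r ->
  (forall t, 0 <= t <= 1 -> cabs (f (circ r t)) <= M) -> cabs (circle_mean f r) <= M.
Proof. by move=> r0 cf hM; apply: is_mean_le hM (mean_exists r0 cf). Qed.

Lemma cdiffs_kernel p u z s (d : R) : 0 <= s -> 0 < d ->
  ccont_circle p s -> ccont_circle u s ->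
  (forall w, cabs w = s -> d <= cabs (u w - z)) ->
  cdiffs (fun v => circle_mean (fun w => p w / (u w - v)) s) z.
Proof.
move=> s0 d0 cp cu uz.
have [M M0 hM] := ccont_circle_bounded s0 cp.
have d2 : 0 < d / 2 by lra.
have nz v w : cabs (v - z) < d / 2 -> cabs w = s -> d / 2 <= cabs (u w - v).
  move=> vz /uz h; have := cabs_normD (u w - v) (v - z).
  by rewrite subrKA; lra.
have ck v : cabs (v - z) < d / 2 -> ccont_circle (fun w => (u w - v)^-1) s.
  move=> vz w ws; have cuw := cu _ ws; ccont_auto.
  by rewrite -cabs_gt0 (lt_le_trans d2)// nz.
have zz : cabs (z - z) < d / 2 by rewrite subrr cabs0.
have cpk v : cabs (v - z) < d / 2 -> ccont_circle (fun w => p w / (u w - v)) s.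
  by move=> vz w ws; apply: ccontM; [exact: cp|exact: ck].
exists (circle_mean (fun w => p w / (u w - z) ^+ 2) s); apply/cdiffP => e e0.
pose C := 2 * M / d ^+ 3.
have C0 : 0 < C by rewrite divr_gt0 ?exprn_gt0// mulr_gt0.
exists (Num.min (d / 2) (e / C)); first by rewrite lt_min d2 divr_gt0.
move=> v; rewrite lt_min => /andP[vz vz'].
have ck2 : ccont_circle (fun w => p w / (u w - z) ^+ 2) s.
  move=> w ws; have := ck z zz w ws; under [in X in _ -> X]eq_fun do rewrite -exprVn.
  by move=> h; apply: ccontM; [exact: cp|exact: ccontX].
have ck3 : ccont_circle (fun w => (v - z) * (p w / (u w - z) ^+ 2)) s.
  by move=> w ws; apply: ccontM; [exact: ccont_cst|exact: ck2].
rewrite [_ * (v - z)]mulrC -circle_meanZ// -circle_meanB//; [|exact: cpk|exact: cpk].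
rewrite -circle_meanB//; last by move=> w ws; apply: ccontB; exact: cpk.
apply: (@le_trans _ _ (C * cabs (v - z) * cabs (v - z))); last first.
  rewrite ler_wpM2r ?cabs_ge0// mulrC -ler_pdivlMr//; exact: ltW.
apply: circle_mean_circ_le => // [w ws|t t01].
  by apply: ccontB; [apply: ccontB; exact: cpk|exact: ck3].
set w := circ s t; have ws : cabs w = s by exact: cabs_circ.
have h1 := nz v w vz ws; have h2 := uz w ws.
have n1 : u w - v != 0 by rewrite -cabs_gt0; lra.
have n2 : u w - z != 0 by rewrite -cabs_gt0; lra.
have -> : p w / (u w - v) - p w / (u w - z) - (v - z) * (p w / (u w - z) ^+ 2) =
    (v - z) ^+ 2 * (p w / ((u w - v) * (u w - z) ^+ 2)).
  by field; rewrite n1 n2.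
rewrite cabsM cabsX mulrC -mulrA -expr2 ler_wpM2r ?exprn_ge0 ?cabs_ge0//.
rewrite cabs_div cabsM cabsX /C.
have hp : cabs (p w) <= M by exact: hM.
have hd : d / 2 * d ^+ 2 <= cabs (u w - v) * cabs (u w - z) ^+ 2.
  apply: ler_pM => //; [exact: ltW|exact/exprn_ge0/ltW|].
  by rewrite lerXn2r ?nnegrE ?cabs_ge0 ?(ltW d0).
have dd : 0 < d / 2 * d ^+ 2 by rewrite mulr_gt0 ?exprn_gt0.
rewrite (_ : 2 * M / d ^+ 3 = M / (d / 2 * d ^+ 2)); last by field; rewrite gt_eqF.
by rewrite ler_pM ?cabs_ge0 ?invr_ge0 ?mulr_ge0 ?exprn_ge0 ?cabs_ge0// lef_pV2 ?posrE// (lt_le_trans dd).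
Qed.

Lemma ccont_uniform_limit (fn : nat -> R[i] -> R[i]) f z (r : R) : 0 < r ->
  (forall n, ccont (fn n) z) ->
  (forall e : R, 0 < e -> exists n, forall w, cabs (w - z) < r -> cabs (fn n w - f w) <= e) ->
  ccont f z.
Proof.
move=> r0 cfn unif e e0; have e4 : 0 < e / 4 by lra.
have [n hn] := unif _ e4; have [d d0 hd] := cfn n _ e4.
exists (Num.min r d) => [|w]; first by rewrite lt_min r0.
rewrite lt_min => /andP[wr /hd wd].
have -> : f w - f z = (fn n w - fn n z) - (fn n w - f w) + (fn n z - f z) by ring.
apply: le_lt_trans (cabs_normD _ _) _.
have := cabsB (fn n w - fn n z) (fn n w - f w).
have := hn _ wr; have := hn z; rewrite subrr cabs0 => /(_ r0).
by lra.
Qed.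

Lemma cdiffs_uniform_limit (fn : nat -> R[i] -> R[i]) f r1 r2 : 0 < r1 ->
  (forall n w, r1 < cabs w < r2 -> cdiffs (fn n) w) ->
  (forall e : R, 0 < e -> exists n, forall w, r1 < cabs w < r2 -> cabs (fn n w - f w) <= e) ->
  forall z, r1 < cabs z < r2 -> cdiffs f z.
Proof.
move=> r10 dfn unif z /andP[z1 z2].
have cf w : r1 < cabs w < r2 -> ccont f w.
  move=> /andP[w1 w2].
  apply: (@ccont_uniform_limit fn _ _ (Num.min (cabs w - r1) (r2 - cabs w))).
  - by rewrite lt_min !subr_gt0 w1.
  - by move=> n; apply/cdiffs_cont/dfn; rewrite w1.
  - move=> e /unif[n hn]; exists n => v; rewrite lt_min => /andP[v1 v2]; apply: hn.
    have := cabs_lerB v w; have := cabs_lerB' v w; move: v1 v2.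
    by rewrite !ltrBrDr => *; apply/andP; split; lra.
pose s1 := (r1 + cabs z) / 2; pose s2 := (cabs z + r2) / 2.
have [s1r s1z s2z s2r] : [/\ r1 < s1, s1 < cabs z, cabs z < s2 & s2 < r2].
  by rewrite /s1 /s2; split; lra.
have s10 : 0 <= s1 by lra.
have s20 : 0 <= s2 by lra.
have cp s : r1 < s < r2 -> ccont_circle (fun w => f w * w) s.
  by move=> hs w ws; apply: ccontM; [apply: cf; rewrite ws|exact: ccont_id].
have cs1 : ccont_circle (fun w => f w * w) s1 by apply: cp; lra.
have cs2 : ccont_circle (fun w => f w * w) s2 by apply: cp; lra.
pose F v := circle_mean (fun w => f w * w / (w - v)) s2 -
            circle_mean (fun w => f w * w / (w - v)) s1.
have r0 : 0 < Num.min (cabs z - s1) (s2 - cabs z) by rewrite lt_min !subr_gt0 s1z.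
apply: (@cdiffs_near _ F _ _ _ r0); last first.
  apply: cdiffsB.
    apply: (@cdiffs_kernel _ id _ _ (s2 - cabs z)) => // [|w _|w ws]; [lra|exact: ccont_id|].
    by have := cabs_lerB w z; rewrite ws.
  apply: (@cdiffs_kernel _ id _ _ (cabs z - s1)) => // [|w _|w ws]; [lra|exact: ccont_id|].
  by have := cabs_lerB' w z; rewrite ws.
move=> v; rewrite lt_min => /andP[v1 v2].
have [vs1 vs2] : s1 < cabs v /\ cabs v < s2.
  by have := cabs_lerB v z; have := cabs_lerB' v z; move: v1 v2; split; lra.
apply: cabs_close_eq => e e0.
pose K := 1 + s2 / (s2 - cabs v) + s1 / (cabs v - s1).
have K1 : 0 <= s2 / (s2 - cabs v) by rewrite divr_ge0// subr_ge0 ltW.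
have K2 : 0 <= s1 / (cabs v - s1) by rewrite divr_ge0// subr_ge0 ltW.
have K0 : 0 < K by rewrite /K; lra.
have [n hn] := unif _ (divr_gt0 e0 K0).
have fv : fn n v = circle_mean (fun w => fn n w * (w / (w - v))) s2 -
                   circle_mean (fun w => fn n w * (w / (w - v))) s1.
  rewrite cauchy_formula//; first by lra.
    by rewrite vs1.
  by move=> w /andP[w1 w2]; apply: dfn; apply/andP; split; lra.
have est s (D : R) : r1 < s < r2 -> 0 < D -> (forall w, cabs w = s -> D <= cabs (w - v)) ->
    cabs (circle_mean (fun w => f w * w / (w - v)) s -
          circle_mean (fun w => fn n w * (w / (w - v))) s) <= e / K * (s / D).
  move=> hs D0 hD; have s0 : 0 <= s by lra.
  have nz w : cabs w = s -> w - v != 0 by move=> /hD h; rewrite -cabs_gt0; lra.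
  have c1 : ccont_circle (fun w => f w * w / (w - v)) s.
    by move=> w ws; have := nz _ ws; have := cp _ hs _ ws => ? ?; ccont_auto.
  have c2 : ccont_circle (fun w => fn n w * (w / (w - v))) s.
    move=> w ws; have := nz _ ws => ?.
    have : ccont (fn n) w by apply/cdiffs_cont/dfn; rewrite ws.
    by move=> ?; ccont_auto.
  rewrite -circle_meanB//.
  apply: circle_mean_le => // [w ws|w ws].
    by apply: ccontB; [exact: c1|exact: c2].
  have -> : f w * w / (w - v) - fn n w * (w / (w - v)) =
     - ((fn n w - f w) * (w / (w - v))) by ring.
  rewrite cabsN cabsM cabs_div ws ler_pM ?divr_ge0 ?cabs_ge0//.
    by apply: hn; rewrite ws.
  by rewrite ler_wpM2l// lef_pV2 ?posrE// ?hD// (lt_le_trans D0)// hD.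
have h2 : cabs (circle_mean (fun w => f w * w / (w - v)) s2 -
    circle_mean (fun w => fn n w * (w / (w - v))) s2) <= e / K * (s2 / (s2 - cabs v)).
  by apply: est => [||w <-]; [lra|lra|exact: cabs_lerB].
have h1 : cabs (circle_mean (fun w => f w * w / (w - v)) s1 -
    circle_mean (fun w => fn n w * (w / (w - v))) s1) <= e / K * (s1 / (cabs v - s1)).
  by apply: est => [||w <-]; [lra|lra|exact: cabs_lerB'].
have h3 : cabs (fn n v - f v) <= e / K by apply: hn; apply/andP; split; lra.
have -> : F v - f v = (circle_mean (fun w => f w * w / (w - v)) s2 -
          circle_mean (fun w => fn n w * (w / (w - v))) s2) -
   (circle_mean (fun w => f w * w / (w - v)) s1 -
          circle_mean (fun w => fn n w * (w / (w - v))) s1) + (fn n v - f v).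
  by rewrite fv /F; ring.
apply: le_trans (cabs_normD _ _) _.
apply: (@le_trans _ _ (e / K * (s2 / (s2 - cabs v)) + e / K * (s1 / (cabs v - s1)) + e / K)).
  by apply: lerD => //; apply: le_trans (cabsB _ _) _; exact: lerD.
by rewrite -mulrDr -[X in _ + X]mulr1 -mulrDr (_ : _ + 1 = K) ?divfK ?gt_eqF// /K; ring.
Qed.

End CauchyConsequences.

Section CircleUniqueness.
Variable R : realType.
Implicit Types (f g p u : R[i] -> R[i]) (z w l : R[i]) (x r s t rho : R).

Lemma geometric_kernel (k c : R[i]) N : k = 1 + c * k ->
  k = \sum_(0 <= n < N) c ^+ n + c ^+ N * k.
Proof.
move=> kE; elim: N => [|N IH]; first by rewrite big_geq// expr0 mul1r add0r.
by rewrite big_nat_recr//= -addrA exprSr -mulrA -[c ^+ N as X in X + _]mulr1 -mulrDr -kE.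
Qed.

Lemma geometric_vanish (a : R[i]) (q M : R) : 0 <= q < 1 -> 0 < M ->
  (forall N, cabs a <= M * q ^+ N) -> a = 0.
Proof.
move=> hq M0 h; apply: cabs_small_eq0 => e e0.
have [N /(_ _ (leqnn _)) hN] := geometric_small hq (divr_gt0 e0 M0).
by apply: le_trans (h N) _; rewrite mulrC -ler_pdivlMr.
Qed.

Lemma circle_mean_geometric_zero (phi c k : R[i] -> R[i]) s (q : R) : 0 <= s -> 0 <= q < 1 ->
  ccont_circle phi s -> ccont_circle c s -> ccont_circle k s ->
  (forall w, cabs w = s -> cabs (c w) = q) ->
  (forall w, cabs w = s -> k w = 1 + c w * k w) ->
  (forall n, circle_mean (fun w => phi w * c w ^+ n) s = 0) ->
  circle_mean (fun w => phi w * k w) s = 0.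
Proof.
move=> s0 hq cphi cc ck cq kE zero.
have cpk : ccont_circle (fun w => phi w * k w) s.
  by move=> w ws; apply: ccontM; [exact: cphi|exact: ck].
have [M M0 hM] := ccont_circle_bounded s0 cpk.
apply: (geometric_vanish hq M0) => N.
have cn n : ccont_circle (fun w => phi w * c w ^+ n) s.
  by move=> w ws; apply: ccontM; [exact: cphi|apply: ccontX; exact: cc].
have cN : ccont_circle (fun w => phi w * k w * c w ^+ N) s.
  by move=> w ws; apply: ccontM; [exact: cpk|apply: ccontX; exact: cc].
have -> : circle_mean (fun w => phi w * k w) s = circle_mean (fun w => phi w * k w * c w ^+ N) s.
  rewrite (@eq_circle_mean _ _ (fun w => \sum_(0 <= n < N) phi w * c w ^+ n +
    phi w * k w * c w ^+ N))//; last first.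
    move=> w ws; rewrite {1}(geometric_kernel N (kE w ws)) mulrDr mulr_sumr.
    by congr (_ + _); ring.
  rewrite circle_meanD//; last first.
    move=> w ws; elim: (index_iota 0 N) => [|n l IH].
      by under eq_fun do rewrite big_nil; exact: ccont_cst.
    by under eq_fun do rewrite big_cons; apply: ccontD => //; exact: cn.
  by rewrite circle_mean_sum// big1 ?add0r.
apply: circle_mean_circ_le => // t t01.
rewrite cabsM cabsX cq ?cabs_circ// ler_wpM2r ?exprn_ge0//; last exact: hM.
by case/andP: hq.
Qed.

Lemma eq0_on_unit_circle f r1 r2 : 0 < r1 < 1 -> 1 < r2 ->
  (forall w, r1 < cabs w < r2 -> cdiffs f w) ->
  (forall w, cabs w = 1 -> f w = 0) -> forall z, r1 < cabs z < r2 -> f z = 0.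
Proof.
move=> /andP[r10 r11] r21 df f0 z /andP[z1 z2].
have [zE|zN1] := eqVneq (cabs z) 1; first exact: f0.
have z0 : z != 0 by rewrite -cabs_gt0; lra.
have nz w : cabs w != cabs z -> w - z != 0.
  by apply: contra; rewrite subr_eq0 => /eqP ->.
have nz' w : cabs w != cabs z -> z - w != 0 by move=> /nz h; rewrite -opprB oppr_eq0.
pose F g w := f w * g w.
have mean1 g : circle_mean (F g) 1 = 0.
  rewrite -(circle_mean_cst (0 : R[i]) 1); apply: eq_circle_mean => // w /f0.
  by rewrite /F => ->; rewrite mul0r.
have inner g s : r1 < s <= 1 -> (forall w, s <= cabs w <= 1 -> cdiffs g w) ->
    circle_mean (F g) s = 0.
  move=> /andP[hs1 hs2] dg; rewrite -(mean1 g); apply: circle_mean_regular => //; first by lra.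
  move=> w /andP[w1 w2]; apply: cdiffsM; last by apply: dg; rewrite w1.
  by apply: df; apply/andP; split; lra.
have outer g s : 1 <= s < r2 -> (forall w, 1 <= cabs w <= s -> cdiffs g w) ->
    circle_mean (F g) s = 0.
  move=> /andP[hs1 hs2] dg; rewrite -(mean1 g); apply/esym/circle_mean_regular => //.
  move=> w /andP[w1 w2]; apply: cdiffsM; last by apply: dg; rewrite w1.
  by apply: df; apply/andP; split; lra.
have cF g s : r1 < s < r2 -> ccont_circle g s -> ccont_circle (F g) s.
  move=> hs cg w ws; apply: ccontM; last exact: cg.
  by apply/cdiffs_cont/df; rewrite ws.
have [s1 [s2 [h1 h2 h3 [h4 h5 h6]]]] : exists s1 s2 : R,
    [/\ r1 < s1, s1 < cabs z, s1 < 1 & [/\ s2 < r2, cabs z < s2 & 1 < s2]].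
  have [z11|z11] := ltP (cabs z) 1.
    by exists ((r1 + cabs z) / 2), ((1 + r2) / 2); do 2?split; lra.
  by exists ((r1 + 1) / 2), ((cabs z + r2) / 2); do 2?split; lra.
have -> : f z = circle_mean (F (fun w => w / (w - z))) s2 -
                circle_mean (F (fun w => w / (w - z))) s1.
  rewrite cauchy_formula//; [lra|by rewrite h2|].
  by move=> w /andP[w1 w2]; apply: df; apply/andP; split; lra.
have dk w : cabs w != cabs z -> cdiffs (fun w => w / (w - z)) w.
  by move=> /nz w0; cdiffs_auto.
have [z11|z11] := ltP (cabs z) 1.
  rewrite (outer _ s2); [|lra|by move=> w /andP[w1 w2]; apply: dk; apply/eqP; lra].
  have E w : cabs w = s1 -> F (fun w => w / (w - z)) w =
      (F (fun w => -1 * (w / z)) w) * (z / (z - w)).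
    move=> ws; have n1 := nz w; have n2 := nz' w; rewrite ws in n1 n2.
    by rewrite /F; field; rewrite z0 n1 ?n2// lt_eqF.
  rewrite (eq_circle_mean _ E) ?sub0r; last by lra.
  rewrite (@circle_mean_geometric_zero _ (fun w => w / z) _ _ (s1 / cabs z)) ?oppr0//.
  - by lra.
  - have zz : 0 < cabs z by lra.
    by apply/andP; split; [apply: divr_ge0; lra|rewrite ltr_pdivrMr// mul1r].
  - by apply: cF => [|w _]; [lra|ccont_auto].
  - by move=> w _; ccont_auto.
  - move=> w ws; have n2 := nz' w; rewrite ws (lt_eqF h2) in n2.
    by have {}n2 := n2 isT; ccont_auto.
  - by move=> w ws; rewrite cabs_div ws.
  - move=> w ws; have n2 := nz' w; rewrite ws (lt_eqF h2) in n2.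
    by field; rewrite z0 n2.
  - move=> n; rewrite -[RHS](inner (fun w => -1 * (w / z) * (w / z) ^+ n) s1).
    + by congr (circle_mean _ _); apply/funext => w; rewrite /F; ring.
    + by lra.
    + by move=> w _; cdiffs_auto.
rewrite (inner _ s1); [rewrite subr0|lra|]; last first.
  by move=> w /andP[w1 w2]; apply: dk; apply/eqP; move: zN1; rewrite neq_lt; lra.
have s20 : s2 > 0 by lra.
have w0 w : cabs w = s2 -> w != 0 by move=> ws; rewrite -cabs_gt0 ws.
have w1 w : 1 <= cabs w -> w != 0 by move=> ws; rewrite -cabs_gt0; lra.
rewrite (@circle_mean_geometric_zero f (fun w => z / w) (fun w => w / (w - z)) _ (cabs z / s2))//.
- exact: ltW.
- by apply/andP; split; [apply: divr_ge0; lra|rewrite ltr_pdivrMr// mul1r].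
- by move=> w ws; apply/cdiffs_cont/df; rewrite ws; lra.
- by move=> w /w0 ?; ccont_auto.
- move=> w ws; have n2 := nz w; rewrite ws (gt_eqF h5) in n2.
  by have {}n2 := n2 isT; ccont_auto.
- by move=> w ws; rewrite cabs_div ws.
- move=> w ws; have n2 := nz w; rewrite ws (gt_eqF h5) in n2.
  by field; rewrite ?(w0 _ ws) ?n2.
- move=> n; apply: (outer (fun w => (z / w) ^+ n)); first by lra.
  by move=> w /andP[/w1 ? _]; cdiffs_auto.
Qed.

End CircleUniqueness.

(** * Triangular nuclear operators *)

Section NormedSpace.
Variables (R : realType) (V : normedModType R[i]).
Implicit Types (u v f g : V) (a k mu : R[i]).

Definition rnorm v : R := complex.Re `|v|.

Lemma rnormE v : `|v| = (rnorm v)%:C%C.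
Proof. by rewrite /rnorm RRe_real// normr_real. Qed.

Lemma rnorm_ge0 v : 0 <= rnorm v.
Proof. by rewrite -ler0c -rnormE. Qed.

Lemma rnormD u v : rnorm (u + v) <= rnorm u + rnorm v.
Proof. by rewrite -lecR rmorphD /= -!rnormE ler_normD. Qed.

Lemma rnormN v : rnorm (- v) = rnorm v.
Proof. by rewrite /rnorm normrN. Qed.

Lemma rnormB u v : rnorm (u - v) <= rnorm u + rnorm v.
Proof. by rewrite (le_trans (rnormD _ _))// rnormN. Qed.

Lemma rnormZ a v : rnorm (a *: v) = cabs a * rnorm v.
Proof. by apply: complexI; rewrite rmorphM /= -!rnormE normrZ cabsE. Qed.

Lemma rnorm0 : rnorm 0 = 0.
Proof. by rewrite /rnorm normr0. Qed.

Lemma rnorm_eq0 v : rnorm v = 0 -> v = 0.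
Proof. by move=> h; apply/eqP; rewrite -normr_eq0 rnormE h. Qed.

Lemma rnorm_gt0 v : v != 0 -> 0 < rnorm v.
Proof.
move=> v0; rewrite lt_def rnorm_ge0 andbT; apply: contra v0 => /eqP h.
by apply/eqP/rnorm_eq0.
Qed.

Lemma rnorm_small v : (forall e : R, 0 < e -> rnorm v <= e) -> v = 0.
Proof.
move=> h; apply/rnorm_eq0/eqP; rewrite eq_le rnorm_ge0 andbT.
by apply/ler_addgt0Pr => e e0; rewrite add0r h.
Qed.

Lemma continuous_bounded (S : {linear V -> V}) :
  continuous S <-> exists M : R, forall v, rnorm (S v) <= M * rnorm v.
Proof.
rewrite -linear_bounded_continuous linear_boundedP; split.
  move=> [M [Mr hM]]; exists (complex.Re M + 1) => v.
  have M1 : M < (complex.Re M + 1)%:C%C.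
    by rewrite rmorphD /= RRe_real// ltrDl ltr01.
  by have := hM _ M1 v; rewrite !rnormE -rmorphM /= lecR.
move=> [M hM]; exists `|M|%:C%C; split.
  by apply/complex_realP; exists `|M|.
move=> y My v; rewrite !rnormE.
have y0 : 0 <= y by apply: le_trans (ltW My); rewrite ler0c.
have yr : y \is Num.real by exact: ger0_real.
rewrite -(RRe_real yr) in My *; rewrite -rmorphM /= lecR.
rewrite ltcR in My.
apply: le_trans (hM v) _; rewrite ler_wpM2r ?rnorm_ge0//.
exact: le_trans (ler_norm _) (ltW My).
Qed.

Definition cinvertible (A : V -> V) := exists S : {linear V -> V},
  [/\ continuous S, cancel A S & cancel S A].

Lemma linear_pack (F : V -> V) : linear F -> exists S : {linear V -> V}, S =1 F.
Proof.
move=> hF; pose H := GRing.isLinear.Build _ _ _ _ F hF.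
pose S : {linear V -> V} := HB.pack F H.
by exists S.
Qed.

Lemma cinvertible_intro (A F : V -> V) (M : R) : linear F ->
  (forall v, rnorm (F v) <= M * rnorm v) -> cancel A F -> cancel F A -> cinvertible A.
Proof.
move=> /linear_pack[S SF] hM AF FA; exists S; split.
- by apply/continuous_bounded; exists M => v; rewrite SF.
- by move=> v; rewrite SF AF.
- by move=> v; rewrite SF FA.
Qed.

Lemma cinvertible_comp (A B : V -> V) : cinvertible A -> cinvertible B ->
  cinvertible (fun v => A (B v)).
Proof.
move=> [S [/continuous_bounded[M hM] AS SA]] [T [/continuous_bounded[N hN] BT TB]].
apply: (@cinvertible_intro _ (fun v => T (S v)) (`|N| * `|M|)).
- by move=> k u v; rewrite !linearP.
- move=> v; apply: le_trans (hN _) _.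
  apply: (@le_trans _ _ (`|N| * rnorm (S v))).
    by rewrite ler_wpM2r ?rnorm_ge0// ler_norm.
  rewrite -mulrA ler_wpM2l//; apply: le_trans (hM _) _.
  by rewrite ler_wpM2r ?rnorm_ge0// ler_norm.
- by move=> v; rewrite AS BT.
- by move=> v; rewrite TB SA.
Qed.

Lemma cinvertibleZ mu : mu != 0 -> cinvertible (fun v => mu *: v).
Proof.
move=> mu0; apply: (@cinvertible_intro _ (fun v => mu^-1 *: v) (cabs mu^-1)).
- by move=> k u v; rewrite scalerDr !scalerA mulrC.
- by move=> v; rewrite rnormZ.
- by move=> v; rewrite scalerA mulVf// scale1r.
- by move=> v; rewrite scalerA mulfV// scale1r.
Qed.

Lemma eq_cinvertible (A B : V -> V) : A =1 B -> cinvertible A -> cinvertible B.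
Proof.
move=> AB [S [cS AS SA]]; exists S; split=> // v.
  by rewrite -AB AS.
by rewrite -AB SA.
Qed.

Definition geometrically_complete := forall (u : nat -> V) (C q : R), 0 <= q < 1 ->
  (forall n, rnorm (u n) <= C * q ^+ n) ->
  exists v, forall e : R, 0 < e -> exists N, forall n, (N <= n)%N ->
    rnorm (\sum_(0 <= i < n) u i - v) <= e.

Lemma neumann (K : V -> V) (q : R) : geometrically_complete -> linear K -> 0 <= q < 1 ->
  (forall v, rnorm (K v) <= q * rnorm v) -> cinvertible (fun v => v - K v).
Proof.
move=> cpl linK q01 hK; case/andP: (q01) => q0 q1.
have KZ a u v : K (a *: u + v) = a *: K u + K v by exact: linK.
have KB u v : K (u - v) = K u - K v.
  by rewrite -[- v]scaleN1r addrC linK scaleN1r addrC.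
have KD u v : K (u + v) = K u + K v by have := KZ 1 u v; rewrite !scale1r.
have inj v : v - K v = 0 -> v = 0.
  move=> /eqP; rewrite subr_eq0 => /eqP vK; apply/rnorm_eq0.
  have := hK v; rewrite -vK; have := rnorm_ge0 v; nra.
have low v : (1 - q) * rnorm v <= rnorm (v - K v).
  have := rnormD (v - K v) (K v); rewrite subrK; have := hK v; lra.
have surj g : exists f, f - K f = g.
  have hu n : rnorm (iter n K g) <= rnorm g * q ^+ n.
    elim: n => [|n IH]; first by rewrite expr0 mulr1.
    by rewrite iterS (le_trans (hK _))// exprS mulrCA ler_wpM2l.
  have [f hf] := cpl _ _ _ q01 hu; exists f.
  apply/eqP; rewrite -subr_eq0; apply/eqP/rnorm_small => e e0.
  have e4 : 0 < e / 4 by lra.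
  have C0 : 0 < rnorm g + 1 by rewrite ltr_wpDl// rnorm_ge0.
  have [N hN] := hf _ e4; have [N' hN'] := geometric_small q01 (divr_gt0 e4 C0).
  pose n := maxn N N'; have {}hN := hN n (leq_maxl _ _); have {}hN' := hN' n (leq_maxr _ _).
  set s := \sum_(0 <= i < n) _ in hN.
  have sK : s - K s = g - iter n K g.
    rewrite /s; elim: n {s hN hN'} => [|n IH].
      have K0 : K 0 = 0 by have := KB 0 0; rewrite !subrr.
      by rewrite big_geq// K0 !subrr.
    by rewrite big_nat_recr//= KD opprD addrACA IH subrKA.
  pose D := s - f.
  have fD : f - K f - g = - (iter n K g + (D - K D)).
    have H : f - K f + (D - K D) = g - iter n K g.
      rewrite addrACA -opprD -sK; congr (_ - _); first by rewrite /D addrC subrK.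
      by rewrite KB addrC subrK.
    by rewrite -[f - K f](addrK (D - K D)) H addrAC [g - _ - g]addrAC subrr sub0r [RHS]opprD.
  rewrite fD rnormN; apply: le_trans (rnormD _ _) _.
  have h1 := rnormB D (K D); have h2 := hK D; have h3 : rnorm D <= e / 4 := hN.
  have h4 : rnorm (iter n K g) <= e / 4.
    apply: le_trans (hu n) _.
    apply: (@le_trans _ _ ((rnorm g + 1) * (e / 4 / (rnorm g + 1)))).
      by rewrite ler_pM ?rnorm_ge0 ?exprn_ge0// lerDl.
    by rewrite mulrC divfK// gt_eqF.
  have h5 : q * rnorm D <= rnorm D by rewrite ler_piMl ?rnorm_ge0// ltW.
  lra.
have [F hF] : exists F, forall g, F g - K (F g) = g.
  by have [F hF] := choice surj; exists F.
have uniq u v : u - K u = v - K v -> u = v.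
  move=> uv; apply/eqP; rewrite -subr_eq0; apply/eqP/inj.
  have -> : u - v - K (u - v) = (u - K u) - (v - K v) by rewrite KB !opprD !opprK addrACA.
  by rewrite uv subrr.
have FK v : F (v - K v) = v by apply: uniq; rewrite hF.
apply: (@cinvertible_intro _ F (1 - q)^-1) => //.
- move=> a u v; apply: uniq; rewrite hF KZ.
  by rewrite opprD addrACA -scalerBr !hF.
- move=> v; rewrite mulrC ler_pdivlMr ?subr_gt0// mulrC.
  by have := low (F v); rewrite hF.
Qed.

End NormedSpace.

Section TriangularNuclear.
Variables (R : realType) (V : normedModType R[i]) (L : {linear V -> V}).
Variables (e : nat -> V) (a : nat -> V -> R[i]).
Implicit Types (u v f g : V) (k mu : R[i]).

(* The rank one operators are P_i v = c i v *: e i, and partial n is the sum of the first n. *)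
Let c i v := a i (L v).
Let d i := c i (e i).
Let partial n v := \sum_(i < n) c i v *: e i.

Hypothesis cplV : geometrically_complete V.
Hypothesis ctsL : continuous L.
Hypothesis lin_a : forall i k u v, a i (k *: u + v) = k * a i u + a i v.
Hypothesis bnd_a : forall i, exists M : R, forall v, cabs (a i v) <= M * rnorm v.
Hypothesis a_e : forall i j, a i (e j) = (i == j)%:R.
Hypothesis tri : forall i j, (j < i)%N -> c i (e j) = 0.
Hypothesis approx : forall eps : R, 0 < eps -> exists N, forall n, (N <= n)%N ->
  forall v, rnorm (L v - partial n v) <= eps * rnorm v.

Lemma icoordP i k u v : c i (k *: u + v) = k * c i u + c i v.
Proof. by rewrite /c linearP lin_a. Qed.

Lemma icoord0 i : c i 0 = 0.
Proof. by have := icoordP i (-1) 0 0; rewrite scaler0 addr0 mulN1r addNr. Qed.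

Lemma icoordD i u v : c i (u + v) = c i u + c i v.
Proof. by have := icoordP i 1 u v; rewrite scale1r mul1r. Qed.

Lemma icoordZ i k u : c i (k *: u) = k * c i u.
Proof. by have := icoordP i k u 0; rewrite icoord0 !addr0. Qed.

Lemma icoordB i u v : c i (u - v) = c i u - c i v.
Proof. by rewrite icoordD -scaleN1r icoordZ mulN1r. Qed.

Lemma icoord_sum i (I : finType) (x : I -> V) : c i (\sum_j x j) = \sum_j c i (x j).
Proof. exact: (big_morph _ (icoordD i) (icoord0 i)). Qed.

Lemma coord0 i : a i 0 = 0.
Proof. by have := lin_a i (-1) 0 0; rewrite scaler0 addr0 mulN1r addNr. Qed.

Lemma coordD i u v : a i (u + v) = a i u + a i v.
Proof. by have := lin_a i 1 u v; rewrite scale1r mul1r. Qed.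

Lemma coordZ i k u : a i (k *: u) = k * a i u.
Proof. by have := lin_a i k u 0; rewrite coord0 !addr0. Qed.

Lemma coord_sum i (I : finType) (x : I -> V) : a i (\sum_j x j) = \sum_j a i (x j).
Proof. exact: (big_morph _ (coordD i) (coord0 i)). Qed.

Lemma icoord_bounded i : exists M : R, forall v, cabs (c i v) <= M * rnorm v.
Proof.
have [M hM] := bnd_a i; have [N hN] := (continuous_bounded L).1 ctsL.
exists (`|M| * `|N|) => v; apply: le_trans (hM _) _.
apply: (@le_trans _ _ (`|M| * rnorm (L v))); first by rewrite ler_wpM2r ?rnorm_ge0// ler_norm.
rewrite -mulrA ler_wpM2l//; apply: le_trans (hN _) _.
by rewrite ler_wpM2r ?rnorm_ge0// ler_norm.
Qed.

Lemma partialP n k u v : partial n (k *: u + v) = k *: partial n u + partial n v.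
Proof.
rewrite /partial scaler_sumr -big_split; apply: eq_bigr => i _.
by rewrite icoordP scalerDl scalerA.
Qed.

Lemma cinvertible_rank1 i mu : mu != 0 -> d i != mu ->
  cinvertible (fun v => v - (c i v / mu) *: e i).
Proof.
move=> mu0 dmu; have dmu0 : mu - d i != 0 by rewrite subr_eq0 eq_sym.
have [M hM] := icoord_bounded i.
apply: (@cinvertible_intro R V _ (fun v => v + (c i v / (mu - d i)) *: e i)
  (1 + M / cabs (mu - d i) * rnorm (e i))).
- move=> k u v; rewrite icoordP mulrDl scalerDl -mulrA -scalerA scalerDr.
  by rewrite addrACA.
- move=> v; apply: le_trans (rnormD _ _) _; rewrite mulrDl mul1r lerD2l rnormZ.
  rewrite mulrAC ler_wpM2r ?rnorm_ge0// cabs_div mulrAC ler_wpM2r ?invr_ge0 ?cabs_ge0//.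
- move=> v; rewrite icoordB icoordZ -/(d i).
  have -> : (c i v - c i v / mu * d i) / (mu - d i) = c i v / mu by field; rewrite mu0.
  by rewrite subrK.
- move=> v; rewrite icoordD icoordZ -/(d i).
  have -> : (c i v + c i v / (mu - d i) * d i) / mu = c i v / (mu - d i).
    by field; rewrite ?mu0 ?dmu0.
  by rewrite addrK.
Qed.

(* 1 - partial n / mu = (1 - P_(n-1)/mu) ... (1 - P_0/mu) because c_i (e_j) = 0 for j < i. *)
Lemma cinvertible_partial n mu : mu != 0 -> (forall i, (i < n)%N -> d i != mu) ->
  cinvertible (fun v => v - mu^-1 *: partial n v).
Proof.
move=> mu0; elim: n => [|n IH] dn.
  apply: (@cinvertible_intro R V _ idfun 1) => // v; rewrite ?mul1r//=.
    by rewrite /partial big_ord0 scaler0 subr0.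
  by rewrite /partial big_ord0 scaler0 subr0.
have := cinvertible_comp (cinvertible_rank1 mu0 (dn n (leqnn _))) (IH (fun i h => dn i (ltnW h))).
apply: eq_cinvertible => v.
have -> : c n (v - mu^-1 *: partial n v) = c n v.
  rewrite icoordB icoordZ [c n (partial n v)](@icoord_sum n 'I_n (fun i => c i v *: e i)).
  by rewrite big1 ?mulr0 ?subr0// => i _; rewrite icoordZ tri// mulr0.
rewrite /partial big_ord_recr /= scalerDr opprD addrA scalerA mulrC.
by [].
Qed.

Definition spanned n v := exists x : nat -> R[i], v = \sum_(i < n) x i *: e i.

Lemma spannedP n k u v : spanned n u -> spanned n v -> spanned n (k *: u + v).
Proof.
move=> [x ->] [y ->]; exists (fun i => k * x i + y i).
rewrite scaler_sumr -big_split; apply: eq_bigr => i _ /=.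
by rewrite scalerDl scalerA.
Qed.

Lemma spanned0 n : spanned n 0.
Proof. by exists (fun=> 0); rewrite big1// => i _; rewrite scale0r. Qed.

Lemma spannedZ n k u : spanned n u -> spanned n (k *: u).
Proof. by move=> hu; have := spannedP k hu (spanned0 n); rewrite addr0. Qed.

Lemma spannedD n u v : spanned n u -> spanned n v -> spanned n (u + v).
Proof. by move=> hu hv; have := spannedP 1 hu hv; rewrite scale1r. Qed.

Lemma spannedB n u v : spanned n u -> spanned n v -> spanned n (u - v).
Proof. by move=> hu hv; rewrite -scaleN1r; apply: spannedD => //; exact: spannedZ. Qed.

Lemma spanned_widen m n v : (m <= n)%N -> spanned m v -> spanned n v.
Proof.
move=> mn [x ->]; exists (fun i => if (i < m)%N then x i else 0).
rewrite (big_ord_widen_cond n xpredT (fun i => x i *: e i))// big_mkcond /=.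
by apply: eq_bigr => i _; case: ifP; rewrite ?scale0r.
Qed.

Lemma spanned_partial n v : spanned n (partial n v).
Proof. by exists (fun i => c i v). Qed.

Lemma L_basis n j : (j < n)%N -> L (e j) = partial n (e j).
Proof.
move=> jn; apply/eqP; rewrite -subr_eq0; apply/eqP/rnorm_small => eps eps0.
have C0 : 0 < rnorm (e j) + 1 by rewrite ltr_wpDl// rnorm_ge0.
have [N hN] := approx (divr_gt0 eps0 C0).
have stable m : (n <= m)%N -> partial m (e j) = partial n (e j).
  move=> /subnK <-; elim: (m - n)%N => //= l IH.
  rewrite addSn /partial big_ord_recr /= -/(partial _ _) IH tri ?scale0r ?addr0//.
  by rewrite (leq_trans jn)// leq_addl.
have := hN (maxn N n) (leq_maxl _ _) (e j); rewrite stable ?leq_maxr// => h.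
apply: le_trans h _; rewrite mulrAC ler_pdivrMr// ler_pM2l//.
by rewrite lerDl.
Qed.

Lemma L_spanned n v : spanned n v -> L v = partial n v.
Proof.
move=> [x ->]; rewrite linear_sum.
have -> : forall m, partial n (\sum_(i < m) x i *: e i) = \sum_(i < m) x i *: partial n (e i).
  elim=> [|m IH].
    rewrite !big_ord0; have := partialP n (-1) 0 0.
    by rewrite scaler0 addr0 scaleN1r addNr.
  by rewrite !big_ord_recr /= addrC partialP IH addrC.
by apply: eq_bigr => i _; rewrite linearZ /= (L_basis (ltn_ord i)).
Qed.

Lemma residual_small mu : mu != 0 -> exists n, exists2 q : R, 0 <= q < 1 &
  forall v, rnorm (mu^-1 *: (L v - partial n v)) <= q * rnorm v.
Proof.
move=> mu0; have cm : 0 < cabs mu by rewrite cabs_gt0.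
have cm2 : 0 < cabs mu / 2 by lra.
have [N hN] := approx cm2; exists N, (1 / 2); first by lra.
move=> v; rewrite rnormZ cabsV mulrC ler_pdivrMr//.
by apply: le_trans (hN _ (leqnn _) v) _; rewrite le_eqVlt; apply/orP; left; apply/eqP; field.
Qed.

Lemma resolvent_triangular mu : mu != 0 -> (forall i, d i != mu) -> resolvent_set L mu.
Proof.
move=> mu0 dmu.
have [N [q q01 hq]] := residual_small mu0.
pose K v := mu^-1 *: (L v - partial N v).
have linK : linear K.
  move=> k u v; rewrite /K linearP partialP opprD addrACA -scalerBr scalerDr.
  by rewrite !scalerA mulrC.
have iK := neumann cplV linK q01 hq.
have iP := @cinvertible_partial N mu mu0 (fun i _ => dmu i).
have := cinvertible_comp (cinvertibleZ V mu0) (cinvertible_comp iK iP).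
move=> [S [cS AS SA]]; exists S.
suff E v : mu *: (v - mu^-1 *: partial N v - K (v - mu^-1 *: partial N v)) = mu *: v - L v.
  by split=> // v; rewrite -E ?AS ?SA.
have KB u w : K (u - w) = K u - K w.
  by rewrite addrC -scaleN1r linK scaleN1r addrC.
have K0 u : spanned N u -> K u = 0 by move=> /L_spanned h; rewrite /K h subrr scaler0.
rewrite KB (K0 (_ *: _)) ?subr0; last by apply: spannedZ; exact: spanned_partial.
rewrite /K -addrA -opprD -scalerDr [partial N v + _]addrC subrK scalerBr scalerA mulfV// scale1r.
by [].
Qed.

(* A bounded inverse S would give c_N (S e_N) = -1, whereas the norm of P_N tends to 0. *)
Lemma zero_spectrum : spectrum L 0.
Proof.
move=> [S [/continuous_bounded[M hM] _ SA]].
have e_neq0 n : e n != 0.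
  apply/eqP => en0; have := a_e n n.
  by rewrite en0 coord0 eqxx => /eqP; rewrite eq_sym oner_eq0.
have M1 : 0 < `|M| + 1 by rewrite ltr_wpDl.
have eps0 : 0 < 1 / 4 / (`|M| + 1) by rewrite !divr_gt0.
have [N hN] := approx eps0.
have := SA (e N); rewrite scale0r sub0r => LS.
have cN : c N (S (e N)) = -1.
  by rewrite /c -[L _]opprK LS -scaleN1r coordZ a_e eqxx mulr1.
have h1 := hN N (leqnn _) (S (e N)); have h2 := hN N.+1 (leqnSn _) (S (e N)).
have E : e N = (L (S (e N)) - partial N.+1 (S (e N))) - (L (S (e N)) - partial N (S (e N))).
  rewrite /partial big_ord_recr /= cN scaleN1r -/(partial N _).
  by rewrite [- (partial N _ - _)]opprD opprK addrA [RHS]addrC addKr.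
have := rnormB (L (S (e N)) - partial N.+1 (S (e N))) (L (S (e N)) - partial N (S (e N))).
rewrite -E; have := rnorm_gt0 (e_neq0 N).
have : 1 / 4 / (`|M| + 1) * rnorm (S (e N)) <= 1 / 4 * rnorm (e N).
  have : rnorm (S (e N)) <= (`|M| + 1) * rnorm (e N).
    apply: le_trans (hM _) _.
    by rewrite ler_wpM2r ?rnorm_ge0//; have := ler_norm M; lra.
  by rewrite mulrAC ler_pdivrMr//; lra.
by move: h1 h2; lra.
Qed.

Lemma coord_spanned n v : spanned n v -> forall i, (n <= i)%N -> a i v = 0.
Proof.
move=> [x ->] i ni; rewrite [LHS](@coord_sum i 'I_n (fun j => x j *: e j)) big1// => j _.
by rewrite coordZ a_e gtn_eqF ?mulr0// (leq_trans (ltn_ord j)).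
Qed.

Lemma spanned_recr n v : spanned n.+1 v -> exists k u, spanned n u /\ v = u + k *: e n.
Proof.
move=> [x ->]; exists (x n), (\sum_(i < n) x i *: e i).
by split; [exists x|rewrite big_ord_recr].
Qed.

(* T := L - partial N vanishes on the range of partial N, so T (L - mu) = (T - mu) T, and
   T - mu is injective. *)
Lemma generalized_spanned mu f : mu != 0 -> generalized_eigenspace L mu f ->
  exists n, spanned n f.
Proof.
move=> mu0 [k hk]; have [N [q /andP[q0 q1] hq]] := residual_small mu0; exists N.
elim: k f hk => [|k IH] f; first by move=> /= ->; exact: spanned0.
rewrite iterSr => /IH sg.
have [S SE] : exists S : {linear V -> V}, S =1 (fun v => mu^-1 *: (L v - partial N v)).
  apply: linear_pack => k' u v; rewrite linearP partialP opprD addrACA -scalerBr scalerDr.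
  by rewrite !scalerA mulrC.
have S0 u : spanned N u -> S u = 0 by move=> /L_spanned h; rewrite SE h subrr scaler0.
have Lf : L f = partial N f + mu *: S f.
  by rewrite SE scalerA mulfV// scale1r addrC subrK.
have SS : S (S f) = S f.
  apply: (scalerI mu0); apply/eqP; rewrite -subr_eq0.
  have := S0 _ sg; rewrite {1}Lf -addrA linearD (S0 _ (spanned_partial N f)) add0r.
  by rewrite linearB !linearZ /= => ->.
have Sf : S f = 0.
  apply/rnorm_eq0; have := hq (S f); rewrite -SE SS; have := rnorm_ge0 (S f).
  by move=> h1 h2; nra.
have Lf' : L f = partial N f by rewrite Lf Sf scaler0 addr0.
have -> : f = mu^-1 *: (L f - (L f - mu *: f)).
  by rewrite opprB [X in _ *: X]addrC subrK scalerA mulVf// scale1r.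
by apply: spannedZ; apply: spannedB => //; rewrite Lf'; exact: spanned_partial.
Qed.

Lemma coord_shift mu n f : spanned n.+1 f ->
  spanned n.+1 (L f - mu *: f) /\ a n (L f - mu *: f) = (d n - mu) * a n f.
Proof.
move=> sf; split.
  by apply: spannedB; [rewrite (L_spanned sf); exact: spanned_partial|exact: spannedZ].
rewrite -scaleNr addrC lin_a -/(c n f) mulNr mulrBl addrC; congr (_ - _).
have [k [u [[x ->] ->]]] := spanned_recr sf.
rewrite icoordD icoordZ [c n _](@icoord_sum n 'I_n (fun i => x i *: e i)) big1 ?add0r; last first.
  by move=> i _; rewrite icoordZ tri ?mulr0.
have au : a n (\sum_(i < n) x i *: e i) = 0 by apply: (coord_spanned (n := n)) => //; exists x.
by rewrite coordD coordZ a_e eqxx mulr1 au add0r mulrC.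
Qed.

Lemma generalized_leading mu n f : spanned n.+1 f -> generalized_eigenspace L mu f ->
  d n != mu -> spanned n f.
Proof.
move=> sf [k hk] dn.
have : (d n - mu) ^+ k * a n f = 0.
  rewrite -[RHS](coord0 n) -hk; elim: k f sf {hk} => [|k IH] f sf; first by rewrite expr0 mul1r.
  have [s1 s2] := coord_shift mu sf.
  by rewrite iterSr -IH// s2 exprSr mulrA.
move=> /eqP; rewrite mulf_eq0 expf_eq0 subr_eq0 (negPf dn) andbF /= => /eqP an.
have [k' [u [su fE]]] := spanned_recr sf.
move: an; rewrite fE coordD coordZ a_e eqxx mulr1 (coord_spanned su (leqnn n)) add0r => ->.
by rewrite scale0r addr0.
Qed.

(* The correction b - e_i solves (L - d_i) v = - (L - d_i) e_i, whose right-hand side lies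
   in the span of the e_j with j < m. *)
Lemma eigenvector_exists i m : d i != 0 -> (m <= i)%N ->
  (forall j, (j < m)%N -> d j != d i) ->
  (forall j, (m <= j < i)%N -> c j (e i) = 0) ->
  exists2 b, spanned i (b - e i) & L b = d i *: b.
Proof.
move=> di0 mi dm cm; set mu := d i.
pose t := mu^-1 *: \sum_(j < m) c j (e i) *: e j.
have st : spanned m t by apply: spannedZ; exists (fun j => c j (e i)).
have Le : L (e i) = mu *: t + mu *: e i.
  rewrite (L_basis (leqnn i.+1)) /partial big_ord_recr /= /t scalerA mulfV// scale1r.
  congr (_ + _); rewrite [RHS](big_ord_widen_cond i xpredT (fun j => c j (e i) *: e j))//.
  rewrite [RHS]big_mkcond /=; apply: eq_bigr => j _; case: ifP => // /negbT.
  by rewrite -leqNgt => mj; rewrite cm ?scale0r// mj /=.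
have [S [_ _ SA]] := cinvertible_partial di0 dm.
pose v := S t; have vE : v = t + mu^-1 *: partial m v by rewrite -{1}(SA t) /v subrK.
have sv : spanned m v.
  by rewrite vE; apply: spannedD => //; apply: spannedZ; exact: spanned_partial.
exists (v + e i); first by rewrite addrK; exact: spanned_widen sv.
rewrite linearD Le (L_spanned sv) addrA scalerDr; congr (_ + _).
by rewrite [in RHS]vE scalerDr [_ *: (_ *: partial m v)]scalerA mulfV// scale1r addrC.
Qed.

Lemma triangular_multiplicity mu m (iota : 'I_m -> nat) (b : nat -> V) : mu != 0 ->
  injective iota -> (forall i, d i = mu <-> exists l, iota l = i) ->
  (forall i, d i = mu -> spanned i (b i - e i)) -> (forall i, d i = mu -> L (b i) = mu *: b i) ->
  algebraic_multiplicity L mu m.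
Proof.
move=> mu0 iota_inj diota sb Lb; exists (fun l => b (iota l)).
have dio l : d (iota l) = mu by apply/diota; exists l.
pose comb (x : {ffun 'I_m -> R[i]}) := \sum_l x l *: b (iota l).
have combP k (x y : {ffun 'I_m -> R[i]}) :
    comb [ffun i => k * x i + y i] = k *: comb x + comb y.
  rewrite /comb scaler_sumr -big_split; apply: eq_bigr => i _ /=.
  by rewrite ffunE scalerDl scalerA.
have ab i j : d j = mu -> (j <= i)%N -> a i (b j) = (i == j)%:R.
  move=> dj ji; rewrite -[b j](subrK (e j)) coordD (coord_spanned (sb _ dj))//.
  by rewrite a_e add0r.
split.
  move=> x y /= xy; apply/ffunP => k0; apply/eqP; rewrite -subr_eq0.
  pose z := [ffun i => -1 * y i + x i] : {ffun 'I_m -> R[i]}.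
  have zE i : z i = x i - y i by rewrite ffunE mulN1r addrC.
  have cz : comb z = 0 by rewrite combP scaleN1r /comb xy addNr.
  rewrite -zE; apply: contrapT => /negP z0.
  have [k zk kmax] : exists2 l, z l != 0 & forall j, z j != 0 -> (iota j <= iota l)%N.
    have [k zk kmax] := @arg_maxnP _ k0 (fun l => z l != 0) iota z0.
    by exists k.
  have := congr1 (a (iota k)) cz; rewrite coord0 [LHS](@coord_sum _ 'I_m (fun j => z j *: b (iota j))).
  rewrite (bigD1 k)//= coordZ ab// eqxx mulr1 big1 ?addr0 => [/eqP|j jk].
    by rewrite (negPf zk).
  have [->|zj] := eqVneq (z j) 0; first by rewrite scale0r coord0.
  rewrite coordZ ab ?kmax// (introF eqP) ?mulr0// => /iota_inj kj.
  by rewrite kj eqxx in jk.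
have W0 : (fun g => L g - mu *: g) 0 = 0 by rewrite linear0 scaler0 subrr.
apply/seteqP; split=> [_ [x _ <-]|f].
  exists 1%N; rewrite /= linear_sum scaler_sumr -sumrB big1// => k _.
  by rewrite linearZ /= Lb// !scalerA mulrC subrr.
move=> Wf; have [N] := generalized_spanned mu0 Wf.
elim: N f Wf => [|n IH] f Wf sf.
  exists [ffun=> 0] => //; have [x ->] := sf; rewrite big_ord0 big1// => k _.
  by rewrite ffunE scale0r.
have [dn|dn] := eqVneq (d n) mu; last by apply: IH => //; exact: generalized_leading sf Wf dn.
have [k [u [su fE]]] := spanned_recr sf.
have [k0 k0n] := (diota n).1 dn.
have [||x _ xE] := IH (f - k *: b n).
- have [K hK] := Wf; exists K.+1; rewrite iterSr.
  have -> : L (f - k *: b n) - mu *: (f - k *: b n) = L f - mu *: f.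
    have -> : L (f - k *: b n) = L f - mu *: (k *: b n).
      by rewrite linearB linearZ /= Lb// !scalerA mulrC.
    by rewrite scalerBr opprB addrA subrK.
  by rewrite -iterSr iterS hK.
- rewrite fE; have -> : u + k *: e n - k *: b n = u - k *: (b n - e n).
    by rewrite scalerBr opprB addrA.
  by apply: spannedB => //; apply: spannedZ; exact: sb.
exists [ffun i => k * [ffun i => (i == k0)%:R : R[i]] i + x i] => //.
rewrite -/(comb _) combP /comb; move: xE; rewrite -/(comb x) => ->.
rewrite (bigD1 k0)//= ffunE eqxx scale1r big1 ?addr0.
  by rewrite k0n addrC subrK.
by move=> i /negPf ik; rewrite ffunE ik scale0r.
Qed.

End TriangularNuclear.

(** * The transfer operator of a Blaschke product *)

Section HinfAnnulus.
Variables (R : realType) (r1 r2 : R).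
Hypotheses (r10 : 0 < r1) (r11 : r1 < 1) (r21 : 1 < r2).
Local Notation A := (annulus r1 r2).
Implicit Types (f g : Hinf A) (z w : R[i]).

Lemma annulusP z : A z <-> r1 < cabs z < r2.
Proof. by []. Qed.

Lemma annulus1 : A 1.
Proof. by rewrite annulusP cabs1 r11. Qed.

Lemma annulus_neq0 z : A z -> z != 0.
Proof. by move=> /andP[h _]; rewrite -cabs_gt0 (lt_trans r10). Qed.

Lemma Hinf_ext f g : (forall z, A z -> f z = g z) -> f = g.
Proof.
move=> fg; apply/val_inj/funext => z /=.
by have [/fg//|nAz] := pselect (A z); rewrite !Hinf_out.
Qed.

Lemma Hinf_cdiffs f z : A z -> cdiffs f z.
Proof.
by case: f => f /= /asboolP[hf _ _] /hf /derivable_cdiffs.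
Qed.

Lemma annulus_nbhs z : A z -> exists2 r : R, 0 < r & forall w, cabs (w - z) < r -> A w.
Proof.
move=> /andP[z1 z2]; exists (Num.min (cabs z - r1) (r2 - cabs z)).
  by rewrite lt_min !subr_gt0 z1.
move=> w; rewrite lt_min => /andP[w1 w2]; rewrite annulusP.
have := cabs_lerB w z; have := cabs_lerB' w z.
by move: w1 w2 => *; apply/andP; split; lra.
Qed.

Lemma Hinf_make (F : R[i] -> R[i]) (M : R) :
  (forall z, A z -> cdiffs F z) -> (forall z, A z -> cabs (F z) <= M) ->
  exists f : Hinf A, forall z, A z -> f z = F z.
Proof.
move=> dF bF; pose F' z := if `[< A z >] then F z else 0.
have F'E z : A z -> F' z = F z by move=> Az; rewrite /F' asboolT.
have hF : F' \in bounded_holomorphic A.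
  apply/asboolP; split.
  - move=> z Az; apply/derivable_cdiffs; have [r r0 hr] := annulus_nbhs Az.
    by apply: cdiffs_near r0 _ (dF _ Az) => w /hr Aw; rewrite F'E.
  - by exists M => _ [z Az <-]; rewrite F'E// bF.
  - by move=> z nAz; rewrite /F' asboolF.
by exists (MkHinf hF) => z /F'E.
Qed.

Lemma rnorm_supnorm f : rnorm f = Hinf_supnorm f.
Proof. by []. Qed.

Lemma rnorm_ge f z : A z -> cabs (f z) <= rnorm f.
Proof. by rewrite rnorm_supnorm; exact: Hinf_le. Qed.

Lemma rnorm_le f M : (forall z, A z -> cabs (f z) <= M) -> rnorm f <= M.
Proof. by rewrite rnorm_supnorm; apply: Hinf_ge; exists 1; exact: annulus1. Qed.

Lemma Hinf_sub f g z : (f - g) z = f z - g z.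
Proof. by []. Qed.

Lemma Hinf_geometrically_complete : geometrically_complete (Hinf A).
Proof.
move=> u C q q01 hu; case/andP: (q01) => q0 q1.
pose s n : Hinf A := \sum_(0 <= i < n) u i.
have C0 : 0 <= C by have := hu 0%N; rewrite expr0 mulr1; apply: le_trans; exact: rnorm_ge0.
pose B := C / (1 - q).
have q1' : 0 < 1 - q by rewrite subr_gt0.
have B0 : 0 <= B by rewrite divr_ge0 // ltW.
have tail N n : (N <= n)%N -> rnorm (s n - s N) <= B * (q ^+ N - q ^+ n).
  move=> /subnK <-; elim: (n - N)%N => [|k IH].
    by rewrite add0n !subrr rnorm0 mulr0.
  rewrite addSn /s big_nat_recr//= -/(s _) addrAC; apply: le_trans (rnormD _ _) _.
  apply: le_trans (lerD IH (hu _)) _.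
  rewrite exprS le_eqVlt; apply/orP; left; apply/eqP; rewrite /B; field.
  by rewrite gt_eqF.
have tail' N n z : (N <= n)%N -> A z -> cabs (s n z - s N z) <= B * q ^+ N.
  move=> Nn Az; rewrite -Hinf_sub; apply: le_trans (rnorm_ge _ Az) _.
  apply: le_trans (tail _ _ Nn) _; rewrite ler_wpM2l// lerBlDr lerDl.
  exact: exprn_ge0.
have B1 : 0 < B + 1 by lra.
have small e : 0 < e -> exists N, forall n, (N <= n)%N -> B * q ^+ n <= e.
  move=> e0; have [N hN] := geometric_small q01 (divr_gt0 e0 B1).
  exists N => n /hN h; apply: (@le_trans _ _ ((B + 1) * (e / (B + 1)))).
    by rewrite ler_pM ?exprn_ge0// lerDl.
  by rewrite mulrC divfK// gt_eqF.
have [F hF] : exists F : R[i] -> R[i], forall z, A z -> forall n, cabs (s n z - F z) <= B * q ^+ n.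
  suff /choice[F hF] : forall z, exists l, A z -> forall n, cabs (s n z - l) <= B * q ^+ n.
    by exists F.
  move=> z; have [Az|nAz] := pselect (A z); last by exists 0.
  have [|l hl] := @ccomplete R (fun n => s n z).
    by move=> e /small[N hN]; exists N => n Nn; apply: le_trans (tail' _ _ _ Nn Az) (hN _ (leqnn _)).
  exists l => _ n; apply/ler_addgt0Pr => e /hl[N hN].
  have {}hN := hN (maxn n N) (leq_maxr _ _).
  have h := tail' n (maxn n N) z (leq_maxl _ _) Az.
  rewrite -(subrKA (s (maxn n N) z)); apply: le_trans (cabs_normD _ _) _.
  by rewrite cabs_distC; lra.
have [||f fF] := @Hinf_make F (rnorm (s 0%N) + B).
- move=> z Az; apply: (@cdiffs_uniform_limit R (fun n => s n) _ r1 r2) Az => //.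
    by move=> n w Aw; apply: Hinf_cdiffs.
  move=> e /small[N hN]; exists N => w Aw.
  by apply: le_trans (hF _ Aw _) (hN _ (leqnn _)).
- move=> z Az; have := hF _ Az 0%N; rewrite expr0 mulr1 => h.
  have := rnorm_ge (s 0%N) Az; have := cabs_lerB' (s 0%N z) (F z); lra.
exists f => e /small[N hN]; exists N => n Nn; rewrite -/(s n).
apply: rnorm_le => z Az; rewrite Hinf_sub fF//.
by apply: le_trans (hF _ Az _) (hN _ Nn).
Qed.

End HinfAnnulus.

Section CircleGap.
Variable R : realType.

Lemma circle_positive (f : R[i] -> R[i]) (phi : R[i] -> R) (s : R) : 0 <= s ->
  ccont_circle f s -> (forall u v, `|phi u - phi v| <= cabs (u - v)) ->
  (forall w, cabs w = s -> 0 < phi (f w)) ->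
  exists2 d : R, 0 < d & forall t, 0 <= t <= 1 -> d <= phi (f (circ s t)).
Proof.
move=> s0 cf lip pos.
have [N hN] : exists N, forall t, 0 <= t <= 1 -> 2 ^- N <= phi (f (circ s t)).
  apply: (@unit_interval_cover R (fun N t => 2 ^- N <= phi (f (circ s t)))) => x _.
  have p0 := pos _ (cabs_circ x s0).
  have p2 : 0 < phi (f (circ s x)) / 2 by lra.
  have [d d0 hd] := cf _ (cabs_circ x s0) _ p2.
  have [d' d'0 hd'] := ccont_circ s x d0.
  have [N hN] := dyadic_small p2.
  exists N, d'; split=> // n t /hN nN tx.
  have h : cabs (f (circ s t) - f (circ s x)) < phi (f (circ s x)) / 2.
    by apply/hd/hd'; rewrite // subrr normr0.
  have := lip (f (circ s t)) (f (circ s x)); rewrite ler_norml => /andP[h1 _].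
  by lra.
by exists (2 ^- N) => //; rewrite invr_gt0 exprn_gt0.
Qed.

Lemma cabs_lip (u v : R[i]) : `|cabs u - cabs v| <= cabs (u - v).
Proof. by rewrite ler_norml lerNl opprB cabs_lerB cabs_lerB'. Qed.

Lemma circle_lower_gap (f : R[i] -> R[i]) (s m : R) : 0 <= s -> ccont_circle f s ->
  (forall w, cabs w = s -> m < cabs (f w)) ->
  exists2 q : R, m < q & forall t, 0 <= t <= 1 -> q <= cabs (f (circ s t)).
Proof.
move=> s0 cf hm.
have [||d d0 hd] := @circle_positive f (fun u => cabs u - m) s s0 cf.
- by move=> u v /=; rewrite opprB addrA subrK cabs_lip.
- by move=> w /hm; rewrite subr_gt0.
by exists (m + d) => [|t /hd]; lra.
Qed.

Lemma circle_upper_gap (f : R[i] -> R[i]) (s m : R) : 0 <= s -> ccont_circle f s ->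
  (forall w, cabs w = s -> cabs (f w) < m) ->
  exists2 q : R, q < m & forall t, 0 <= t <= 1 -> cabs (f (circ s t)) <= q.
Proof.
move=> s0 cf hm.
have [||d d0 hd] := @circle_positive f (fun u => m - cabs u) s s0 cf.
- by move=> u v /=; rewrite opprB addrC addrA subrK distrC cabs_lip.
- by move=> w /hm; rewrite subr_gt0.
by exists (m - d) => [|t /hd]; lra.
Qed.

End CircleGap.

Section Blaschke.
Variables (R : realType) (l : R[i]).
Hypothesis l1 : cabs l < 1.
Implicit Types (z w : R[i]).

Definition blaschke z : R[i] := z * (z + l) / (1 + (l^*)%C * z).

Lemma blaschke_den_neq0 w : cabs w <= 1 -> 1 + (l^*)%C * w != 0.
Proof.
move=> w1; rewrite -cabs_gt0; have := cabs_lerB 1 (- ((l^*)%C * w)).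
rewrite opprK cabsN cabs1 cabsM cabs_conj.
have : cabs l * cabs w <= cabs l by rewrite ler_piMr ?cabs_ge0.
by move: l1; lra.
Qed.

Lemma cabs_add_sub w : cabs (w + l) ^+ 2 - cabs (1 + (l^*)%C * w) ^+ 2 =
  (cabs w ^+ 2 - 1) * (1 - cabs l ^+ 2).
Proof. by rewrite !cabs_sqr; case: w l => [a b] [c d] /=; ring. Qed.

Lemma sqr_cabs_l : 0 < 1 - cabs l ^+ 2.
Proof. by rewrite subr_gt0 expr_lt1// cabs_ge0. Qed.

Lemma cabs_den_lt w : 1 < cabs w -> cabs (1 + (l^*)%C * w) < cabs (w + l).
Proof.
move=> w1; rewrite -(ltr_pXn2r (n := 2)) ?nnegrE ?cabs_ge0// -subr_gt0 cabs_add_sub.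
by rewrite mulr_gt0 ?sqr_cabs_l// subr_gt0 exprn_egt1.
Qed.

Lemma cabs_den_gt w : cabs w < 1 -> cabs (w + l) < cabs (1 + (l^*)%C * w).
Proof.
move=> w1; rewrite -(ltr_pXn2r (n := 2)) ?nnegrE ?cabs_ge0// -subr_lt0 cabs_add_sub.
by rewrite pmulr_llt0 ?sqr_cabs_l// subr_lt0 expr_lt1 ?cabs_ge0.
Qed.

Lemma cabs_den_eq w : cabs w = 1 -> cabs (w + l) = cabs (1 + (l^*)%C * w).
Proof.
move=> w1; apply/eqP; rewrite -(eqrXn2 (n := 2)) ?cabs_ge0// -subr_eq0 cabs_add_sub.
by rewrite w1 expr1n subrr mul0r.
Qed.

Lemma blaschke_gt1 w : 1 < cabs w -> 1 + (l^*)%C * w != 0 -> 1 < cabs (blaschke w).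
Proof.
move=> w1 den; rewrite /blaschke cabs_div cabsM ltr_pdivlMr ?cabs_gt0// mul1r.
by rewrite (lt_le_trans (cabs_den_lt w1))// ler_peMl ?cabs_ge0// ltW.
Qed.

Lemma blaschke_lt1 w : cabs w < 1 -> cabs (blaschke w) < 1.
Proof.
move=> w1; have den := blaschke_den_neq0 (ltW w1).
rewrite /blaschke cabs_div cabsM ltr_pdivrMr ?cabs_gt0// mul1r.
by rewrite (le_lt_trans _ (cabs_den_gt w1))// ler_piMl ?cabs_ge0// ltW.
Qed.

Lemma blaschke_eq1 w : cabs w = 1 -> cabs (blaschke w) = 1.
Proof.
move=> w1; have den : 1 + (l^*)%C * w != 0 by apply: blaschke_den_neq0; rewrite w1.
by rewrite /blaschke cabs_div cabsM w1 mul1r (cabs_den_eq w1) divff// cabs_eq0.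
Qed.

Lemma cdiffs_blaschke w : 1 + (l^*)%C * w != 0 -> cdiffs blaschke w.
Proof. by move=> den; rewrite /blaschke; cdiffs_auto. Qed.

End Blaschke.

Lemma big_ord_double (V : nmodType) (F : nat -> V) N :
  \sum_(i < N.*2) F i = \sum_(n < N) (F n.*2 + F n.*2.+1).
Proof.
elim: N => [|N IH]; first by rewrite !big_ord0.
by rewrite doubleS !big_ord_recr /= IH addrA.
Qed.

Section Monomials.
Variable R : realType.
Implicit Types (z w : R[i]).

(* Laurent monomials enumerated as z^-1, 1, z^-2, z, z^-3, z^2, etc. *)
Definition laurent i z : R[i] := if odd i then z ^+ i./2 else z^-1 ^+ (i./2).+1.

Lemma cdiffs_laurent i z : z != 0 -> cdiffs (laurent i) z.
Proof. by move=> z0; rewrite /laurent; case: (odd i); cdiffs_auto. Qed.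

Lemma laurent_neq0 i z : z != 0 -> laurent i z != 0.
Proof. by move=> z0; rewrite /laurent; case: (odd i); rewrite expf_neq0// invr_eq0. Qed.

Lemma cabs_laurent1 i z : cabs z = 1 -> cabs (laurent i z) = 1.
Proof.
move=> z1; rewrite /laurent; case: (odd i); rewrite cabsX ?cabsV z1 ?invr1 expr1n//.
Qed.

Lemma circle_mean_exp n r : 0 < r -> circle_mean (fun w : R[i] => w ^+ n) r = (n == 0%N)%:R.
Proof.
move=> r0; rewrite circle_mean_at0 ?expr0n//; first by move=> w _; cdiffs_auto.
by ccont_auto.
Qed.

Lemma circle_mean_expV n r : 0 < r -> circle_mean (fun w : R[i] => w^-1 ^+ n) r = (n == 0%N)%:R.
Proof.
move=> r0; rewrite (@circle_mean_at_infinity R _ (fun u => u ^+ n)) ?expr0n//.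
- move=> w rw; have w0 : w != 0 by rewrite -cabs_gt0 (lt_le_trans r0).
  by cdiffs_auto.
- by ccont_auto.
Qed.

Lemma circle_mean_laurent i j r : 0 < r ->
  circle_mean (fun w => laurent j w / laurent i w) r = (i == j)%:R.
Proof.
move=> r0.
have nz w : cabs w = r -> w != 0 by move=> wr; rewrite -cabs_gt0 wr.
have expK n m (x : R[i]) : x != 0 -> x ^+ (n + m) / x ^+ m = x ^+ n.
  by move=> x0; rewrite exprD mulfK// expf_neq0.
have parity : i = j <-> odd i = odd j /\ i./2 = j./2.
  split=> [->|[pij hij]]; first by [].
  by rewrite -(odd_double_half i) -(odd_double_half j) pij hij.
have eqE b n : (i = j <-> n = 0%N) -> b = (n == 0%N)%:R -> b = (i == j)%:R :> R[i].
  move=> h ->; congr (_%:R); congr nat_of_bool; apply/eqP/eqP; [by move=> /h|by move=> /h].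
rewrite /laurent; case oi: (odd i); case oj: (odd j).
- have [ij|ij] := leqP i./2 j./2.
    apply: (@eqE _ (j./2 - i./2)%N).
      rewrite parity oi oj; split=> [[_ ->]|/eqP]; first by rewrite subnn.
      by rewrite subn_eq0 => h; split=> //; apply/eqP; rewrite eqn_leq ij.
    rewrite -(circle_mean_exp _ r0); apply: eq_circle_mean; first exact: ltW.
    by move=> w /nz w0; rewrite -{1}(subnK ij) expK.
  apply: (@eqE _ (i./2 - j./2)%N).
    rewrite parity oi oj; split=> [[_ h]|/eqP]; first by rewrite h ltnn in ij.
    by rewrite subn_eq0 leqNgt ij.
  rewrite -(circle_mean_expV _ r0); apply: eq_circle_mean; first exact: ltW.
  move=> w /nz w0; rewrite -{1}(subnK (ltnW ij)) exprD invfM exprVn.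
  by rewrite mulrCA mulfV ?mulr1// expf_neq0.
- apply: (@eqE _ (i./2 + (j./2).+1)%N).
    by rewrite parity oi oj addnS; split=> [[]|].
  rewrite -(circle_mean_expV _ r0); apply: eq_circle_mean; first exact: ltW.
  by move=> w /nz w0; rewrite exprD !exprVn mulrC.
- apply: (@eqE _ (j./2 + (i./2).+1)%N).
    by rewrite parity oi oj addnS; split=> [[]|].
  rewrite -(circle_mean_exp _ r0); apply: eq_circle_mean; first exact: ltW.
  by move=> w /nz w0; rewrite exprD !exprVn invrK.
- have [ij|ij] := leqP i./2 j./2.
    apply: (@eqE _ (j./2 - i./2)%N).
      rewrite parity oi oj; split=> [[_ ->]|/eqP]; first by rewrite subnn.
      by rewrite subn_eq0 => h; split=> //; apply/eqP; rewrite eqn_leq ij.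
    rewrite -(circle_mean_expV _ r0); apply: eq_circle_mean; first exact: ltW.
    by move=> w /nz w0; rewrite -{1}(subnK ij) -addnS expK// invr_eq0.
  apply: (@eqE _ (i./2 - j./2)%N).
    rewrite parity oi oj; split=> [[_ h]|/eqP]; first by rewrite h ltnn in ij.
    by rewrite subn_eq0 leqNgt ij.
  rewrite -(circle_mean_exp _ r0); apply: eq_circle_mean; first exact: ltW.
  move=> w /nz w0; rewrite -{1}(subnK (ltnW ij)) -addnS exprD invfM mulrCA.
  by rewrite mulfV ?mulr1 ?exprVn ?invrK// invr_eq0 expf_neq0.
Qed.

End Monomials.

Lemma uphalf_lt i j : (j < (if odd i then i else i.-1))%N -> (uphalf j < uphalf i)%N.
Proof.
have := odd_double_half i; case: (odd i); set n := i./2 => <-.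
  by rewrite add1n ltnS => /uphalf_leq; rewrite uphalf_double /= doubleK ltnS.
rewrite add0n; case: n => // n; rewrite doubleS /= ltnS => /uphalf_leq.
by rewrite !uphalf_double ltnS.
Qed.

Section TransferOperator.
Variables (R : realType) (l : R[i]) (r1 r2 s1 s2 : R).
Hypothesis l1 : cabs l < 1.
Hypotheses (r10 : 0 < r1) (rs1 : r1 < s1) (s11 : s1 < 1) (s21 : 1 < s2) (rs2 : s2 < r2).
Let tau := blaschke l.
Hypothesis tau1 : forall w, cabs w = s1 -> cabs (tau w) < r1.
Hypothesis den2 : forall w, cabs w = s2 -> 1 + (l^*)%C * w != 0.
Hypothesis tau2 : forall w, cabs w = s2 -> r2 < cabs (tau w).
Local Notation A := (annulus r1 r2).
Implicit Types (f g : Hinf A) (z w : R[i]).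

Let r11 : r1 < 1 := lt_trans rs1 s11.
Let r21 : 1 < r2 := lt_trans s21 rs2.
Let s10 : 0 < s1 := lt_trans r10 rs1.
Let s20 : 0 < s2 := lt_trans ltr01 s21.
Let r20 : 0 < r2 := lt_trans ltr01 r21.

Lemma blaschke_den_s1 w : cabs w = s1 -> 1 + (l^*)%C * w != 0.
Proof. by move=> ws; apply: blaschke_den_neq0 => //; rewrite ws ltW. Qed.

Lemma ccont_tau1 : ccont_circle tau s1.
Proof. by move=> w /blaschke_den_s1/cdiffs_blaschke/cdiffs_cont. Qed.

Lemma ccont_tau2 : ccont_circle tau s2.
Proof. by move=> w /den2/cdiffs_blaschke/cdiffs_cont. Qed.

Lemma annulus_s1 w : cabs w = s1 -> A w.
Proof. by move=> ws; rewrite annulusP ws rs1 (lt_trans s11). Qed.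

Lemma annulus_s2 w : cabs w = s2 -> A w.
Proof. by move=> ws; rewrite annulusP ws rs2 andbT (lt_trans r11). Qed.

Lemma ccont_Hinf1 f : ccont_circle f s1.
Proof. by move=> w /annulus_s1 /(Hinf_cdiffs f)/cdiffs_cont. Qed.

Lemma ccont_Hinf2 f : ccont_circle f s2.
Proof. by move=> w /annulus_s2 /(Hinf_cdiffs f)/cdiffs_cont. Qed.

Lemma blaschke_sub_s1 z w : A z -> cabs w = s1 -> cabs z - r1 <= cabs (tau w - z).
Proof.
move=> _ /tau1 h; apply: le_trans (cabs_lerB' _ _); by rewrite lerB// ltW.
Qed.

Lemma blaschke_sub_s2 z w : A z -> cabs w = s2 -> r2 - cabs z <= cabs (tau w - z).
Proof. by move=> _ /tau2 h; apply: le_trans (cabs_lerB _ _); rewrite lerB// ltW. Qed.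

Lemma blaschke_sub_s1_neq0 z w : A z -> cabs w = s1 -> tau w - z != 0.
Proof.
move=> Az ws; rewrite -cabs_gt0 (lt_le_trans _ (blaschke_sub_s1 Az ws))// subr_gt0.
by case/andP: Az.
Qed.

Lemma blaschke_sub_s2_neq0 z w : A z -> cabs w = s2 -> tau w - z != 0.
Proof.
move=> Az ws; rewrite -cabs_gt0 (lt_le_trans _ (blaschke_sub_s2 Az ws))// subr_gt0.
by case/andP: Az.
Qed.

Lemma blaschke_s2_neq0 w : cabs w = s2 -> tau w != 0.
Proof. by move=> /tau2 h; rewrite -cabs_gt0 (lt_trans r20). Qed.

Definition transfer_fun f z : R[i] :=
  circle_mean (fun w => f w * w / (tau w - z)) s2 -
  circle_mean (fun w => f w * w / (tau w - z)) s1.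

Definition transfer_coef i f : R[i] :=
  if odd i then circle_mean (fun w => f w * w * (tau w)^-1 ^+ (i./2).+1) s2
  else circle_mean (fun w => f w * w * tau w ^+ i./2) s1.

Lemma ccont_num1 f : ccont_circle (fun w => f w * w) s1.
Proof. by move=> w ws; have := ccont_Hinf1 f ws => ?; ccont_auto. Qed.

Lemma ccont_num2 f : ccont_circle (fun w => f w * w) s2.
Proof. by move=> w ws; have := ccont_Hinf2 f ws => ?; ccont_auto. Qed.

Lemma ccont_transfer1 f z : A z -> ccont_circle (fun w => f w * w / (tau w - z)) s1.
Proof.
move=> Az w ws; have := ccont_num1 f ws; have := ccont_tau1 ws => ? ?.
by have := blaschke_sub_s1_neq0 Az ws => ?; ccont_auto.
Qed.

Lemma ccont_transfer2 f z : A z -> ccont_circle (fun w => f w * w / (tau w - z)) s2.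
Proof.
move=> Az w ws; have := ccont_num2 f ws; have := ccont_tau2 ws => ? ?.
by have := blaschke_sub_s2_neq0 Az ws => ?; ccont_auto.
Qed.

Lemma ccont_coef1 f n : ccont_circle (fun w => f w * w * tau w ^+ n) s1.
Proof.
by move=> w ws; have := ccont_num1 f ws; have := ccont_tau1 ws => ? ?; ccont_auto.
Qed.

Lemma ccont_coef2 f n : ccont_circle (fun w => f w * w * (tau w)^-1 ^+ n) s2.
Proof.
move=> w ws; have := ccont_num2 f ws; have := ccont_tau2 ws; have := blaschke_s2_neq0 ws => ? ? ?.
by ccont_auto.
Qed.

Lemma cdiffs_transfer f z : A z -> cdiffs (transfer_fun f) z.
Proof.
move=> Az; case/andP: (Az) => z1 z2; apply: cdiffsB.
  apply: (@cdiffs_kernel _ _ _ _ _ (r2 - cabs z)); [exact: ltW|by rewrite subr_gt0| | |].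
  - exact: ccont_num2.
  - exact: ccont_tau2.
  - by move=> w; exact: blaschke_sub_s2.
apply: (@cdiffs_kernel _ _ _ _ _ (cabs z - r1)); [exact: ltW|by rewrite subr_gt0| | |].
- exact: ccont_num1.
- exact: ccont_tau1.
- by move=> w; exact: blaschke_sub_s1.
Qed.

Lemma transferP k f g z : A z -> transfer_fun (k *: f + g) z = k * transfer_fun f z + transfer_fun g z.
Proof.
move=> Az; rewrite /transfer_fun.
have E : forall w : R[i], (k *: f + g) w * w / (tau w - z) =
    k * (f w * w / (tau w - z)) + g w * w / (tau w - z).
  by move=> w; rewrite HinfD HinfZ; ring.
have H s : 0 < s -> (forall h : Hinf A, ccont_circle (fun w => h w * w / (tau w - z)) s) ->
    circle_mean (fun w => (k *: f + g) w * w / (tau w - z)) s =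
    k * circle_mean (fun w => f w * w / (tau w - z)) s +
    circle_mean (fun w => g w * w / (tau w - z)) s.
  move=> s0 ch.
  have cf : ccont_circle (fun w => k * (f w * w / (tau w - z))) s.
    by move=> w ws; apply: ccontM; [exact: ccont_cst|exact: ch].
  rewrite -(circle_meanZ k (ltW s0) (ch f)) -(circle_meanD (ltW s0) cf (ch g)).
  by apply: eq_circle_mean => [|w _]; [exact: ltW|exact: E].
rewrite !H//; last by move=> h; exact: ccont_transfer2.
  by ring.
by move=> h; exact: ccont_transfer1.
Qed.

Lemma transfer_expansion : exists C theta : R, 0 <= C /\ 0 <= theta < 1 /\
  forall f z N, A z ->
  cabs (transfer_fun f z - \sum_(i < N) transfer_coef i f * laurent i z) <= C * theta ^+ N./2 * rnorm f.
Proof.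
have [q2 q2r hq2] := circle_lower_gap (ltW s20) ccont_tau2 tau2.
have [q1 q1r hq1] := circle_upper_gap (ltW s10) ccont_tau1 tau1.
have q10 : 0 <= q1.
  apply: le_trans (hq1 0 _); [exact: cabs_ge0|by rewrite lexx ler01].
have q20 : 0 < q2 := lt_trans r20 q2r.
pose theta := Num.max (r2 / q2) (q1 / r1).
have t2 : r2 / q2 <= theta by rewrite le_max lexx.
have t1 : q1 / r1 <= theta by rewrite le_max lexx orbT.
have t0 : 0 <= theta by apply: le_trans t2; rewrite divr_ge0// ltW.
have tlt1 : theta < 1 by rewrite gt_max !ltr_pdivrMr// !mul1r q2r.
pose C2 := s2 / (q2 - r2); pose C1 := s1 / (r1 - q1); pose C3 := s1 / r1.
have C20 : 0 <= C2 by rewrite divr_ge0// ?subr_ge0 ltW.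
have C10 : 0 <= C1 by rewrite divr_ge0// ?subr_ge0 ltW.
have C30 : 0 <= C3 by rewrite divr_ge0// ltW.
exists (C1 + C2 + C3), theta; split; first by rewrite !addr_ge0.
split; first by rewrite t0.
move=> f z N Az; case/andP: (Az) => z1 z2.
have z0 := annulus_neq0 r10 Az.
have cz0 : 0 < cabs z by rewrite cabs_gt0.
have fb w : A w -> cabs (f w) <= rnorm f by exact: rnorm_ge.
pose rem2 M := circle_mean (fun w => f w * w * ((z / tau w) ^+ M / (tau w - z))) s2.
pose rem1 M := circle_mean (fun w => f w * w * ((tau w / z) ^+ M / (z - tau w))) s1.
have c2 M : ccont_circle (fun w => f w * w * ((z / tau w) ^+ M / (tau w - z))) s2.
  move=> w ws; have := ccont_num2 f ws; have := ccont_tau2 ws; have := blaschke_s2_neq0 ws => ? ? ?.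
  by have := blaschke_sub_s2_neq0 Az ws => ?; ccont_auto.
have sub1 w : cabs w = s1 -> z - tau w != 0.
  by move=> /(blaschke_sub_s1_neq0 Az) h; rewrite -opprB oppr_eq0.
have c1 M : ccont_circle (fun w => f w * w * ((tau w / z) ^+ M / (z - tau w))) s1.
  move=> w ws; have := ccont_num1 f ws; have := ccont_tau1 ws; have := sub1 _ ws => ? ? ?.
  by ccont_auto.
have b2 M : cabs (rem2 M) <= C2 * theta ^+ M * rnorm f.
  apply: circle_mean_circ_le; [exact: ltW|exact: c2|move=> t /hq2 ht].
  move: (circ s2 t) (cabs_circ t (ltW s20)) ht => w ws ht.
  have tw0 : 0 < cabs (tau w) by rewrite (lt_le_trans q20).
  have dw : q2 - r2 <= cabs (tau w - z).
    by apply: le_trans (cabs_lerB _ _); rewrite lerB// ltW.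
  rewrite !cabsM cabsX cabs_div cabsV ws.
  rewrite (_ : C2 * _ * _ = rnorm f * s2 * (theta ^+ M / (q2 - r2))); last by rewrite /C2; ring.
  have qr : 0 < q2 - r2 by rewrite subr_gt0.
  rewrite ler_pM ?mulr_ge0 ?invr_ge0 ?exprn_ge0 ?divr_ge0 ?cabs_ge0//.
  - by rewrite ltW.
  - by rewrite ler_wpM2r ?(ltW s20)//; exact/fb/annulus_s2.
  - rewrite ler_pM ?invr_ge0 ?exprn_ge0 ?divr_ge0 ?cabs_ge0//.
      rewrite lerXn2r ?nnegrE ?divr_ge0 ?cabs_ge0//.
      apply: le_trans t2; rewrite ler_pM ?invr_ge0 ?cabs_ge0// ?(ltW z2)//.
      by rewrite lef_pV2 ?posrE.
    by rewrite lef_pV2 ?posrE// (lt_le_trans qr).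
have b1 M : cabs (rem1 M) <= C1 * theta ^+ M * rnorm f.
  apply: circle_mean_circ_le; [exact: ltW|exact: c1|move=> t /hq1 ht].
  move: (circ s1 t) (cabs_circ t (ltW s10)) ht => w ws ht.
  have dw : r1 - q1 <= cabs (z - tau w).
    by apply: le_trans (cabs_lerB _ _); rewrite lerB// ltW.
  rewrite !cabsM cabsX cabs_div cabsV ws.
  rewrite (_ : C1 * _ * _ = rnorm f * s1 * (theta ^+ M / (r1 - q1))); last by rewrite /C1; ring.
  have qr : 0 < r1 - q1 by rewrite subr_gt0.
  rewrite ler_pM ?mulr_ge0 ?invr_ge0 ?exprn_ge0 ?divr_ge0 ?cabs_ge0//.
  - by rewrite ltW.
  - by rewrite ler_wpM2r ?(ltW s10)//; exact/fb/annulus_s1.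
  - rewrite ler_pM ?invr_ge0 ?exprn_ge0 ?divr_ge0 ?cabs_ge0//.
      rewrite lerXn2r ?nnegrE ?divr_ge0 ?cabs_ge0//.
      apply: le_trans t1; rewrite ler_pM ?invr_ge0 ?cabs_ge0//.
      by rewrite lef_pV2 ?posrE// ltW.
    by rewrite lef_pV2 ?posrE// (lt_le_trans qr).
have b3 M : cabs (transfer_coef M.*2 f * laurent M.*2 z) <= C3 * theta ^+ M * rnorm f.
  rewrite /transfer_coef /laurent odd_double doubleK cabsM cabsX cabsV.
  have : cabs (circle_mean (fun w => f w * w * tau w ^+ M) s1) <= rnorm f * s1 * q1 ^+ M.
    apply: circle_mean_circ_le; [exact: ltW|exact: ccont_coef1|move=> t /hq1 ht].
    move: (circ s1 t) (cabs_circ t (ltW s10)) ht => w ws ht.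
    rewrite !cabsM cabsX ws ler_pM ?mulr_ge0 ?exprn_ge0 ?cabs_ge0// ?(ltW s10)//.
      by rewrite ler_wpM2r ?(ltW s10)//; exact/fb/annulus_s1.
    by rewrite lerXn2r ?nnegrE ?cabs_ge0.
  move=> h; apply: (@le_trans _ _ (rnorm f * s1 * q1 ^+ M * (r1^-1) ^+ M.+1)).
    rewrite ler_pM ?exprn_ge0 ?invr_ge0 ?cabs_ge0//.
    by rewrite lerXn2r ?nnegrE ?invr_ge0 ?cabs_ge0 ?(ltW r10)// lef_pV2 ?posrE// ltW.
  rewrite (_ : _ * _ = C3 * (q1 / r1) ^+ M * rnorm f); last first.
    by rewrite /C3 exprS exprMn; ring.
  rewrite ler_wpM2r ?rnorm_ge0// ler_wpM2l//.
  by rewrite lerXn2r ?nnegrE// divr_ge0// ltW.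
have ex2 M : circle_mean (fun w => f w * w / (tau w - z)) s2 =
    \sum_(n < M) transfer_coef n.*2.+1 f * laurent n.*2.+1 z + rem2 M.
  transitivity (circle_mean (fun w => \sum_(n < M)
      z ^+ n * (f w * w * (tau w)^-1 ^+ n.+1) + f w * w * ((z / tau w) ^+ M / (tau w - z))) s2).
    apply: eq_circle_mean; first exact: ltW.
    move=> w ws; have w1 := blaschke_s2_neq0 ws; have w2 := blaschke_sub_s2_neq0 Az ws.
    have kE : tau w / (tau w - z) = 1 + z / tau w * (tau w / (tau w - z)).
      by field; rewrite w1 w2.
    have -> : f w * w / (tau w - z) = f w * w / tau w * (tau w / (tau w - z)).
      by field; rewrite w1 w2.
    rewrite (geometric_kernel M kE) mulrDr; congr (_ + _).
      rewrite big_mkord mulr_sumr; apply: eq_bigr => n _.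
      by rewrite exprMn exprS; ring.
    by field; rewrite w1 w2.
  rewrite circle_meanD ?ltW//; last first.
    move=> w ws; elim: (index_enum _) => [|n s IH].
      by under eq_fun do rewrite big_nil; exact: ccont_cst.
    under eq_fun do rewrite big_cons; apply: ccontD => //.
    by apply: ccontM; [exact: ccont_cst|exact: ccont_coef2].
  rewrite circle_mean_sum ?ltW//; last first.
    by move=> n w ws; apply: ccontM; [exact: ccont_cst|exact: ccont_coef2].
  congr (_ + _); apply: eq_bigr => n _; rewrite circle_meanZ ?ltW//; last exact: ccont_coef2.
  by rewrite /transfer_coef /laurent /= odd_double /= uphalf_double mulrC.
have ex1 M : - circle_mean (fun w => f w * w / (tau w - z)) s1 =
    \sum_(n < M) transfer_coef n.*2 f * laurent n.*2 z + rem1 M.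
  rewrite -mulN1r -circle_meanZ ?ltW//; last exact: ccont_transfer1.
  transitivity (circle_mean (fun w => \sum_(n < M)
      z^-1 ^+ n.+1 * (f w * w * tau w ^+ n) + f w * w * ((tau w / z) ^+ M / (z - tau w))) s1).
    apply: eq_circle_mean; first exact: ltW.
    move=> w ws; have w2 := sub1 _ ws; have w3 := blaschke_sub_s1_neq0 Az ws.
    have kE : z / (z - tau w) = 1 + tau w / z * (z / (z - tau w)).
      by field; rewrite z0 w2.
    have -> : -1 * (f w * w / (tau w - z)) = f w * w / z * (z / (z - tau w)).
      by field; rewrite w3 z0 w2.
    rewrite (geometric_kernel M kE) mulrDr; congr (_ + _).
      rewrite big_mkord mulr_sumr; apply: eq_bigr => n _.
      by rewrite exprMn exprS; ring.
    by field; rewrite z0 w2.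
  rewrite circle_meanD ?ltW//; last first.
    move=> w ws; elim: (index_enum _) => [|n s IH].
      by under eq_fun do rewrite big_nil; exact: ccont_cst.
    under eq_fun do rewrite big_cons; apply: ccontD => //.
    by apply: ccontM; [exact: ccont_cst|exact: ccont_coef1].
  rewrite circle_mean_sum ?ltW//; last first.
    by move=> n w ws; apply: ccontM; [exact: ccont_cst|exact: ccont_coef1].
  congr (_ + _); apply: eq_bigr => n _; rewrite circle_meanZ ?ltW//; last exact: ccont_coef1.
  by rewrite /transfer_coef /laurent /= odd_double /= doubleK mulrC.
have even M : transfer_fun f z - \sum_(i < M.*2) transfer_coef i f * laurent i z = rem1 M + rem2 M.
  rewrite (big_ord_double (fun i => transfer_coef i f * laurent i z)) big_split /= /transfer_fun (ex2 M) (ex1 M).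
  by ring.
have CE M : (C1 + C2 + C3) * theta ^+ M * rnorm f = (C1 * theta ^+ M * rnorm f +
    C2 * theta ^+ M * rnorm f) + C3 * theta ^+ M * rnorm f by ring.
have b12 M : cabs (rem1 M + rem2 M) <= C1 * theta ^+ M * rnorm f + C2 * theta ^+ M * rnorm f.
  by apply: le_trans (cabs_normD _ _) _; exact: lerD.
rewrite CE; move: (odd_double_half N); set M := N./2 => <-; case: (odd N) => /=.
  rewrite big_ord_recr /= opprD addrA even; apply: le_trans (cabsB _ _) _.
  exact: lerD.
rewrite add0n even -[leLHS]addr0; apply: lerD => //.
exact: mulr_ge0 (mulr_ge0 C30 (exprn_ge0 _ t0)) (rnorm_ge0 f).
Qed.

Lemma transfer_linear_operator : exists L : {linear Hinf A -> Hinf A},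
  (forall f z, A z -> L f z = transfer_fun f z) /\ continuous L.
Proof.
have [C [theta [C0 [_ hC]]]] := transfer_expansion.
have bound f z : A z -> cabs (transfer_fun f z) <= C * rnorm f.
  by move=> /(hC f z 0%N); rewrite big_ord0 subr0 mulr1.
have [F hF] : exists F : Hinf A -> Hinf A, forall f z, A z -> F f z = transfer_fun f z.
  suff /choice[F hF] : forall f, exists g : Hinf A, forall z, A z -> g z = transfer_fun f z.
    by exists F.
  by move=> f; apply: Hinf_make; [exact: cdiffs_transfer|exact: bound].
have linF : linear F.
  move=> k f g; apply: Hinf_ext => z Az.
  by rewrite HinfD HinfZ !hF// transferP.
have [L LF] := linear_pack linF; exists L; split=> [f z Az|]; first by rewrite LF hF.
apply/continuous_bounded; exists C => f; apply: rnorm_le => // z Az.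
by rewrite LF hF// bound.
Qed.

Lemma transfer_roots f z w1 w2 : cabs z = 1 -> cabs w1 = 1 -> cabs w2 = 1 -> w1 != w2 ->
  w1 + w2 = (l^*)%C * z - l -> w1 * w2 = - z ->
  transfer_fun f z = (f w1 * (1 + (l^*)%C * w1) - f w2 * (1 + (l^*)%C * w2)) / (w1 - w2).
Proof.
move=> z1 cw1 cw2 w12 sum prod.
have w12' : w1 - w2 != 0 by rewrite subr_eq0.
have Az : A z by rewrite annulusP z1 r11.
pose h w := f w * (1 + (l^*)%C * w).
have dh w : s1 <= cabs w <= s2 -> cdiffs h w.
  move=> /andP[h1 h2].
  have : cdiffs f w by apply: Hinf_cdiffs => //; rewrite annulusP (lt_le_trans rs1)// (le_lt_trans h2).
  by move=> ?; rewrite /h; cdiffs_auto.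
have nz s w v : cabs w = s -> cabs v = 1 -> s != 1 -> w - v != 0.
  by move=> ws v1; apply: contra; rewrite subr_eq0 => /eqP wv; rewrite -ws wv v1.
have s1n : s1 != 1 by rewrite lt_eqF.
have s2n : s2 != 1 by rewrite gt_eqF.
have key s w : cabs w = s -> s != 1 -> 1 + (l^*)%C * w != 0 ->
    f w * w / (tau w - z) = (w1 - w2)^-1 * (h w * (w / (w - w1)) - h w * (w / (w - w2))).
  move=> ws sn den.
  have n1 := nz _ _ _ ws cw1 sn; have n2 := nz _ _ _ ws cw2 sn.
  have -> : tau w - z = (w - w1) * (w - w2) / (1 + (l^*)%C * w).
    have -> : (w - w1) * (w - w2) = w ^+ 2 - (w1 + w2) * w + w1 * w2 by ring.
    by rewrite sum prod /tau /blaschke; field.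
  by rewrite /h; field; rewrite w12' n1 n2 den.
have ck s v : s1 <= s <= s2 -> s != 1 -> cabs v = 1 -> ccont_circle (fun w => h w * (w / (w - v))) s.
  move=> hs sn v1 w ws; have := nz _ _ _ ws v1 sn => ?.
  have : ccont h w by apply/cdiffs_cont/dh; rewrite ws.
  by move=> ?; ccont_auto.
have s12 : s1 <= s2 by rewrite ltW// (lt_trans s11).
have mean s : 0 < s -> s1 <= s <= s2 -> s != 1 -> (forall w, cabs w = s -> 1 + (l^*)%C * w != 0) ->
    circle_mean (fun w => f w * w / (tau w - z)) s =
    (w1 - w2)^-1 * (circle_mean (fun w => h w * (w / (w - w1))) s -
                    circle_mean (fun w => h w * (w / (w - w2))) s).
  move=> s0 hs sn den.
  have k1 := ck _ _ hs sn cw1; have k2 := ck _ _ hs sn cw2.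
  rewrite -(circle_meanB (ltW s0) k1 k2) -circle_meanZ; [|exact: ltW|].
    by apply: eq_circle_mean => [|w ws]; [exact: ltW|apply: key (ws) _ _ => //; exact: den].
  by move=> w ws; apply: ccontB; [exact: k1|exact: k2].
rewrite /transfer_fun !mean ?lexx ?s12//; last exact: blaschke_den_s1.
have e1 := cauchy_formula s10 _ dh (z := w1); have e2 := cauchy_formula s10 _ dh (z := w2).
rewrite -[f w1 * _]/(h w1) -[f w2 * _]/(h w2) -e1 ?cw1 ?s11// -e2 ?cw2 ?s11//.
by field.
Qed.

Lemma transfer_coef_odd i j p f : odd i -> (forall z, A z -> f z = laurent j z) ->
  (forall w, w != 0 -> laurent j w * w * w^-1 ^+ (i./2).+1 = w^-1 ^+ p) ->
  transfer_coef i f = (p == 0%N)%:R * (l^*)%C ^+ (i./2).+1.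
Proof.
move=> oi fj hp; rewrite /transfer_coef oi.
have nz w : s2 <= cabs w -> w != 0 /\ w + l != 0.
  move=> ws; split; first by rewrite -cabs_gt0 (lt_le_trans s20).
  rewrite -cabs_gt0; have := cabs_lerB w (- l); rewrite opprK cabsN.
  by move: ws s21 l1; lra.
rewrite (@eq_circle_mean _ _ (fun w => w^-1 ^+ p * ((1 + (l^*)%C * w) / (w + l)) ^+ (i./2).+1)).
- rewrite (@circle_mean_at_infinity _ _ (fun u => u ^+ p * ((u + (l^*)%C) / (1 + l * u)) ^+ (i./2).+1)) //.
  + by rewrite expr0n !mulr0 add0r addr0 divr1.
  + by move=> w /nz[w0 wl]; cdiffs_auto.
  + move=> w /nz[w0 wl]; congr (_ * _ ^+ _).
    have -> : 1 + l * w^-1 = (w + l) / w by field.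
    by field; rewrite w0 wl.
  + by ccont_auto; rewrite mulr0 addr0 oner_neq0.
- exact: ltW.
- move=> w ws; have [w0 wl] := nz w (eq_ind _ (fun x => s2 <= x) (lexx _) _ (esym ws)).
  rewrite fj; last exact: annulus_s2.
  rewrite -hp// /tau /blaschke invf_div.
  have -> : (1 + (l^*)%C * w) / (w * (w + l)) = w^-1 * ((1 + (l^*)%C * w) / (w + l)).
    by field; rewrite w0 wl.
  by rewrite exprMn mulrA.
Qed.

Lemma transfer_coef_even i j p f : ~~ odd i -> (forall z, A z -> f z = laurent j z) ->
  (forall w, w != 0 -> laurent j w * w * w ^+ i./2 = w ^+ p) ->
  transfer_coef i f = (p == 0%N)%:R * l ^+ i./2.
Proof.
move=> /negPf oi fj hp; rewrite /transfer_coef oi.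
have nz w : cabs w <= s1 -> 1 + (l^*)%C * w != 0.
  by move=> ws; apply: blaschke_den_neq0 => //; rewrite (le_trans ws)// ltW.
rewrite (@eq_circle_mean _ _ (fun w => w ^+ p * ((w + l) / (1 + (l^*)%C * w)) ^+ i./2)).
- rewrite circle_mean_at0//.
  + by rewrite expr0n !mulr0 add0r addr0 divr1.
  + by move=> w /andP[_ /nz w0]; cdiffs_auto.
  + by ccont_auto; apply: nz; rewrite cabs0 ltW.
- exact: ltW.
- move=> w ws; have w0 : w != 0 by rewrite -cabs_gt0 ws.
  rewrite fj; last exact: annulus_s1.
  by rewrite -hp// /tau /blaschke -[w * _ / _]mulrA exprMn mulrA.
Qed.

Definition eigval i : R[i] := if odd i then (l^*)%C ^+ (i./2).+1 else l ^+ i./2.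

Lemma cabs_eigval i : cabs (eigval i) = cabs l ^+ uphalf i.
Proof.
rewrite /eigval uphalfE /=; case: ifP => oi; rewrite cabsX ?cabs_conj.
  by rewrite -{2}(odd_double_half i) oi /= doubleK.
by rewrite -{2}(odd_double_half i) oi /= uphalf_double.
Qed.

Lemma transfer_coef_triangular i j f : (forall z, A z -> f z = laurent j z) -> (j < i)%N -> transfer_coef i f = 0.
Proof.
move=> fj ji; have hij : (j./2 <= i./2)%N by exact/half_leq/ltnW.
case oi: (odd i); case oj: (odd j).
- have hlt : (j./2 < i./2)%N.
    move: ji; rewrite -{1}(odd_double_half i) -{1}(odd_double_half j) oi oj ltnS.
    by rewrite ltn_double.
  rewrite (@transfer_coef_odd i j (i./2 - j./2)) ?oi// => [|w w0].
    by rewrite subn_eq0 leqNgt hlt mul0r.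
  rewrite /laurent oj -{1}(subnK hij) exprS exprD !exprVn.
  by field; rewrite w0 !expf_neq0.
- rewrite (@transfer_coef_odd i j (i./2 + j./2).+1) ?oi ?mul0r// => w w0.
  by rewrite /laurent oj !exprS exprD !exprVn; field; rewrite w0 !expf_neq0.
- rewrite (@transfer_coef_even i j (i./2 + j./2).+1) ?oi ?mul0r// => w w0.
  by rewrite /laurent oj exprS exprD; ring.
- have hlt : (j./2 < i./2)%N.
    by move: ji; rewrite -{1}(odd_double_half i) -{1}(odd_double_half j) oi oj ltn_double.
  rewrite (@transfer_coef_even i j (i./2 - j./2)) ?oi// => [|w w0].
    by rewrite subn_eq0 leqNgt hlt mul0r.
  rewrite /laurent oj -{1}(subnK hij) exprS exprD !exprVn.
  by field; rewrite w0 !expf_neq0.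
Qed.

Lemma transfer_coef_cross i j f : (forall z, A z -> f z = laurent j z) -> odd i -> ~~ odd j ->
  transfer_coef i f = 0.
Proof.
move=> fj oi /negPf oj; rewrite (@transfer_coef_odd i j (i./2 + j./2).+1) ?oi ?mul0r// => w w0.
by rewrite /laurent oj !exprS exprD !exprVn; field; rewrite w0 !expf_neq0.
Qed.

Lemma transfer_coef_diagonal i f : (forall z, A z -> f z = laurent i z) -> transfer_coef i f = eigval i.
Proof.
move=> fi; rewrite /eigval; case: ifP => oi.
  rewrite (@transfer_coef_odd i i 0) ?mul1r// => w w0.
  by rewrite /laurent oi exprS !exprVn; field; rewrite w0 expf_neq0.
rewrite (@transfer_coef_even i i 0) ?oi ?mul1r// => w w0.
by rewrite /laurent oi exprS !exprVn; field; rewrite w0 expf_neq0.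
Qed.

Lemma laurent_basis : exists e : nat -> Hinf A, forall i z, A z -> e i z = laurent i z.
Proof.
suff /choice[e he] : forall i, exists f : Hinf A, forall z, A z -> f z = laurent i z by exists e.
move=> i; apply: (@Hinf_make _ _ _ _ (Num.max (r2 ^+ i./2) (r1^-1 ^+ (i./2).+1))).
  by move=> z /(annulus_neq0 r10) z0; exact: cdiffs_laurent.
move=> z /andP[z1 z2]; rewrite /laurent le_max; case: ifP => _; rewrite cabsX.
  by rewrite lerXn2r ?nnegrE ?cabs_ge0 ?(ltW r20) ?(ltW z2).
rewrite cabsV lerXn2r ?orbT ?nnegrE ?invr_ge0 ?cabs_ge0 ?(ltW r10)//.
by rewrite lef_pV2 ?posrE//; [exact: ltW|exact: lt_trans z1].
Qed.

Lemma Hinf_sumE n (F : 'I_n -> Hinf A) z : (\sum_i F i) z = \sum_i F i z.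
Proof.
elim: n F => [|n IH] F; first by rewrite !big_ord0.
by rewrite !big_ord_recr /= -IH.
Qed.

Section Spectrum.
Variable L : {linear Hinf A -> Hinf A}.
Hypothesis LE : forall f z, A z -> L f z = transfer_fun f z.
Hypothesis cL : continuous L.
Variable e : nat -> Hinf A.
Hypothesis eE : forall i z, A z -> e i z = laurent i z.

Definition laurent_coef i f : R[i] := circle_mean (fun w => f w / laurent i w) 1.

Lemma annulus_unit w : cabs w = 1 -> A w.
Proof. by move=> w1; rewrite annulusP w1 r11. Qed.

Lemma ccont_laurent_coef i f : ccont_circle (fun w => f w / laurent i w) 1.
Proof.
move=> w w1; have w0 : w != 0 by rewrite -cabs_gt0 w1.
have := cdiffs_cont (Hinf_cdiffs f (annulus_unit w1)).
have := cdiffs_cont (cdiffs_laurent i w0) => ? ?; have := laurent_neq0 i w0 => ?.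
by ccont_auto.
Qed.

Lemma laurent_coefP i k f g :
  laurent_coef i (k *: f + g) = k * laurent_coef i f + laurent_coef i g.
Proof.
rewrite /laurent_coef -circle_meanZ//; last exact: ccont_laurent_coef.
rewrite -circle_meanD//; last exact: ccont_laurent_coef.
  by apply: eq_circle_mean => // w _; rewrite HinfD HinfZ; ring.
by move=> w w1; apply: ccontM; [exact: ccont_cst|exact: ccont_laurent_coef].
Qed.

Lemma laurent_coef_le i f : cabs (laurent_coef i f) <= rnorm f.
Proof.
apply: circle_mean_le => // [|w w1]; first exact: ccont_laurent_coef.
by rewrite cabs_div cabs_laurent1// divr1 rnorm_ge//; exact: annulus_unit.
Qed.

Lemma laurent_coef_basis i j : laurent_coef i (e j) = (i == j)%:R.
Proof.
rewrite -(circle_mean_laurent i j ltr01); apply: eq_circle_mean => // w w1.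
by rewrite eE//; exact: annulus_unit.
Qed.

Lemma residual_bound : exists C theta : R, 0 <= C /\ 0 <= theta < 1 /\
  forall f N, rnorm (L f - \sum_(i < N) transfer_coef i f *: e i) <= C * theta ^+ N./2 * rnorm f.
Proof.
have [C [theta [C0 [t01 hC]]]] := transfer_expansion; exists C, theta; split=> //; split=> //.
move=> f N; apply: (rnorm_le r11 r21) => z Az.
rewrite Hinf_sub LE// Hinf_sumE; apply: le_trans (hC f z N Az).
rewrite le_eqVlt; apply/orP; left; apply/eqP; congr (cabs (_ - _)).
by apply: eq_bigr => i _; rewrite HinfZ eE.
Qed.

Lemma residual_to0 (eps : R) : 0 < eps -> exists N, forall n, (N <= n)%N ->
  forall f, rnorm (L f - \sum_(i < n) transfer_coef i f *: e i) <= eps * rnorm f.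
Proof.
move=> eps0; have [C [theta [C0 [t01 hC]]]] := residual_bound.
have C1 : 0 < C + 1 by rewrite ltr_wpDl.
have [N hN] := geometric_small t01 (divr_gt0 eps0 C1).
exists N.*2 => n nN f; apply: le_trans (hC f n) _; rewrite ler_wpM2r ?rnorm_ge0//.
have := hN n./2; rewrite -(doubleK N) => /(_ (half_leq nN)) h.
apply: (@le_trans _ _ ((C + 1) * (eps / (C + 1)))).
  by case/andP: t01 => t0 _; rewrite ler_pM ?exprn_ge0// lerDl.
by rewrite mulrC divfK// gt_eqF.
Qed.

Lemma laurent_coef_transfer i f : laurent_coef i (L f) = transfer_coef i f.
Proof.
have a_sumE := coord_sum laurent_coefP.
have aZE := coordZ laurent_coefP.
apply: cabs_close_eq => eps eps0.
have r1' : 0 < rnorm f + 1 by rewrite ltr_wpDl// rnorm_ge0.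
have [N hN] := residual_to0 (divr_gt0 eps0 r1').
have {}hN := hN (maxn N i.+1) (leq_maxl _ _) f.
have E : laurent_coef i (L f - \sum_(j < maxn N i.+1) transfer_coef j f *: e j) =
    laurent_coef i (L f) - transfer_coef i f.
  have ineq : (i < maxn N i.+1)%N by rewrite leq_max ltnSn orbT.
  rewrite -[- \sum_(j < _) _]scaleN1r addrC laurent_coefP mulN1r addrC; congr (_ - _).
  rewrite a_sumE (bigD1 (Ordinal ineq))//= aZE laurent_coef_basis eqxx mulr1.
  rewrite big1 ?addr0// => j /eqP ji; rewrite aZE laurent_coef_basis.
  by rewrite (introF eqP) ?mulr0// => h; apply: ji; exact: val_inj.
rewrite -E; apply: le_trans (laurent_coef_le _ _) _; apply: le_trans hN _.
by rewrite mulrAC ler_pdivrMr// ler_pM2l// lerDl.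
Qed.

Let cpl := Hinf_geometrically_complete r10 r11 r21.

Let bnd i : exists M : R, forall v, cabs (laurent_coef i v) <= M * rnorm v.
Proof. by exists 1 => v; rewrite mul1r laurent_coef_le. Qed.

Let tri i j : (j < i)%N -> laurent_coef i (L (e j)) = 0.
Proof. by move=> ji; rewrite laurent_coef_transfer; apply: transfer_coef_triangular ji => z; exact: eE. Qed.

Let diag i : laurent_coef i (L (e i)) = eigval i.
Proof. by rewrite laurent_coef_transfer; apply: transfer_coef_diagonal => z; exact: eE. Qed.

Let approx (eps : R) : 0 < eps -> exists N, forall n, (N <= n)%N -> forall v,
  rnorm (L v - \sum_(i < n) laurent_coef i (L v) *: e i) <= eps * rnorm v.
Proof.
move=> /residual_to0[N hN]; exists N => n /hN {}hN v.
by under eq_bigr do rewrite laurent_coef_transfer.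
Qed.

Lemma transfer_resolvent mu : mu != 0 -> (forall i, eigval i != mu) -> resolvent_set L mu.
Proof.
move=> mu0 dmu; apply: (resolvent_triangular cpl cL laurent_coefP bnd tri approx mu0).
by move=> i; rewrite diag.
Qed.

Lemma transfer_zero_spectrum : spectrum L 0.
Proof. exact: (zero_spectrum laurent_coefP laurent_coef_basis approx). Qed.

Lemma eigval_neq i j : eigval i != 0 -> (uphalf j < uphalf i)%N -> eigval j != eigval i.
Proof.
move=> di ji; apply/eqP => /(congr1 (@cabs R)); rewrite !cabs_eigval => /eqP.
have l0 : 0 < cabs l.
  rewrite lt_def cabs_ge0 andbT; apply: contra di => /eqP l0.
  by rewrite -cabs_eq0 cabs_eigval l0 expr0n; case: (uphalf i) ji.
by rewrite eq_sym lt_eqF// ltr_iXn2l.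
Qed.

Lemma transfer_eigenvector i : eigval i != 0 ->
  exists2 b, spanned e i (b - e i) & L b = eigval i *: b.
Proof.
move=> di; rewrite -diag.
pose m := if odd i then i else i.-1.
apply: (@eigenvector_exists _ _ L e laurent_coef cL laurent_coefP bnd tri approx i m).
- by rewrite diag.
- by rewrite /m; case: (odd i) => //; exact: leq_pred.
- move=> j jm; rewrite !diag; apply: eigval_neq => //.
  exact: uphalf_lt.
- move=> j /andP[mj ji]; move: mj; rewrite /m; case: ifP => oi mj.
    by rewrite ltnNge mj in ji.
  rewrite laurent_coef_transfer; apply: (transfer_coef_cross (j := i)) => [z|//|]; [exact: eE| |by rewrite oi].
  have ij : i = j.+1.
    by case: i oi mj ji {di m} => // i _ /= h1 h2; apply/eqP; rewrite eqSS eqn_leq h1 -ltnS h2.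
  by move: oi; rewrite ij /= => /negbFE.
Qed.

Lemma transfer_multiplicity mu m (iota : 'I_m -> nat) : mu != 0 -> injective iota ->
  (forall i, eigval i = mu <-> exists k, iota k = i) -> algebraic_multiplicity L mu m.
Proof.
move=> mu0 iota_inj hiota.
have [b hb] : exists b : nat -> Hinf A, forall i, eigval i = mu ->
    spanned e i (b i - e i) /\ L (b i) = mu *: b i.
  suff /choice[b hb] : forall i, exists b : Hinf A, eigval i = mu ->
      spanned e i (b - e i) /\ L b = mu *: b by exists b.
  move=> i; have [dm|dm] := eqVneq (eigval i) mu; last by exists 0 => h; rewrite h eqxx in dm.
  have [|b b1 b2] := @transfer_eigenvector i; first by rewrite dm.
  by exists b => _; rewrite b2 dm.
apply: (triangular_multiplicity laurent_coefP laurent_coef_basis tri approx (iota := iota) (b := b)) => //.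
- by move=> i; rewrite diag.
- by move=> i; rewrite diag => /hb[].
- by move=> i; rewrite diag => /hb[].
Qed.

Lemma transfer_eigenvalue i : eigval i != 0 -> eigenvalues L (eigval i).
Proof.
move=> /transfer_eigenvector[b sb Lb]; exists b => //.
apply: contraTneq (oner_neq0 R[i]) => b0.
have := coord_spanned laurent_coefP laurent_coef_basis sb (leqnn i).
rewrite b0 sub0r -scaleN1r (coordZ laurent_coefP) laurent_coef_basis eqxx mulN1r.
by move=> /eqP; rewrite oppr_eq0 oner_eq0.
Qed.

End Spectrum.

End TransferOperator.

(** * Inverse branches and admissible annuli *)

Section InverseBranches.
Variables (R : realType) (l : R[i]).
Hypothesis l1 : cabs l < 1.
Implicit Types (z w u : R[i]).

Lemma sqrtc_Re_gt0 u : 0 < complex.Re u -> 0 < complex.Re (sqrtc u).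
Proof.
case: u => x y /= x0; rewrite sqrtr_gt0 divr_gt0//.
by rewrite ltr_wpDl// sqrtr_ge0.
Qed.

Lemma cdiff_sqrtc u : 0 < complex.Re u -> cdiff (@sqrtc R) u (2 * sqrtc u)^-1.
Proof.
move=> u0; have su := sqrtc_Re_gt0 u0.
have Re_sum v : 0 < complex.Re v -> complex.Re (sqrtc u) <= cabs (sqrtc v + sqrtc u).
  move=> /sqrtc_Re_gt0 sv; apply: le_trans (cabs_Re _); apply: le_trans (ler_norm _).
  by rewrite ReD; lra.
have near v : cabs (v - u) < complex.Re u -> 0 < complex.Re v.
  by have := cabs_Re (v - u); rewrite ReB ler_norml => /andP[]; lra.
have nz v : 0 < complex.Re v -> sqrtc v + sqrtc u != 0.
  by move=> /Re_sum h; rewrite -cabs_gt0 (lt_le_trans su).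
have dsq v : 0 < complex.Re v -> sqrtc v - sqrtc u = (sqrtc v + sqrtc u)^-1 * (v - u).
  move=> /nz h; apply: (mulfI h); rewrite mulrA mulfV// mul1r.
  have -> : v - u = sqrtc v ^+ 2 - sqrtc u ^+ 2 by rewrite !sqr_sqrtc.
  by ring.
have cs : ccont (@sqrtc R) u.
  move=> e e0; exists (Num.min (complex.Re u) (e * complex.Re (sqrtc u))).
    by rewrite lt_min u0 mulr_gt0.
  move=> v; rewrite lt_min => /andP[/near v0 vu].
  rewrite dsq// mulrC cabs_div ltr_pdivrMr ?cabs_gt0 ?nz//.
  by rewrite (lt_le_trans vu)// ler_pM2l// Re_sum.
pose q v := if 0 < complex.Re v then (sqrtc v + sqrtc u)^-1
            else (sqrtc v - sqrtc u) / (v - u).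
exists q; split.
- apply: (@ccont_near _ (fun v => (sqrtc v + sqrtc u)^-1) _ _ _ u0).
    by move=> v /near v0; rewrite /q v0.
  by have := nz _ u0 => ?; ccont_auto.
- by rewrite /q u0 mulr_natl mulr2n.
- move=> v; rewrite /q; case: ifPn => [/dsq//|v0].
  rewrite divfK// subr_eq0; by apply: contraNneq v0 => ->.
Qed.

Definition blaschke_discr z : R[i] := (l - (l^*)%C * z) ^+ 2 + 4 * z.

Lemma blaschke_discr_neq0 z : cabs z = 1 -> blaschke_discr z != 0.
Proof.
move=> z1; rewrite -cabs_gt0.
have := cabs_lerB (4 * z) (- (l - (l^*)%C * z) ^+ 2).
rewrite opprK cabsN [4 * z + _]addrC /blaschke_discr cabsM cabs_nat z1 cabsX => h.
have b := cabsB l ((l^*)%C * z); rewrite cabsM cabs_conj z1 mulr1 in b.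
have : cabs (l - (l^*)%C * z) ^+ 2 < 2 ^+ 2.
  by rewrite ltr_pXn2r ?nnegrE ?cabs_ge0//; move: l1; lra.
by move: h; rewrite (_ : 2 ^+ 2 = 4 :> R); [lra|ring].
Qed.

Lemma cdiff_blaschke_discr z : cdiff blaschke_discr z (4 - 2 * (l^*)%C * (l - (l^*)%C * z)).
Proof.
have h1 : cdiff (fun w => l - (l^*)%C * w) z (0 - (0 * z + (l^*)%C * 1)).
  by apply: cdiffB; [exact: cdiff_cst|apply: cdiffM; [exact: cdiff_cst|exact: cdiff_id]].
have h2 : cdiff (fun w => 4 * w) z (0 * z + 4 * 1).
  by apply: cdiffM; [exact: cdiff_cst|exact: cdiff_id].
have := cdiffD (cdiffM h1 h1) h2.
set d := (X in cdiff _ _ X -> _); have -> : d = 4 - 2 * (l^*)%C * (l - (l^*)%C * z).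
  by rewrite /d; ring.
by move=> h; rewrite /blaschke_discr; under eq_fun do rewrite expr2.
Qed.

Lemma root_on_circle z w : cabs z = 1 -> w * (w + l) = z * (1 + (l^*)%C * w) -> cabs w = 1.
Proof.
move=> z1 /(congr1 (@cabs R)); rewrite !cabsM z1 mul1r => h.
apply/eqP; rewrite eq_le !leNgt; apply/andP; split; apply/negP => w1.
  have := cabs_den_lt l1 w1; rewrite -h ltNge => /negP; apply.
  by rewrite ler_peMl ?cabs_ge0// ltW.
have := cabs_den_gt l1 w1; rewrite -h ltNge => /negP; apply.
by rewrite ler_piMl ?cabs_ge0// ltW.
Qed.

Definition blaschke_branch (z0 : R[i]) (k : 'I_2) z : R[i] :=
  ((l^*)%C * z - l + (if k == ord0 then 1 else -1) *
    (sqrtc (blaschke_discr z0) * sqrtc (blaschke_discr z / blaschke_discr z0))) / 2.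

Lemma branch_on_circle z s (e : R[i]) (w := ((l^*)%C * z - l + e * s) / 2) :
  cabs z = 1 -> s ^+ 2 = blaschke_discr z -> e ^+ 2 = 1 -> cabs w = 1 /\ blaschke l w = z.
Proof.
move=> z1 s2 e2.
have root : w * (w + l) = z * (1 + (l^*)%C * w).
  have -> : w * (w + l) = z * (1 + (l^*)%C * w) + (e ^+ 2 * s ^+ 2 - blaschke_discr z) / 4.
    by rewrite /w /blaschke_discr; field.
  by rewrite s2 e2 mul1r subrr mul0r addr0.
have w1 := root_on_circle z1 root; split=> //.
rewrite /blaschke root mulfK// blaschke_den_neq0//.
by rewrite w1.
Qed.

Lemma branch_sqr z0 z : blaschke_discr z0 != 0 ->
  (sqrtc (blaschke_discr z0) * sqrtc (blaschke_discr z / blaschke_discr z0)) ^+ 2 = blaschke_discr z.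
Proof. by move=> d0; rewrite exprMn !sqr_sqrtc mulrC divfK. Qed.

Lemma sign_sqr (k : 'I_2) : (if k == ord0 then 1 else -1 : R[i]) ^+ 2 = 1.
Proof. by case: ifP => _; rewrite ?sqrrN expr1n. Qed.

Lemma cdiff_blaschke_branch z0 k z : blaschke_discr z0 != 0 -> 0 < complex.Re (blaschke_discr z / blaschke_discr z0) ->
  cdiff (blaschke_branch z0 k) z (((l^*)%C + (if k == ord0 then 1 else -1) *
      ((4 - 2 * (l^*)%C * (l - (l^*)%C * z)) /
       (2 * (sqrtc (blaschke_discr z0) * sqrtc (blaschke_discr z / blaschke_discr z0))))) / 2).
Proof.
move=> d0 Re0.
have s0 : sqrtc (blaschke_discr z0) != 0 by rewrite sqrtc_eq0.
have s1 : sqrtc (blaschke_discr z / blaschke_discr z0) != 0.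
  by rewrite sqrtc_eq0; apply: contraTneq Re0 => ->; rewrite ltxx.
set e := (if _ then _ else _).
have hd : cdiff (fun w => blaschke_discr w / blaschke_discr z0) z
    ((4 - 2 * (l^*)%C * (l - (l^*)%C * z)) * (blaschke_discr z0)^-1 + blaschke_discr z * 0).
  by apply: cdiffM; [exact: cdiff_blaschke_discr|exact: cdiff_cst].
have hs := cdiff_comp hd (cdiff_sqrtc Re0).
have h1 : cdiff (fun w => (l^*)%C * w - l) z (0 * z + (l^*)%C * 1 - 0).
  by apply: cdiffB; [apply: cdiffM; [exact: cdiff_cst|exact: cdiff_id]|exact: cdiff_cst].
have h2 := cdiffM (cdiff_cst (sqrtc (blaschke_discr z0)) z) hs.
have h3 := cdiffM (cdiff_cst e z) h2.
have := cdiffM (cdiffD h1 h3) (cdiff_cst 2^-1 z).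
set d := (X in cdiff _ _ X -> _) => h.
suff <- : d = ((l^*)%C + e * ((4 - 2 * (l^*)%C * (l - (l^*)%C * z)) /
       (2 * (sqrtc (blaschke_discr z0) * sqrtc (blaschke_discr z / blaschke_discr z0))))) / 2 by [].
rewrite /d; have := sqr_sqrtc (blaschke_discr z0); move: s0 s1.
set x := sqrtc (blaschke_discr z0); set y := sqrtc (blaschke_discr z / _) => x0 y0 <-.
by field; rewrite x0 y0.
Qed.

Lemma local_branches z0 : cabs z0 = 1 -> local_inverse_branches (blaschke l) z0 (blaschke_branch z0).
Proof.
move=> z1; have d0 := blaschke_discr_neq0 z1.
have [r r0 hr] : exists2 r : R, 0 < r & forall z, cabs (z - z0) < r ->
    0 < complex.Re (blaschke_discr z / blaschke_discr z0).
  have cd : ccont (fun w => blaschke_discr w / blaschke_discr z0) z0.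
    by apply: ccontM; [exact: cdiff_cont (cdiff_blaschke_discr _)|exact: ccont_cst].
  have [r r0 hr] := cd _ ltr01; exists r => // z /hr; rewrite divff//.
  have := cabs_Re (blaschke_discr z / blaschke_discr z0 - 1); rewrite ReB /= ler_norml => /andP[].
  lra.
have branch_eq z k : cabs z = 1 -> cabs (blaschke_branch z0 k z) = 1 /\ blaschke l (blaschke_branch z0 k z) = z.
  by move=> h; apply: branch_on_circle => //; [exact: branch_sqr|exact: sign_sqr].
exists [set z | cabs (z - z0) < r]; split.
- apply: cabs_open => z /= zr; exists (r - cabs (z - z0)); first by rewrite subr_gt0.
  move=> w wz /=; rewrite -(subrKA z); apply: le_lt_trans (cabs_normD _ _) _; lra.
- by rewrite /= subrr cabs0.
- by move=> k z zr; apply/derivable_cdiffs; eexists; apply: cdiff_blaschke_branch => //; exact: hr.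
- by move=> k z zr; exact: branch_eq.
move=> z zr cz; set s := sqrtc (blaschke_discr z0) * sqrtc (blaschke_discr z / blaschke_discr z0).
have s2 : s ^+ 2 = blaschke_discr z by exact: branch_sqr.
have s0 : s != 0 by apply: contraTneq (blaschke_discr_neq0 cz) => h; rewrite -s2 h expr0n eqxx.
have b0 : blaschke_branch z0 ord0 z = ((l^*)%C * z - l + s) / 2 by rewrite /blaschke_branch eqxx mul1r.
have b1 : blaschke_branch z0 ord_max z = ((l^*)%C * z - l - s) / 2 by rewrite /blaschke_branch /= mulN1r.
split.
  move=> k k' /= kk'.
  have : (if k == ord0 then 1 else -1) * s = (if k' == ord0 then 1 else -1) * s.
    move: kk'; rewrite /blaschke_branch -/s => /(divIf (two_neq0 R)) /addrI.
    by [].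
  move=> /(mulIf s0) /eqP; case: (eqVneq k ord0) => [->|k0]; case: (eqVneq k' ord0) => [->|k0'] //.
  - by rewrite -subr_eq0 opprK (_ : 1 + 1 = 2 :> R[i]) ?(negPf (two_neq0 R))//; ring.
  - by rewrite eq_sym -subr_eq0 opprK (_ : 1 + 1 = 2 :> R[i]) ?(negPf (two_neq0 R))//; ring.
  - move=> _; apply: val_inj; case: k k' k0 k0' {kk'} => [[|[|//]] ?] [[|[|//]] ?] //.
move=> w w1 tw.
have den : 1 + (l^*)%C * w != 0 by apply: blaschke_den_neq0 => //; rewrite w1.
have root : w * (w + l) - z * (1 + (l^*)%C * w) = 0.
  by rewrite -tw /blaschke divfK// subrr.
have : (w - blaschke_branch z0 ord0 z) * (w - blaschke_branch z0 ord_max z) = 0.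
  have -> : (w - blaschke_branch z0 ord0 z) * (w - blaschke_branch z0 ord_max z) =
      w * (w + l) - z * (1 + (l^*)%C * w) + (blaschke_discr z - s ^+ 2) / 4.
    by rewrite b0 b1 /blaschke_discr; field.
  by rewrite root s2 subrr mul0r addr0.
move=> /eqP; rewrite mulf_eq0 !subr_eq0 => /orP[/eqP ->|/eqP ->].
  by exists ord0.
by exists ord_max.
Qed.

Lemma branch_sum z0 (f : R[i] -> R[i]) : cabs z0 = 1 -> exists w1 w2,
  [/\ cabs w1 = 1, cabs w2 = 1 & w1 != w2] /\
  [/\ w1 + w2 = (l^*)%C * z0 - l, w1 * w2 = - z0 &
  \sum_(k < 2) derive1 (blaschke_branch z0 k) z0 * f (blaschke_branch z0 k z0) =
  (f w1 * (1 + (l^*)%C * w1) - f w2 * (1 + (l^*)%C * w2)) / (w1 - w2)].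
Proof.
move=> z1; have d0 := blaschke_discr_neq0 z1.
pose s := sqrtc (blaschke_discr z0) * sqrtc (blaschke_discr z0 / blaschke_discr z0).
have s2 : s ^+ 2 = blaschke_discr z0 by exact: branch_sqr.
have s0 : s != 0 by apply: contraTneq d0 => h; rewrite -s2 h expr0n eqxx.
have Re0 : 0 < complex.Re (blaschke_discr z0 / blaschke_discr z0) by rewrite divff//= ltr01.
have dE k := cdiff_derive1 (cdiff_blaschke_branch k d0 Re0).
pose w1 := ((l^*)%C * z0 - l + s) / 2; pose w2 := ((l^*)%C * z0 - l - s) / 2.
have b0 : blaschke_branch z0 ord0 z0 = w1 by rewrite /blaschke_branch eqxx mul1r.
have b1 : blaschke_branch z0 ord_max z0 = w2 by rewrite /blaschke_branch /= mulN1r.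
have w12 : w1 - w2 = s by rewrite /w1 /w2; field.
exists w1, w2; split; split.
- rewrite -b0; apply: (branch_on_circle z1 _ (sign_sqr ord0)).1; exact: branch_sqr.
- rewrite -b1; apply: (branch_on_circle z1 _ (sign_sqr ord_max)).1; exact: branch_sqr.
- by rewrite -subr_eq0 w12.
- by rewrite /w1 /w2; field.
- have -> : w1 * w2 = - z0 + (blaschke_discr z0 - s ^+ 2) / 4 by rewrite /w1 /w2 /blaschke_discr; field.
  by rewrite s2 subrr mul0r addr0.
rewrite big_ord_recl big_ord1 (_ : lift ord0 ord0 = ord_max); last exact: val_inj.
rewrite b0 b1 !dE -/s w12 /= mul1r mulN1r.
have e1 : ((l^*)%C + (4 - 2 * (l^*)%C * (l - (l^*)%C * z0)) / (2 * s)) / 2 = (1 + (l^*)%C * w1) / s.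
  by rewrite /w1; field; rewrite s0.
have e2 : ((l^*)%C - (4 - 2 * (l^*)%C * (l - (l^*)%C * z0)) / (2 * s)) / 2 = - ((1 + (l^*)%C * w2) / s).
  by rewrite /w2; field; rewrite s0.
by rewrite e1 e2; ring.
Qed.

End InverseBranches.

Section AnnulusTopology.
Variable R : realType.
Implicit Types (z w : R[i]) (r s : R).

Lemma open_annulus (r1 r2 : R) : open (annulus r1 r2 : set R[i]).
Proof. by apply: cabs_open => z Az; exact: annulus_nbhs. Qed.

Lemma closure_annulus_sub (r1 r2 : R) z : closure (annulus r1 r2) z -> r1 <= cabs z <= r2.
Proof.
move=> /closure_cabs h; apply/andP; split; apply/ler_addgt0Pr => e /h[w /andP[w1 w2] wz].
  by have := cabs_lerB w z; lra.
by have := cabs_lerB' w z; lra.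
Qed.

Lemma closure_annulus_sup (r1 r2 : R) z : 0 < r1 -> r1 < r2 -> r1 <= cabs z <= r2 ->
  closure (annulus r1 r2) z.
Proof.
move=> r10 r12 /andP[z1 z2]; apply/closure_cabs => r r0.
have z0 : 0 < cabs z by lra.
have [rho [h1 h2 h3]] : exists rho : R, [/\ r1 < rho, rho < r2 & `|rho - cabs z| < r].
  have [zr|zr] := ltP (cabs z) r2.
    exists (Num.min (cabs z + r / 2) ((cabs z + r2) / 2)).
    rewrite lt_min gt_min; split; first by apply/andP; split; lra.
      by apply/orP; right; lra.
    rewrite ltr_norml; have : Num.min (cabs z + r / 2) ((cabs z + r2) / 2) <= cabs z + r / 2.
      by rewrite ge_min lexx.
    have : cabs z <= Num.min (cabs z + r / 2) ((cabs z + r2) / 2).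
      by rewrite le_min; apply/andP; split; lra.
    by move=> *; apply/andP; split; lra.
  exists (Num.max (cabs z - r / 2) ((r1 + r2) / 2)).
  rewrite lt_max gt_max; split; first by apply/orP; right; lra.
    by apply/andP; split; lra.
  rewrite ltr_norml; have : cabs z - r / 2 <= Num.max (cabs z - r / 2) ((r1 + r2) / 2).
    by rewrite le_max lexx.
  have : Num.max (cabs z - r / 2) ((r1 + r2) / 2) <= cabs z.
    by rewrite ge_max; apply/andP; split; lra.
  by move=> *; apply/andP; split; lra.
have rho0 : 0 < rho by lra.
exists ((rho / cabs z)%:C%C * z).
  rewrite annulusP cabsM cabs_real ger0_norm ?divr_ge0 ?ltW// divfK ?gt_eqF//.
  by rewrite h1.
have -> : (rho / cabs z)%:C%C * z - z = ((rho - cabs z) / cabs z)%:C%C * z.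
  rewrite mulrBl divff ?gt_eqF// rmorphB rmorph1 /=; ring.
by rewrite cabsM cabs_real normrM normfV (gtr0_norm z0) divfK ?gt_eqF.
Qed.

Lemma frontier_annulus_sub (s1 s2 : R) z : frontier (annulus s1 s2) z -> cabs z = s1 \/ cabs z = s2.
Proof.
move=> [/closure_annulus_sub /andP[h1 h2] hi].
have [e1|n1] := eqVneq (cabs z) s1; first by left.
have [e2|n2] := eqVneq (cabs z) s2; first by right.
exfalso; apply: hi; rewrite /interior.
apply: open_nbhs_nbhs; split; first exact: open_annulus.
by rewrite annulusP !lt_neqAle eq_sym n1 n2 h1.
Qed.

Lemma frontier_annulus_sup (s1 s2 : R) z : 0 < s1 -> s1 < s2 -> cabs z = s1 \/ cabs z = s2 ->
  frontier (annulus s1 s2) z.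
Proof.
move=> s10 s12 hz; split.
  by apply: closure_annulus_sup => //; case: hz => ->; rewrite lexx ltW.
move=> /interior_subset; rewrite annulusP.
by case: hz => ->; rewrite ltxx ?andbF.
Qed.

End AnnulusTopology.

Section BlaschkeAdmissible.
Variables (R : realType) (l : R[i]).
Hypothesis l1 : cabs l < 1.
Implicit Types (z w : R[i]).

Lemma blaschke_den_neq0_lt w : cabs l * cabs w < 1 -> 1 + (l^*)%C * w != 0.
Proof.
move=> w1; rewrite -cabs_gt0; have := cabs_lerB 1 (- ((l^*)%C * w)).
by rewrite opprK cabsN cabs1 cabsM cabs_conj; lra.
Qed.

Lemma admissible_radii (r1 r2 : R) : admissible (blaschke l) r1 r2 ->
  exists s1 s2 : R, [/\ 0 < r1, r1 < s1, s1 < 1, 1 < s2 & s2 < r2] /\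
  [/\ forall w, cabs w = s1 -> cabs (blaschke l w) < r1,
      forall w, cabs w = s2 -> 1 + (l^*)%C * w != 0 &
      forall w, cabs w = s2 -> r2 < cabs (blaschke l w)].
Proof.
move=> [/andP[r10 r11] r21 [F [Fext Fhol [s1 [s2 [[/andP[s10 s11] s21] _ _ clA frA]]]]]].
have s12 : s1 < s2 by lra.
have r12 : r1 < r2 by lra.
have inA w : cabs w = s1 \/ cabs w = s2 -> r1 < cabs w < r2.
  by move=> h; apply: clA; apply: closure_annulus_sup => //; case: h => ->; rewrite lexx ltW.
have ex s : 0 < s -> exists w : R[i], cabs w = s.
  by move=> s0; exists s%:C%C; rewrite cabs_real gtr0_norm.
exists s1, s2; split.
  have [w ws] := ex _ s10; have := inA w (or_introl ws); rewrite ws => /andP[? _].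
  have s20 : 0 < s2 by lra.
  have [v vs] := ex _ s20; have := inA v (or_intror vs); rewrite vs => /andP[_ ?].
  by [].
have outF w : cabs w = s1 \/ cabs w = s2 -> cabs (F w) < r1 \/ r2 < cabs (F w).
  move=> h; have [|h1] := ltP (cabs (F w)) r1; first by left.
  have [|h2] := ltP r2 (cabs (F w)); first by right.
  have : (F @` frontier (annulus s1 s2) `&` closure (annulus r1 r2)) (F w).
    split; first by exists w => //; exact: frontier_annulus_sup.
    by apply: closure_annulus_sup => //; rewrite h1.
  by rewrite frA.
have ident w : r1 < cabs w < r2 -> F w * (1 + (l^*)%C * w) = w * (w + l).
  move=> hw; apply/eqP; rewrite -subr_eq0; apply/eqP; move: w hw.
  apply: (@eq0_on_unit_circle _ (fun w => F w * (1 + (l^*)%C * w) - w * (w + l)) r1 r2) => //.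
  - by rewrite r10.
  - move=> w hw; have : cdiffs F w by apply/derivable_cdiffs/Fhol.
    by move=> ?; cdiffs_auto.
  - move=> w w1; rewrite Fext// /blaschke divfK ?subrr// blaschke_den_neq0//.
    by rewrite w1.
have den2 w : cabs w = s2 -> 1 + (l^*)%C * w != 0.
  move=> ws; apply/eqP => h0; have := ident w (inA w (or_intror ws)).
  move=> /eqP; rewrite h0 mulr0 eq_sym mulf_eq0 => /orP[]/eqP h.
    by have := cabs0 R; rewrite -h ws; lra.
  have := cabs_lerB w (- l); rewrite opprK h cabs0 cabsN ws; move: l1; lra.
have den1 w : cabs w = s1 -> 1 + (l^*)%C * w != 0.
  by move=> ws; apply: blaschke_den_neq0 => //; rewrite ws ltW.
have FE w : cabs w = s1 \/ cabs w = s2 -> F w = blaschke l w.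
  move=> hw; have den : 1 + (l^*)%C * w != 0 by case: hw => [/den1|/den2].
  by rewrite /blaschke -(ident w (inA w hw)) mulfK.
split=> // w ws.
- have := outF w (or_introl ws); rewrite FE; last by left.
  case=> // h; have : cabs (blaschke l w) < 1 by apply: blaschke_lt1 => //; rewrite ws.
  by lra.
- have := outF w (or_intror ws); rewrite FE; last by right.
  case=> // h; have : 1 < cabs (blaschke l w).
    by apply: blaschke_gt1 => //; [rewrite ws|exact: den2].
  by lra.
Qed.

Lemma blaschke_inv w : w != 0 -> cabs (blaschke l w) = (cabs (blaschke l ((w^*)%C)^-1))^-1.
Proof.
move=> w0; rewrite -(cabs_conj (blaschke l _^-1)) -cabsV; congr cabs.
rewrite /blaschke !(rmorphM, fmorphV, rmorphD, rmorph1) /= conjcK.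
have -> : ((l^*)%C^*)%C = l by exact: conjcK.
have [d0|d0] := eqVneq (1 + (l^*)%C * w) 0.
  have -> : w^-1 + (l^*)%C = 0 by rewrite -[_ + _](mulfK w0) mulrDl mulVf// d0 mul0r.
  by rewrite d0 invr0 mulr0 mulr0 mul0r invr0.
have [d1|d1] := eqVneq (w + l) 0.
  have -> : 1 + l * w^-1 = 0 by rewrite -[_ + _](mulfK w0) mulrDl mul1r divfK// d1 mul0r.
  by rewrite d1 mulr0 mul0r invr0 mulr0 invr0.
have -> : w^-1 + (l^*)%C = (1 + (l^*)%C * w) / w by field.
have -> : 1 + l * w^-1 = (w + l) / w by field.
by field; rewrite w0 d0 d1.
Qed.

Lemma blaschke_admissible : exists r1 r2 : R, admissible (blaschke l) r1 r2.
Proof.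
pose a := cabs l; have a0 : 0 <= a := cabs_ge0 l; have a1 : a < 1 := l1.
pose s := (1 + a) / 2; have [s0 s1 as1] : [/\ 0 < s, s < 1 & a < s] by rewrite /s; split; lra.
have ls2 : 0 < (1 - s ^+ 2) * (1 - a ^+ 2).
  by rewrite mulr_gt0// subr_gt0 expr_lt1// ltW.
pose k := (1 - s ^+ 2) * (1 - a ^+ 2) / 4; have k0 : 0 < k by rewrite divr_gt0.
have k1 : k <= 1 / 4.
  rewrite /k ler_pM2r// -[leRHS]mul1r ler_pM ?subr_ge0 ?expr_le1 ?(ltW s0)// ?(ltW s1)// ?(ltW a1)//.
    by rewrite gerBl sqr_ge0.
  by rewrite gerBl sqr_ge0.
have tau_s w : cabs w = s -> cabs (blaschke l w) <= s * (1 - k / 2).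
  move=> ws; have den : 1 + (l^*)%C * w != 0 by apply: blaschke_den_neq0 => //; rewrite ws ltW.
  have d0 : 0 < cabs (1 + (l^*)%C * w) by rewrite cabs_gt0.
  rewrite /blaschke cabs_div cabsM ws -mulrA ler_pM2l// ler_pdivrMr//.
  rewrite -(ler_pXn2r (n := 2)) ?nnegrE ?cabs_ge0 ?mulr_ge0 ?cabs_ge0//; last by lra.
  have h := cabs_add_sub l w; rewrite ws -/a in h.
  have d2 : cabs (1 + (l^*)%C * w) <= 2.
    apply: le_trans (cabs_normD _ _) _; rewrite cabs1 cabsM cabs_conj ws -/a; nra.
  have d4 : cabs (1 + (l^*)%C * w) ^+ 2 <= 4.
    by rewrite (_ : 4 = 2 ^+ 2 :> R); [rewrite lerXn2r ?nnegrE ?cabs_ge0|ring].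
  rewrite exprMn; move: h d4; set E := cabs (w + l) ^+ 2; set D := cabs (1 + _) ^+ 2 => h d4.
  have -> : E = D - 4 * k by move: h; rewrite /k; lra.
  have D0 : 0 <= D by rewrite exprn_ge0// cabs_ge0.
  by nra.
pose r1 := Num.max ((a + s) / 2) (s * (1 - k / 4)).
have [ar1 kr1 r1s] : [/\ a < r1, s * (1 - k / 2) < r1 & r1 < s].
  rewrite /r1 !lt_max gt_max; split; first by apply/orP; left; lra.
    by apply/orP; right; nra.
  by apply/andP; split; [lra|nra].
have r10 : 0 < r1 by lra.
pose r2 := r1^-1; pose s2 := s^-1.
have s21 : 1 < s2 by rewrite invf_gt1.
have s2r2 : s2 < r2 by rewrite ltf_pV2 ?posrE.
have tau_s2 w : cabs w = s2 -> r2 < cabs (blaschke l w).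
  move=> ws; have w0 : w != 0 by rewrite -cabs_gt0 ws invr_gt0.
  rewrite blaschke_inv//; set v := (w^*)%C^-1.
  have vs : cabs v = s by rewrite /v cabsV cabs_conj ws invrK.
  have v0 : v != 0 by rewrite -cabs_gt0 vs.
  have vl : v + l != 0.
    rewrite -cabs_gt0; have := cabs_lerB v (- l); rewrite opprK cabsN vs -/a; lra.
  have den : 1 + (l^*)%C * v != 0 by apply: blaschke_den_neq0 => //; rewrite vs ltW.
  have t0 : 0 < cabs (blaschke l v).
    rewrite cabs_gt0 /blaschke; apply: mulf_neq0; first exact: mulf_neq0.
    by rewrite invr_eq0.
  by rewrite ltf_pV2 ?posrE// (le_lt_trans (tau_s v vs)).
have denA w : annulus r1 r2 w -> 1 + (l^*)%C * w != 0.
  move=> /andP[_ w2]; apply: blaschke_den_neq0_lt; rewrite -/a.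
  have : cabs w * r1 < 1 by rewrite -ltr_pdivlMr// div1r.
  have := cabs_ge0 w; nra.
have clos z : closure (annulus s s2) z -> annulus r1 r2 z.
  by move=> /closure_annulus_sub /andP[h1 h2]; apply/andP; split; lra.
exists r1, r2; split; [by apply/andP; split; lra|lra|].
exists (blaschke l); split=> //.
  by move=> z /denA h; apply/derivable_cdiffs/cdiffs_blaschke.
exists s, s2; split.
- by rewrite s0.
- split; exists (annulus r1 r2); split=> //; try exact: open_annulus.
    by move=> z /denA h; apply/derivable_cdiffs/cdiffs_blaschke.
  move=> z Az; apply/derivable_cdiffs/cdiffsV; first exact/cdiffs_blaschke/denA.
  have z0 : z != 0 by rewrite -cabs_gt0; case/andP: Az; lra.
  rewrite /blaschke; apply: mulf_neq0; last by rewrite invr_eq0 denA.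
  apply: mulf_neq0 => //; rewrite -cabs_gt0.
  have := cabs_lerB z (- l); rewrite opprK cabsN -/a; case/andP: Az; lra.
- apply/seteqP; split=> // _ [[w /frontier_annulus_sub hw <-] /closure_annulus_sub /andP[h1 h2]].
  case: hw => [/tau_s|/tau_s2]; [|]; nra.
- exact: clos.
- apply/seteqP; split=> // _ [[w /frontier_annulus_sub hw <-] /closure_annulus_sub /andP[h1 h2]].
  by case: hw => [/tau_s|/tau_s2]; lra.
Qed.

Lemma cdiff_blaschke z : 1 + (l^*)%C * z != 0 ->
  cdiff (blaschke l) z (((l^*)%C * z ^+ 2 + 2 * z + l) / (1 + (l^*)%C * z) ^+ 2).
Proof.
move=> den.
have h1 : cdiff (fun w => w + l) z (1 + 0) by apply: cdiffD; [exact: cdiff_id|exact: cdiff_cst].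
have h2 : cdiff (fun w => 1 + (l^*)%C * w) z (0 + (0 * z + (l^*)%C * 1)).
  by apply: cdiffD; [exact: cdiff_cst|apply: cdiffM; [exact: cdiff_cst|exact: cdiff_id]].
have := cdiffM (cdiffM (cdiff_id z) h1) (cdiffV h2 den).
set d := (X in cdiff _ _ X -> _) => h.
suff <- : d = ((l^*)%C * z ^+ 2 + 2 * z + l) / (1 + (l^*)%C * z) ^+ 2 by [].
by rewrite /d; field.
Qed.

Lemma blaschke_expanding : analytic_expanding_circle_map (blaschke l).
Proof.
split; first by move=> z z1; exact: blaschke_eq1.
have den z : cabs z = 1 -> 1 + (l^*)%C * z != 0.
  by move=> z1; apply: blaschke_den_neq0 => //; rewrite z1.
exists (blaschke l); split=> //.
  exists [set z | 1 + (l^*)%C * z != 0]; split.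
  - apply: cabs_open => z /= z0.
    have cz : ccont (fun w => 1 + (l^*)%C * w) z by ccont_auto.
    have c0 : 0 < cabs (1 + (l^*)%C * z) by rewrite cabs_gt0.
    have [r r0 hr] := cz _ c0; exists r => // w /hr.
    by apply: contraTneq => ->; rewrite sub0r cabsN ltxx.
  - by move=> z; exact: den.
  - by move=> z z0; apply/derivable_cdiffs/cdiffs_blaschke.
pose k := (1 - cabs l ^+ 2) / 4.
have k0 : 0 < k by rewrite divr_gt0 ?sqr_cabs_l.
apply: (@lt_le_trans _ _ (1 + k)); first by rewrite ltrDl.
apply: lb_le_inf; first by exists (cabs (derive1 (blaschke l) 1)), 1 => //; exact: cabs1.
move=> _ [z z1 <-]; rewrite /unit_circle /= in z1.
rewrite (cdiff_derive1 (cdiff_blaschke (den _ z1))).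
set v := (l^*)%C * z; set u := 1 + v.
have zz : z * (z^*)%C = 1 by rewrite mulcJ z1 expr1n.
have -> : (l^*)%C * z ^+ 2 + 2 * z + l = z * (u + (u^*)%C).
  rewrite /u /v !(rmorphD, rmorphM, rmorph1) /=.
  have -> : ((l^*)%C^*)%C = l by exact: conjcK.
  have -> : z * (1 + (l^*)%C * z + (1 + l * (z^*)%C)) =
     (l^*)%C * z ^+ 2 + 2 * z + l * (z * (z^*)%C) by ring.
  by rewrite zz mulr1.
have u0 : 0 < cabs u by rewrite cabs_gt0 den.
have cv : cabs v = cabs l by rewrite /v cabsM cabs_conj z1 mulr1.
have hN : cabs u ^+ 2 + (1 - cabs l ^+ 2) <= cabs (u + (u^*)%C).
  apply: le_trans (cabs_Re _); apply: le_trans (ler_norm _).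
  rewrite -cv !cabs_sqr /u; case: (v) => x y /=; nra.
have u2 : cabs u <= 2.
  by apply: le_trans (cabs_normD _ _) _; rewrite cabs1 cv; move: l1; lra.
rewrite cabs_div cabsM z1 mul1r cabsX ler_pdivlMr ?exprn_gt0//.
apply: le_trans hN; rewrite mulrDl mul1r lerD2l /k.
have : cabs u ^+ 2 <= 4.
  by rewrite (_ : 4 = 2 ^+ 2 :> R); [rewrite lerXn2r ?nnegrE ?cabs_ge0|ring].
have := sqr_cabs_l l1; nra.
Qed.

End BlaschkeAdmissible.

Section EigenvalueIndices.
Variables (R : realType) (l : R[i]).
Hypothesis l1 : cabs l < 1.

Lemma eigval_even n : eigval l n.*2 = l ^+ n.
Proof. by rewrite /eigval odd_double doubleK. Qed.

Lemma eigval_odd n : eigval l n.*2.+1 = (l^*)%C ^+ n.+1.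
Proof. by rewrite /eigval /= odd_double uphalf_double. Qed.

Lemma eigval0 : eigval l 0 = 1.
Proof. by rewrite /eigval /= expr0. Qed.

Lemma conjX n (z : R[i]) : ((z ^+ n)^*)%C = (z^*)%C ^+ n.
Proof. exact: rmorphXn. Qed.

Lemma conj_eq (z : R[i]) : ((z^*)%C = z) <-> complex.Im z = 0.
Proof.
case: z => x y /=; split=> [[] h|->]; last by rewrite oppr0.
by move: h; lra.
Qed.

Lemma uphalf_eq i n : uphalf i = n.+1 <-> i = n.*2.+1 \/ i = n.+1.*2.
Proof.
split=> [|[->|->]]; last 2 first.
- by rewrite /= doubleK.
- by rewrite uphalf_double.
have := odd_double_half i; rewrite uphalf_half; case: (odd i); set k := i./2 => <-.
  by rewrite !add1n => -[->]; left.
by rewrite !add0n => ->; right.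
Qed.

Lemma eigval_uphalf i j : eigval l i != 0 -> eigval l j = eigval l i -> uphalf j = uphalf i.
Proof.
move=> i0 ji; have j0 : eigval l j != 0 by rewrite ji.
apply/eqP; rewrite eqn_leq; apply/andP; split; rewrite leqNgt; apply/negP => h.
  by have := eigval_neq l1 j0 h; rewrite ji eqxx.
by have := eigval_neq l1 i0 h; rewrite ji eqxx.
Qed.

Lemma eigval_eq1 i : eigval l i = 1 <-> exists k : 'I_1, 0%N = i.
Proof.
split=> [h|[_ <-]]; last exact: eigval0.
exists ord0; have : uphalf i = uphalf 0.
  by apply: eigval_uphalf; rewrite eigval0 ?oner_neq0.
by case: i {h}.
Qed.

Lemma eigval_pair n : l ^+ n.+1 != 0 -> complex.Im (l ^+ n.+1) = 0 ->
  forall i, eigval l i = l ^+ n.+1 <->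
  exists k : 'I_2, (if k == ord0 then n.*2.+1 else n.+1.*2) = i.
Proof.
move=> l0 /conj_eq lc i; rewrite conjX in lc; split=> [h|[k <-]].
  have : uphalf i = uphalf n.+1.*2 by apply: eigval_uphalf; rewrite eigval_even.
  rewrite uphalf_double => /uphalf_eq[->|->]; first by exists ord0.
  by exists ord_max.
by case: ifP => _; rewrite ?eigval_odd ?eigval_even.
Qed.

Lemma eigval_single i : eigval l i != 0 -> complex.Im (eigval l i) != 0 ->
  forall j, eigval l j = eigval l i <-> exists k : 'I_1, i = j.
Proof.
move=> i0 im j; split=> [h|[_ ->]//]; exists ord0.
have u := eigval_uphalf i0 h.
have nc : eigval l i <> ((eigval l i)^*)%C.
  by move=> hc; move/eqP: im; apply; apply/conj_eq.
case ui: (uphalf i) => [|n].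
  by case: i ui {i0 im h nc} u => // _; case: j.
rewrite ui in u; case/uphalf_eq: u => ju; case/uphalf_eq: ui => iu; rewrite ?iu ?ju //;
  exfalso; apply: nc; rewrite -{1}h iu ju eigval_odd eigval_even conjX//.
by rewrite conjcK.
Qed.

Lemma eigval_range (mu : R[i]) : (exists i, eigval l i = mu) <->
  (exists n, mu = l ^+ n) \/ (exists n, mu = (l^*)%C ^+ n).
Proof.
split=> [[i <-]|[[n ->]|[n ->]]].
- by rewrite /eigval; case: ifP => _; [right; exists (i./2).+1|left; exists i./2].
- by exists n.*2; rewrite eigval_even.
- case: n => [|n]; first by exists 0%N; rewrite eigval0 expr0.
  by exists n.*2.+1; rewrite eigval_odd.
Qed.

End EigenvalueIndices.

Theorem theorem1p1 (R : realType) (lambda : R[i]) (hlambda : `|lambda| < 1) :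
  exists tau : R[i] -> R[i],
    [/\ analytic_expanding_circle_map tau,
        exists r1 r2 : R, admissible tau r1 r2 &
        forall r1 r2 : R, admissible tau r1 r2 ->
        exists L : {linear Hinf (annulus r1 r2) -> Hinf (annulus r1 r2)},
          [/\ is_transfer_operator tau L /\ continuous L,
              eigenvalues L `\ 0 =
                ([set lambda ^+ n | n in [set: nat]] `|`
                 [set (lambda^*)%C ^+ n | n in [set: nat]]) `\ 0,
              spectrum L =
                [set lambda ^+ n | n in [set: nat]] `|`
                [set (lambda^*)%C ^+ n | n in [set n | (0 < n)%N]] `|`
                [set 0],
              algebraic_multiplicity L 1 1 &
              forall mu : R[i], eigenvalues L mu -> mu != 0 -> mu != 1 ->
                (complex.Im lambda = 0 -> algebraic_multiplicity L mu 2) /\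
                (complex.Im lambda <> 0 ->
                   (complex.Im mu <> 0 -> algebraic_multiplicity L mu 1) /\
                   (complex.Im mu = 0 -> algebraic_multiplicity L mu 2))]].
Proof.
have l1 : cabs lambda < 1 by rewrite -ltcR cabsE.
exists (blaschke lambda); split; [exact: blaschke_expanding|exact: blaschke_admissible|].
move=> r1 r2 /(admissible_radii l1)[s1 [s2 [[r10 rs1 s11 s21 rs2] [tau1 den2 tau2]]]].
have [L [LE cL]] := transfer_linear_operator l1 r10 rs1 s11 s21 rs2 tau1 den2 tau2.
have [e eE] := laurent_basis r10 s21 rs2.
have resL := transfer_resolvent l1 r10 rs1 s11 s21 rs2 tau1 den2 tau2 LE cL eE.
have zeroL := transfer_zero_spectrum l1 r10 rs1 s11 s21 rs2 tau1 den2 tau2 LE eE.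
have eigL := transfer_eigenvalue l1 r10 rs1 s11 s21 rs2 tau1 den2 tau2 LE cL eE.
have multL := transfer_multiplicity l1 r10 rs1 s11 s21 rs2 tau1 den2 tau2 LE cL eE.
have eig_spec mu : eigenvalues L mu -> spectrum L mu.
  move=> [f f0 Lf] [S [_ SK _]]; move/eqP: f0; apply.
  by rewrite -[f]SK Lf subrr linear0.
have spec_eig mu : spectrum L mu -> mu != 0 -> exists i, eigval lambda i = mu.
  move=> smu mu0; apply: contrapT => /forallNP h; apply: smu; apply: resL => // i.
  exact/eqP/h.
exists L; split.
- split=> //; exists 2%N => // z z1; exists (blaschke_branch lambda z); split.
    exact: local_branches.
  move=> f; have [w1 [w2 [[cw1 cw2 w12] [sum prod ->]]]] := branch_sum l1 f z1.
  rewrite LE; last by rewrite annulusP z1 (lt_trans rs1 s11) (lt_trans s21 rs2).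
  exact: (transfer_roots l1 r10 rs1 s11 s21 rs2 den2).
- apply/seteqP; split=> mu [h mu0]; split=> //.
    have [|i hi] := spec_eig mu (eig_spec _ h); first exact/eqP.
    have /eigval_range[[n ->]|[n ->]] : exists i, eigval lambda i = mu by exists i.
      by left; exists n.
    by right; exists n.
  have [i hi] : exists i, eigval lambda i = mu.
    by apply/eigval_range; case: h => [[n _ <-]|[n _ <-]]; [left; exists n|right; exists n].
  by rewrite -hi; apply: eigL; rewrite hi; apply/eqP.
- apply/seteqP; split=> mu.
    move=> smu; have [->|mu0] := eqVneq mu 0; first by right.
    left; have [i <-] := spec_eig _ smu mu0; rewrite /eigval; case: ifP => _.
      by right; exists (i./2).+1.
    by left; exists i./2.
  have val i : spectrum L (eigval lambda i).
    have [->//|i0] := eqVneq (eigval lambda i) 0.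
    exact/eig_spec/eigL.
  case=> [[[n _ <-]|[n n0 <-]]|-> //].
    by rewrite -eigval_even.
  by case: n n0 => // n _; rewrite -eigval_odd.
- apply: (multL _ _ (fun=> 0%N)); [exact: oner_neq0|by move=> i j _; rewrite !ord1|].
  by move=> i; exact: eigval_eq1.
move=> mu emu mu0 mu1.
have [i iE] := spec_eig _ (eig_spec _ emu) mu0.
have [n nE] : exists n, uphalf i = n.+1.
  case: i iE => [|i]; first by rewrite eigval0 => h; rewrite h eqxx in mu1.
  by exists i./2.
have muE : mu = lambda ^+ n.+1 \/ mu = (lambda ^+ n.+1)^*%C.
  rewrite -iE; case/uphalf_eq: nE => ->; [right|left]; last exact: eigval_even.
  by rewrite eigval_odd conjX.
have pair : complex.Im mu = 0 -> algebraic_multiplicity L mu 2.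
  move=> im0; have muE' : mu = lambda ^+ n.+1.
    by case: muE => // h; rewrite -((conj_eq mu).2 im0) h conjcK.
  apply: (multL _ _ (fun k : 'I_2 => if k == ord0 then n.*2.+1 else n.+1.*2)) => //.
    move=> k k' /(congr1 odd).
    have max (x : 'I_2) : x != ord0 -> x = ord_max by case: x => [[|[|//]] p] // _; exact: val_inj.
    case: (eqVneq k ord0) => [->|/max ->]; case: (eqVneq k' ord0) => [->|/max ->] //.
      by rewrite /= !odd_double.
    by rewrite /= !odd_double.
  rewrite muE'; apply: eigval_pair => //; rewrite -muE' //.
split=> [iml|_]; last split=> [imn|] //.
  apply: pair; apply/conj_eq; have hl := (conj_eq lambda).2 iml.
  by case: muE => ->; rewrite ?conjX ?hl// -conjX hl.
apply: (multL _ _ (fun=> i)) => //; first by move=> x y _; rewrite !ord1.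
move=> j; rewrite -iE; apply: eigval_single => //; first by rewrite iE.
by rewrite iE; apply/eqP.
Qed.
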